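(* Let $p$ be a prime and $c$ a positive integer with $p>c$. There is a polynomial-time algorithm $A$ which, given the Cayley tables of two groups $G$ and $H$ from $\mathfrak{B}(p,c,N)$, outputs the Cayley tables of groups $A(G)$ and $A(H)$ in $\mathfrak{B}(p,2,\mathrm{poly}(N))$ (i.e. of order bounded by a polynomial in $N$), such that $G\cong H$ if and only if $A(G)\cong A(H)$.
   Context: For a prime $p$ and integers $c,N\ge 1$, $\mathfrak{B}(p,c,N)$ denotes the set of finite $p$-groups of nilpotency class $c$ (length of the lower central series), exponent $p$, and order $N$. Groups are given by their Cayley tables (full multiplication tables); polynomial time means polynomial in $N$.
   Formalization: The case p = 2, c = 1 is excluded: there the claim fails, since every group of exponent 2 is abelian, so no group of exponent 2 and nilpotency class 2 exists to serve as A(G), although B(2,1,N) is nonempty (e.g. the group of order 2). *)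

(* Defs.v *)
From HB Require Import structures.
From mathcomp Require Import all_boot all_order all_algebra.
From mathcomp Require Import all_fingroup all_solvable.

Set Implicit Arguments.
Unset Strict Implicit.
Unset Printing Implicit Defensive.

(** Random access machines, presented as structured programs.  A machine has
    registers (indexed by [nat], finitely many occurring in a given program)
    and a separate memory with indirect addressing; every cell holds a natural
    number.  The time is the uniform (unit) cost.  There is no multiplication
    instruction, so the bit length of the cells and addresses grows by at most
    one per step (beyond the largest constant of the program and of the input),
    and polynomial time here is polynomial time on Turing machines
    (Cook and Reckhow). *)

Inductive prog : Type :=
  | Const (x k : nat)           (* x := k *)
  | Copy (x y : nat)            (* x := y *)
  | Add (x y z : nat)           (* x := y + z *)
  | Sub (x y z : nat)           (* x := y - z, truncated at 0 *)
  | Fetch (x y : nat)            (* x := mem[y] *)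
  | Store (x y : nat)           (* mem[x] := y *)
  | Seq (P Q : prog)
  | If (x : nat) (P Q : prog)   (* P if x <> 0, else Q *)
  | While (x : nat) (P : prog). (* repeat P as long as x <> 0 *)

Record state := State { reg : nat -> nat; mem : nat -> nat }.

Definition upd (f : nat -> nat) (i v : nat) : nat -> nat :=
  fun j => if j == i then v else f j.

Definition set_reg (s : state) (x v : nat) := State (upd (reg s) x v) (mem s).
Definition set_mem (s : state) (a v : nat) := State (reg s) (upd (mem s) a v).

(** [exec P s t s']: started in [s], [P] halts after exactly [t] steps in
    [s']. *)
Inductive exec : prog -> state -> nat -> state -> Prop :=
  | ExecConst s x k : exec (Const x k) s 1 (set_reg s x k)
  | ExecCopy s x y : exec (Copy x y) s 1 (set_reg s x (reg s y))
  | ExecAdd s x y z : exec (Add x y z) s 1 (set_reg s x (reg s y + reg s z))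
  | ExecSub s x y z : exec (Sub x y z) s 1 (set_reg s x (reg s y - reg s z))
  | ExecFetch s x y : exec (Fetch x y) s 1 (set_reg s x (mem s (reg s y)))
  | ExecStore s x y : exec (Store x y) s 1 (set_mem s (reg s x) (reg s y))
  | ExecSeq P Q s1 s2 s3 t1 t2 of exec P s1 t1 s2 & exec Q s2 t2 s3 :
      exec (Seq P Q) s1 (t1 + t2) s3
  | ExecIfT x P Q s t s' of reg s x != 0 & exec P s t s' :
      exec (If x P Q) s t.+1 s'
  | ExecIfF x P Q s t s' of reg s x = 0 & exec Q s t s' :
      exec (If x P Q) s t.+1 s'
  | ExecWhileF x P s of reg s x = 0 : exec (While x P) s 1 s
  | ExecWhileT x P s1 s2 s3 t1 t2 of reg s1 x != 0 & exec P s1 t1 s2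
      & exec (While x P) s2 t2 s3 :
      exec (While x P) s1 (t1 + t2).+1 s3.

(** Words are passed through memory: cell 0 holds the length and the letters
    follow from cell 1 on.  Initially every other cell is 0. *)
Definition input_state (w : seq nat) : state :=
  State (fun=> 0) (fun i => nth 0 (size w :: w) i).

Definition output_word (s : state) : seq nat :=
  mkseq (fun i => mem s i.+1) (mem s 0).

Definition outputs_within (A : prog) (w : seq nat) (t : nat) (w' : seq nat) :
    Prop :=
  exists t' s', [/\ t' <= t, exec A (input_state w) t' s' & output_word s' = w'].

(** [w] is the multiplication table of [G], row by row, for some listing [s]
    of the elements of [G]; an element is named by its position in [s]. *)
Definition cayley_table (gT : finGroupType) (G : {group gT}) (w : seq nat) :
    Prop :=
  exists s : seq gT,
    [/\ uniq s, s =i G & w = [seq index (x * y)%g s | x <- s, y <- s]].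

(** Note that the nilpotency class is exactly [c]. *)
Definition in_B (p c N : nat) (gT : finGroupType) (G : {group gT}) : Prop :=
  [/\ (p.-group G)%g, nil_class G = c, exponent G = p & #|G| = N].

(** Programs are deterministic, so a program induces a partial function on
    words. *)
Lemma exec_det P s t1 s1 t2 s2 :
  exec P s t1 s1 -> exec P s t2 s2 -> t1 = t2 /\ s1 = s2.
Proof.
move=> e1; elim: e1 t2 s2 => {P s t1 s1}
  [s x k|s x y|s x y z|s x y z|s x y|s x y|P Q s1 s2 s3 t1 t2 _ IH1 _ IH2
  |x P Q s t s' x0 _ IH|x P Q s t s' x0 _ IH|x P s x0
  |x P s1 s2 s3 t1 t2 x0 _ IH1 _ IH2] t' r e; inversion e; subst=> //;
  try by match goal with
    | h : is_true (reg _ _ != 0), h' : reg _ _ = 0 |- _ => rewrite h' in h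
    end.
- by case: (IH1 _ _ ltac:(eassumption)) => -> ?; subst;
    case: (IH2 _ _ ltac:(eassumption)) => -> ->.
- by case: (IH _ _ ltac:(eassumption)) => -> ->.
- by case: (IH _ _ ltac:(eassumption)) => -> ->.
- by case: (IH1 _ _ ltac:(eassumption)) => -> ?; subst;
    case: (IH2 _ _ ltac:(eassumption)) => -> ->.
Qed.

(* Main.v *)
Require Import Defs.
From HB Require Import structures.
From mathcomp Require Import all_boot all_order all_algebra.
From mathcomp Require Import all_fingroup all_solvable all_character.
From mathcomp Require Import zify ring.

Set Implicit Arguments.
Unset Strict Implicit.
Unset Printing Implicit Defensive.

Import GRing.Theory.
Local Open Scope ring_scope.

(** The Lazard correspondence is realised by group words.  In the free
    associative algebra over [F_p] truncated above degree [c < p], a unipotent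
    [u] lies in the group generated by the [exp X_a] if and only if conjugation
    by [u] preserves Lie elements and [u^-1 E(u)] is Lie, with [E] the Euler
    derivation.  Hence [exp (X + Y)] and [exp [X, Y]] are words in [exp X] and
    [exp Y].  By the Dynkin map this group is relatively free of class [c] and
    exponent [p], so the two words turn every such group [G] into a nilpotent
    Lie algebra [L] over [F_p], from which the group law is recovered.

    The group [A(G)] is the central extension of [V = L + F_p^2] by [L + L] with
    cocycle [([x, y] + s y, t y)], where [s] and [t] are the coordinates of the
    left argument in [F_p^2].  The subspace [F_p^2] of [V] is recognised by the
    sizes of centralizers, so an isomorphism induces an additive map [f] on [L]
    with [2 alpha f[x, y] = 2 [f x, f y] + a(x) f y - a(y) f x].  Nilpotency
    forces [a = 0], and [alpha^-1 f] is then an isomorphism of Lie algebras.  In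
    class one the isomorphism type is determined by the order instead.

    Every entry of the table of [A(G)] is a fixed expression in the table of
    [G], so the algorithm is a nest of loops over that table. *)

(** * Truncated free associative algebras *)

Section Convolution.
Variables (A : Type) (R : comNzRingType).
Implicit Types (f g h : seq A -> R) (u w : seq A).

Definition conv f g w : R := \sum_(i < (size w).+1) f (take i w) * g (drop i w).
Definition conv_unit w : R := (nilp w)%:R.

Lemma conv_nil f g : conv f g [::] = f [::] * g [::].
Proof. by rewrite /conv big_ord1. Qed.

Lemma conv_cons f g a w :
  conv f g (a :: w) = f [::] * g (a :: w) + conv (fun u => f (a :: u)) g w.
Proof. by rewrite /conv big_ord_recl take0 drop0. Qed.

Lemma eq_conv f f' g g' w :
  (forall u, (size u <= size w)%N -> f u = f' u) ->
  (forall u, (size u <= size w)%N -> g u = g' u) ->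
  conv f g w = conv f' g' w.
Proof.
move=> eqf eqg; apply: eq_bigr => i _.
by rewrite eqf ?eqg // ?size_drop ?leq_subr // size_take_min geq_minr.
Qed.

Lemma convDl f f' g w : conv (fun u => f u + f' u) g w = conv f g w + conv f' g w.
Proof. by rewrite /conv -big_split; apply: eq_bigr => i _; rewrite mulrDl. Qed.

Lemma convDr f g g' w : conv f (fun u => g u + g' u) w = conv f g w + conv f g' w.
Proof. by rewrite /conv -big_split; apply: eq_bigr => i _; rewrite mulrDr. Qed.

Lemma convZl k f g w : conv (fun u => k * f u) g w = k * conv f g w.
Proof. by rewrite /conv mulr_sumr; apply: eq_bigr => i _; rewrite mulrA. Qed.

Lemma convZr k f g w : conv f (fun u => k * g u) w = k * conv f g w.
Proof. by rewrite /conv mulr_sumr; apply: eq_bigr => i _; rewrite mulrCA. Qed.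

Lemma convA f g h w : conv f (conv g h) w = conv (conv f g) h w.
Proof.
elim: w f => [|a w IHw] f; first by rewrite !conv_nil mulrA.
rewrite !conv_cons conv_nil IHw mulrDr mulrA -addrA -convZl -convDl.
by congr (_ + _); apply: eq_conv => // u _; rewrite conv_cons.
Qed.

Lemma conv_eq0 f g w :
  (forall i, (i <= size w)%N -> f (take i w) = 0 \/ g (drop i w) = 0) -> conv f g w = 0.
Proof.
move=> fg0; apply: big1 => i _; have lti := ltn_ord i.
by have [->|->] := fg0 i lti; rewrite ?mul0r ?mulr0.
Qed.

Lemma conv_single i f g w : (i <= size w)%N ->
  (forall j, (j <= size w)%N -> j != i -> f (take j w) = 0 \/ g (drop j w) = 0) ->
  conv f g w = f (take i w) * g (drop i w).
Proof.
move=> lei fg0; rewrite /conv (bigD1 (Ordinal (lei : (i < (size w).+1)%N))) //=.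
rewrite big1 ?addr0 // => j neqji.
by have [//|->|->] := fg0 j (ltn_ord j); rewrite ?mul0r ?mulr0.
Qed.

Lemma conv_unitl g w : conv conv_unit g w = g w.
Proof.
rewrite (conv_single (i := 0%N)) ?take0 ?drop0 ?mul1r // => j lej j0.
by left; rewrite /conv_unit /nilp size_takel // (negPf j0).
Qed.

Lemma conv_unitr f w : conv f conv_unit w = f w.
Proof.
rewrite (conv_single (i := size w)) ?take_size ?drop_size ?mulr1 // => j lej neqj.
by right; rewrite /conv_unit /nilp size_drop subn_eq0 leqNgt ltn_neqAle neqj lej.
Qed.

Lemma conv_size f g w :
  (size w)%:R * conv f g w =
  conv (fun u => (size u)%:R * f u) g w + conv f (fun u => (size u)%:R * g u) w.
Proof.
rewrite /conv mulr_sumr -big_split; apply: eq_bigr => i _ /=.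
by rewrite -{1}(cat_take_drop i w) size_cat natrD; ring.
Qed.

End Convolution.

Definition tfalg (A : finType) (R : comNzRingType) (c : nat) := {ffun c.-bseq A -> R^o}.

Section TruncatedFreeAlgebra.
Variables (A : finType) (R : comNzRingType) (c : nat).
Local Notation T := (tfalg A R c).

HB.instance Definition _ := GRing.Lmodule.on T.

Implicit Types (f g : T) (u w : seq A).

Definition coefw f w : R := if insub w is Some b then f b else 0.
Definition tfalg_of (h : seq A -> R) : T := [ffun b : c.-bseq A => h b].

Lemma coefw_of h w : (size w <= c)%N -> coefw (tfalg_of h) w = h w.
Proof. by move=> lew; rewrite /coefw (insubT (fun w => size w <= c)%N lew) ffunE. Qed.

Lemma coefw_default f w : (c < size w)%N -> coefw f w = 0.
Proof. by move=> ltw; rewrite /coefw insubF // leqNgt ltw. Qed.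

Lemma tfalgP f g : (forall w, (size w <= c)%N -> coefw f w = coefw g w) -> f = g.
Proof.
move=> eqfg; apply/ffunP=> b; have := eqfg b (size_bseq b).
by rewrite /coefw valK.
Qed.

Lemma coefw0 w : coefw 0 w = 0.
Proof. by rewrite /coefw; case: insub => // b; rewrite ffunE. Qed.

Lemma coefwD f g w : coefw (f + g) w = coefw f w + coefw g w.
Proof. by rewrite /coefw; case: insub => [b|]; rewrite ?ffunE ?addr0. Qed.

Lemma coefwN f w : coefw (- f) w = - coefw f w.
Proof. by rewrite /coefw; case: insub => [b|]; rewrite ?ffunE ?oppr0. Qed.

Lemma coefwB f g w : coefw (f - g) w = coefw f w - coefw g w.
Proof. by rewrite coefwD coefwN. Qed.

Lemma coefwZ k f w : coefw (k *: f) w = k * coefw f w.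
Proof. by rewrite /coefw; case: insub => [b|]; rewrite ?ffunE ?mulr0. Qed.

Definition tfalg_one : T := tfalg_of (@conv_unit A R).
Definition tfalg_mul f g : T := tfalg_of (conv (coefw f) (coefw g)).

Fact tfalg_mulA : associative tfalg_mul.
Proof.
move=> f g h; apply: tfalgP => w lew; rewrite !coefw_of //.
transitivity (conv (coefw f) (conv (coefw g) (coefw h)) w).
  by apply: eq_conv => // u leu; rewrite coefw_of // (leq_trans leu).
rewrite convA; apply: eq_conv => // u leu.
by rewrite coefw_of // (leq_trans leu).
Qed.

Fact tfalg_mul1l : left_id tfalg_one tfalg_mul.
Proof.
move=> f; apply: tfalgP => w lew; rewrite coefw_of // -[RHS]conv_unitl.
by apply: eq_conv => // u leu; rewrite coefw_of // (leq_trans leu).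
Qed.

Fact tfalg_mul1r : right_id tfalg_one tfalg_mul.
Proof.
move=> f; apply: tfalgP => w lew; rewrite coefw_of // -[RHS]conv_unitr.
by apply: eq_conv => // u leu; rewrite coefw_of // (leq_trans leu).
Qed.

Fact tfalg_mulDl : left_distributive tfalg_mul +%R.
Proof.
move=> f g h; apply: tfalgP => w lew; rewrite coefwD !coefw_of // -convDl.
by apply: eq_conv => // u _; rewrite coefwD.
Qed.

Fact tfalg_mulDr : right_distributive tfalg_mul +%R.
Proof.
move=> f g h; apply: tfalgP => w lew; rewrite coefwD !coefw_of // -convDr.
by apply: eq_conv => // u _; rewrite coefwD.
Qed.

Fact tfalg_one_neq0 : tfalg_one != 0.
Proof. by apply/eqP=> /(congr1 (coefw^~ [::])) /eqP; rewrite coefw0 coefw_of ?oner_eq0. Qed.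

HB.instance Definition _ := GRing.Zmodule_isNzRing.Build T
  tfalg_mulA tfalg_mul1l tfalg_mul1r tfalg_mulDl tfalg_mulDr tfalg_one_neq0.

Lemma coefwM f g w : (size w <= c)%N -> coefw (f * g) w = conv (coefw f) (coefw g) w.
Proof. exact: coefw_of. Qed.

Fact tfalg_scaleAl (k : R) f g : k *: (f * g) = (k *: f) * g.
Proof.
apply: tfalgP => w lew; rewrite coefwZ !coefwM // -convZl.
by apply: eq_conv => // u _; rewrite coefwZ.
Qed.

HB.instance Definition _ := GRing.Lmodule_isLalgebra.Build R T tfalg_scaleAl.

Fact tfalg_scaleAr (k : R) f g : k *: (f * g) = f * (k *: g).
Proof.
apply: tfalgP => w lew; rewrite coefwZ !coefwM // -convZr.
by apply: eq_conv => // u _; rewrite coefwZ.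
Qed.

HB.instance Definition _ := GRing.Lalgebra_isAlgebra.Build R T tfalg_scaleAr.

Lemma coefw1 w : coefw 1 w = (nilp w)%:R.
Proof.
have [lew|ltw] := leqP (size w) c; first by rewrite coefw_of.
by rewrite coefw_default //; case: w ltw.
Qed.

Definition letter (a : A) : T := tfalg_of (fun w => (w == [:: a])%:R).

Lemma coefw_letterM a f b w : (size w < c)%N ->
  coefw (letter a * f) (b :: w) = (b == a)%:R * coefw f w.
Proof.
move=> ltw; rewrite coefwM // (conv_single (i := 1%N)) //= => [|[|[|j]] lej // _].
- by rewrite take0 drop0 coefw_of ?(leq_ltn_trans _ ltw) // eqseq_cons andbT.
- by left; rewrite coefw_of.
left; have [lec|ltc] := leqP (size (take j.+2 (b :: w))) c; last exact: coefw_default.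
by rewrite coefw_of //= eqseq_cons -size_eq0 size_takel // andbF.
Qed.

Lemma coefwM_letter a f b w : (size w < c)%N ->
  coefw (f * letter a) (rcons w b) = (b == a)%:R * coefw f w.
Proof.
move=> ltw; rewrite coefwM ?size_rcons // (conv_single (i := size w)) ?size_rcons //.
  rewrite -cats1 take_size_cat // drop_size_cat // mulrC.
  by rewrite coefw_of ?(leq_ltn_trans _ ltw) // eqseq_cons andbT.
move=> j lej /eqP neqj; right.
rewrite coefw_of ?size_drop ?size_rcons; last by lia.
by case: eqP => // /(congr1 size); rewrite size_drop size_rcons /=; lia.
Qed.

(* The [k]-th power of the augmentation ideal. *)
Definition aug k : {pred T} := fun f => [forall b : c.-bseq A, (size b < k)%N ==> (f b == 0)].

Lemma augP k f : reflect (forall w, (size w < k)%N -> coefw f w = 0) (f \in aug k).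
Proof.
apply: (iffP forallP) => [f0 w ltw|f0 b].
  by rewrite /coefw; case: insubP => // b _ eqb; apply/eqP/(implyP (f0 b)); rewrite eqb.
by apply/implyP => ltb; rewrite -(f0 b ltb) /coefw valK.
Qed.

Fact aug_submod_closed k : submod_closed (aug k).
Proof.
split=> [|x f g /augP f0 /augP g0]; apply/augP=> w ltw; first exact: coefw0.
by rewrite coefwD coefwZ f0 ?g0 // mulr0 addr0.
Qed.
HB.instance Definition _ k := GRing.isSubmodClosed.Build R T (aug k) (aug_submod_closed k).

Lemma aug_le k l f : (k <= l)%N -> f \in aug l -> f \in aug k.
Proof. by move=> lekl /augP f0; apply/augP => w ltw; apply/f0/(leq_trans ltw). Qed.

Lemma aug_eq0 f : f \in aug c.+1 -> f = 0.
Proof. by move=> /augP f0; apply: tfalgP => w lew; rewrite coefw0 f0. Qed.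

Lemma aug_eq0_gt k f : (c < k)%N -> f \in aug k -> f = 0.
Proof. by move=> ltk fk; apply/aug_eq0/(aug_le ltk). Qed.

Lemma augM k l f g : f \in aug k -> g \in aug l -> f * g \in aug (k + l)%N.
Proof.
move=> /augP f0 /augP g0; apply/augP => w ltw.
have [lew|ltc] := leqP (size w) c; last exact: coefw_default.
rewrite coefwM // conv_eq0 // => i lei; have [lti|leki] := ltnP i k.
  by left; rewrite f0 // size_takel.
by right; rewrite g0 // size_drop; lia.
Qed.

Lemma augMr k f g : f \in aug k -> f * g \in aug k.
Proof. by move=> fk; rewrite -[k]addn0; apply: augM => //; apply/augP. Qed.

Lemma augMl k f g : g \in aug k -> f * g \in aug k.
Proof. by move=> gk; rewrite -[k]add0n; apply: augM => //; apply/augP. Qed.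

Lemma augX k f n : f \in aug k -> f ^+ n \in aug (n * k)%N.
Proof.
by move=> fk; elim: n => [|n IHn]; [apply/augP | rewrite exprS mulSn; apply: augM].
Qed.

Lemma aug1X f n : f \in aug 1 -> f ^+ n \in aug n.
Proof. by move=> f1; have := augX n f1; rewrite muln1. Qed.

Lemma letter_aug a : letter a \in aug 1.
Proof. by apply/augP => -[|//] _; rewrite coefw_of. Qed.

Lemma sub1_aug1 f : (f - 1 \in aug 1) = (coefw f [::] == 1).
Proof.
have coef0 : coefw (f - 1) [::] = coefw f [::] - 1 by rewrite coefwB coefw1.
rewrite -subr_eq0 -coef0; apply/augP/eqP => [f0|f0 [|//] _]; last exact: f0.
exact: f0.
Qed.

Definition homog_part i f : T := tfalg_of (fun w => (size w == i)%:R * coefw f w).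
Definition euler f : T := tfalg_of (fun w => (size w)%:R * coefw f w).

Lemma coefw_homog_part i f w : coefw (homog_part i f) w = (size w == i)%:R * coefw f w.
Proof.
have [lew|ltw] := leqP (size w) c; first by rewrite coefw_of.
by rewrite !coefw_default // mulr0.
Qed.

Lemma coefw_euler f w : coefw (euler f) w = (size w)%:R * coefw f w.
Proof.
have [lew|ltw] := leqP (size w) c; first by rewrite coefw_of.
by rewrite !coefw_default // mulr0.
Qed.

Fact homog_part_is_linear i : linear (homog_part i).
Proof.
move=> k f g; apply: tfalgP => w _.
by rewrite coefwD coefwZ !coefw_homog_part coefwD coefwZ mulrDr mulrCA.
Qed.
HB.instance Definition _ i :=
  GRing.isLinear.Build R T T *:%R (homog_part i) (homog_part_is_linear i).

Fact euler_is_linear : linear euler.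
Proof.
move=> k f g; apply: tfalgP => w _.
by rewrite coefwD coefwZ !coefw_euler coefwD coefwZ mulrDr mulrCA.
Qed.
HB.instance Definition _ := GRing.isLinear.Build R T T *:%R euler euler_is_linear.

Lemma eulerM f g : euler (f * g) = euler f * g + f * euler g.
Proof.
apply: tfalgP => w lew; rewrite coefwD coefw_euler !coefwM // conv_size.
by congr (_ + _); apply: eq_conv => // u _; rewrite coefw_euler.
Qed.

Lemma euler1 : euler 1 = 0.
Proof. by have /eqP := eulerM 1 1; rewrite !mulr1 mul1r addrC -subr_eq subrr => /eqP. Qed.

Lemma euler_aug k f : f \in aug k -> euler f \in aug k.
Proof. by move=> /augP f0; apply/augP => w ltw; rewrite coefw_euler f0 ?mulr0. Qed.

Lemma homog_part_aug i f : homog_part i f \in aug i.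
Proof. by apply/augP => w ltw; rewrite coefw_homog_part ltn_eqF ?mul0r. Qed.

Lemma homog_part_eq0 i f : f \in aug i.+1 -> homog_part i f = 0.
Proof.
move=> /augP f0; apply: tfalgP => w _; rewrite coefw_homog_part coefw0.
by case: eqP => [szw|_]; rewrite ?mul0r // f0 ?mulr0 // szw.
Qed.

Lemma homog_part_small i f : (c < i)%N -> homog_part i f = 0.
Proof. by move=> lti; apply: (aug_eq0_gt lti); apply: homog_part_aug. Qed.

Lemma subr_homog_part_aug i f : f \in aug i -> f - homog_part i f \in aug i.+1.
Proof.
move=> /augP f0; apply/augP => w; rewrite ltnS coefwB coefw_homog_part leq_eqVlt.
by case/predU1P=> [->|ltw]; rewrite ?eqxx ?mul1r ?subrr // f0 // mulr0 subrr.
Qed.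

Lemma homog_part_sub1 i f : (0 < i)%N -> homog_part i (f - 1) = homog_part i f.
Proof.
move=> i_gt0; rewrite raddfB /= [X in _ - X](_ : _ = 0) ?subr0 //.
apply: tfalgP => w _; rewrite coefw_homog_part coefw1 coefw0.
by case: eqP => [szw|_]; rewrite ?mul0r // /nilp szw (gtn_eqF i_gt0) mulr0.
Qed.

Lemma sum_homog_part f : \sum_(i < c.+1) homog_part i f = f.
Proof.
apply: tfalgP => w lew.
have -> (s : seq 'I_c.+1) : coefw (\sum_(i <- s) homog_part i f) w =
    \sum_(i <- s) (size w == i)%:R * coefw f w.
  by elim/big_rec2: _ => [|i x g _ <-]; rewrite ?coefw0 // coefwD coefw_homog_part.
rewrite -mulr_suml (bigD1 (Ordinal (lew : (size w < c.+1)%N))) //= eqxx.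
by rewrite big1 ?addr0 ?mul1r // => i; rewrite -val_eqE eq_sym => /negPf->.
Qed.

Definition homog i : {pred T} := fun f => homog_part i f == f.

Lemma homogP i f : reflect (homog_part i f = f) (f \in homog i).
Proof. exact: eqP. Qed.

Fact homog_submod_closed i : submod_closed (homog i).
Proof.
split=> [|x f g /homogP fi /homogP gi]; apply/homogP; first by rewrite linear0.
by rewrite linearP /= fi gi.
Qed.
HB.instance Definition _ i := GRing.isSubmodClosed.Build R T (homog i) (homog_submod_closed i).

Lemma homog_coefw i f w : f \in homog i -> size w != i -> coefw f w = 0.
Proof. by move=> /homogP<- /negPf neq; rewrite coefw_homog_part neq mul0r. Qed.

Lemma homog_aug i f : f \in homog i -> f \in aug i.
Proof. by move=> /homogP<-; apply: homog_part_aug. Qed.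

Lemma homog_part_homog i f : homog_part i f \in homog i.
Proof.
apply/homogP/tfalgP => w _; rewrite !coefw_homog_part mulrA.
by case: eqP; rewrite ?mul0r ?mulr1.
Qed.

Lemma homog_part_of_homog i j f : f \in homog i -> homog_part j f = if j == i then f else 0.
Proof.
move=> fi; case: eqP => [->|/eqP neqji]; first exact/homogP.
apply: tfalgP => w _; rewrite coefw_homog_part coefw0.
by case: eqP => [szw|]; rewrite ?mul0r // (homog_coefw fi) ?mulr0 ?szw.
Qed.

Lemma euler_homog i f : f \in homog i -> euler f = i%:R *: f.
Proof.
move=> fi; apply: tfalgP => w _; rewrite coefw_euler coefwZ.
by have [->//|neq] := eqVneq (size w) i; rewrite (homog_coefw fi neq) !mulr0.
Qed.

Lemma homog0_1 : 1 \in homog 0.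
Proof.
by apply/homogP/tfalgP => w _; rewrite coefw_homog_part coefw1 /nilp -natrM mulnb andbb.
Qed.

Lemma letter_homog a : letter a \in homog 1.
Proof.
apply/homogP/tfalgP => w lew; rewrite coefw_homog_part coefw_of //.
by case: eqP => [_|neq]; rewrite ?mul1r // mul0r; case: eqP neq => // ->.
Qed.

Lemma homogM i j f g : f \in homog i -> g \in homog j -> f * g \in homog (i + j)%N.
Proof.
move=> fi gj; apply/homogP/tfalgP => w lew; rewrite coefw_homog_part.
have [_|neq] := eqVneq; rewrite ?mul1r // mul0r coefwM // conv_eq0 // => k lek.
have [eqk|neqk] := eqVneq k i.
  by right; rewrite (homog_coefw gj) // size_drop; move/eqP: neq; lia.
by left; rewrite (homog_coefw fi) // size_takel.
Qed.

Lemma homog_partM i j f g : f \in aug i -> g \in aug j ->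
  homog_part (i + j)%N (f * g) = homog_part i f * homog_part j g.
Proof.
move=> fi gj; rewrite -{1}(subrK (homog_part i f) f) mulrDl linearD /=.
rewrite [X in X + _]homog_part_eq0 ?add0r; last first.
  by rewrite -addSn; apply: augM => //; apply: subr_homog_part_aug.
rewrite -{1}(subrK (homog_part j g) g) mulrDr linearD /=.
rewrite [X in X + _]homog_part_eq0 ?add0r; last first.
  by rewrite -addnS; apply: augM; [apply: homog_part_aug | apply: subr_homog_part_aug].
by apply/homogP/homogM; apply: homog_part_homog.
Qed.

Lemma homog_part_homogMl i j f g : f \in homog i ->
  homog_part (i + j)%N (f * g) = f * homog_part j g.
Proof.
move=> fi; rewrite -{1}(sum_homog_part g) mulr_sumr linear_sum /=.
under eq_bigr => k _ do
  rewrite (homog_part_of_homog _ (homogM fi (homog_part_homog k g))) eqn_add2l.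
have [ltj|lejc] := ltnP c j.
  rewrite (homog_part_small _ ltj) mulr0 big1 // => k _.
  by rewrite gtn_eqF // (leq_trans (ltn_ord k)).
rewrite (bigD1 (Ordinal (lejc : (j < c.+1)%N))) //= eqxx big1 ?addr0 // => k.
by rewrite -val_eqE eq_sym => /negPf->.
Qed.

Lemma homog_part_homogMr i j f g : g \in homog j ->
  homog_part (i + j)%N (f * g) = homog_part i f * g.
Proof.
move=> gj; rewrite -{1}(sum_homog_part f) mulr_suml linear_sum /=.
under eq_bigr => k _ do
  rewrite (homog_part_of_homog _ (homogM (homog_part_homog k f) gj)) eqn_add2r.
have [lti|leic] := ltnP c i.
  rewrite (homog_part_small _ lti) mul0r big1 // => k _.
  by rewrite gtn_eqF // (leq_trans (ltn_ord k)).
rewrite (bigD1 (Ordinal (leic : (i < c.+1)%N))) //= eqxx big1 ?addr0 // => k.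
by rewrite -val_eqE eq_sym => /negPf->.
Qed.

End TruncatedFreeAlgebra.

Arguments letter {A R c} a.

Lemma truncated_cauchy_product (R : pzRingType) (c : nat) (U V : nat -> R) :
  (forall m k, (c < m + k)%N -> U m * V k = 0) ->
  (\sum_(0 <= m < c.+1) U m) * (\sum_(0 <= k < c.+1) V k) =
  \sum_(0 <= n < c.+1) \sum_(0 <= k < n.+1) U (n - k)%N * V k.
Proof.
move=> UV0; under [RHS]eq_big_nat => n /andP[_ ltn] do
  rewrite (@big_nat_widen _ _ _ 0 n.+1 c.+1) //.
rewrite mulr_sumr (exchange_big_dep_nat predT) //=.
apply: eq_big_nat => k /andP[_ ltk]; rewrite mulr_suml.
rewrite -(@big_nat_widenl _ _ _ k 0 c.+1 predT) // -{2}[k]add0n big_addn.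
rewrite [LHS](@big_cat_nat _ _ _ (c.+1 - k)%N) ?leq_subr //=.
rewrite [X in _ + X = _]big_nat [X in _ + X = _]big1 ?addr0 => [|m /andP[lem _]].
  by apply: eq_bigr => m _; rewrite addnK.
by rewrite UV0 //; lia.
Qed.

Section SumsOverTuples.
Variables (A : finType) (V : nmodType).
Implicit Types F : seq A -> V.

Lemma sum_tuple0 F : \sum_(u : 0.-tuple A) F u = F [::].
Proof.
by rewrite (big_pred1 [tuple]) // => u; rewrite [u]tuple0; apply/esym/eqP.
Qed.

Lemma sum_tuple_cons k F :
  \sum_(w : k.+1.-tuple A) F w = \sum_x \sum_(u : k.-tuple A) F (x :: u).
Proof.
rewrite pair_big /= (reindex (fun xu : A * k.-tuple A => [tuple of xu.1 :: xu.2])) //=.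
apply/onW_bij/inj_card_bij; last by rewrite card_prod !card_tuple expnS.
by move=> [x u] [y v] /(congr1 val)/= [-> /val_inj->].
Qed.

Lemma sum_tuple_rcons k F :
  \sum_(w : k.+1.-tuple A) F w = \sum_x \sum_(u : k.-tuple A) F (rcons u x).
Proof.
rewrite pair_big /= (reindex (fun xu : A * k.-tuple A => [tuple of rcons xu.2 xu.1])) //=.
apply/onW_bij/inj_card_bij; last by rewrite card_prod !card_tuple expnS.
by move=> [x u] [y v] /(congr1 val)/rcons_inj[/val_inj-> ->].
Qed.

Lemma sum_tuple_cat k l n F : n = (k + l)%N ->
  \sum_(w : n.-tuple A) F w = \sum_(u : k.-tuple A) \sum_(v : l.-tuple A) F (u ++ v).
Proof.
move=> ->; rewrite pair_big /=.
rewrite (reindex (fun uv : k.-tuple A * l.-tuple A => [tuple of uv.1 ++ uv.2])) //=.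
apply/onW_bij/inj_card_bij; last by rewrite card_prod !card_tuple expnD.
move=> [u v] [u' v'] /(congr1 val)/eqP; rewrite eqseq_cat ?size_tuple //=.
by case/andP=> /eqP/val_inj-> /eqP/val_inj->.
Qed.

End SumsOverTuples.

Section WordSums.
Variables (A : finType) (R : comNzRingType) (c : nat) (V : lmodType R).
Local Notation T := (tfalg A R c).
Implicit Types (f g : T) (H : seq A -> V).

Definition word_sum k H f : V := \sum_(u : k.-tuple A) coefw f u *: H u.

Fact word_sum_is_linear k H : linear (word_sum k H).
Proof.
move=> x f g; rewrite /word_sum scaler_sumr -big_split; apply: eq_bigr => u _.
by rewrite coefwD coefwZ scalerDl scalerA.
Qed.
HB.instance Definition _ k H :=
  GRing.isLinear.Build R T V *:%R (word_sum k H) (word_sum_is_linear k H).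

Lemma eq_wsum k H H' f : (forall u, size u = k -> H u = H' u) -> word_sum k H f = word_sum k H' f.
Proof. by move=> eqH; apply: eq_bigr => u _; rewrite eqH ?size_tuple. Qed.

Lemma word_sum0n H f : word_sum 0 H f = coefw f [::] *: H [::].
Proof. exact: (sum_tuple0 (fun u => coefw f u *: H u)). Qed.

Lemma word_sum_homog_neq i k H f : f \in homog i -> k != i -> word_sum k H f = 0.
Proof.
by move=> fi neqki; apply: big1 => u _; rewrite (homog_coefw fi) ?scale0r ?size_tuple.
Qed.

Lemma word_sum_letterM k H x f : (k < c)%N ->
  word_sum k.+1 H (letter x * f) = word_sum k (fun u => H (x :: u)) f.
Proof.
move=> ltk; rewrite /word_sum (sum_tuple_cons _ (fun w => coefw (letter x * f) w *: H w)).
rewrite (bigD1 x) //= [X in _ + X]big1 ?addr0 => [|y neqyx].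
  by apply: eq_bigr => u _; rewrite coefw_letterM ?size_tuple // eqxx mul1r.
by apply: big1 => u _; rewrite coefw_letterM ?size_tuple // (negPf neqyx) mul0r scale0r.
Qed.

Lemma word_sumM_letter k H x f : (k < c)%N ->
  word_sum k.+1 H (f * letter x) = word_sum k (fun u => H (rcons u x)) f.
Proof.
move=> ltk; rewrite /word_sum (sum_tuple_rcons _ (fun w => coefw (f * letter x) w *: H w)).
rewrite (bigD1 x) //= [X in _ + X]big1 ?addr0 => [|y neqyx].
  by apply: eq_bigr => u _; rewrite coefwM_letter ?size_tuple // eqxx mul1r.
by apply: big1 => u _; rewrite coefwM_letter ?size_tuple // (negPf neqyx) mul0r scale0r.
Qed.

Lemma word_sum_letter H x : (0 < c)%N -> word_sum 1 H (letter x) = H [:: x].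
Proof. by move=> c_gt0; rewrite -[letter x]mulr1 word_sum_letterM // word_sum0n coefw1 scale1r. Qed.

End WordSums.

Section Evaluation.
Variables (A : finType) (R : comNzRingType) (c : nat) (S : algType R) (a : A -> S).
Local Notation T := (tfalg A R c).
Implicit Types f g : T.

Definition word_eval (w : seq A) : S := \prod_(x <- w) a x.
Definition tfalg_eval f : S := \sum_(0 <= k < c.+1) word_sum k word_eval f.

Fact tfalg_eval_is_linear : linear tfalg_eval.
Proof.
move=> x f g; rewrite /tfalg_eval scaler_sumr -big_split; apply: eq_bigr => k _ /=.
exact: linearP.
Qed.
HB.instance Definition _ := GRing.isLinear.Build R T S *:%R tfalg_eval tfalg_eval_is_linear.

Lemma tfalg_eval_homog i f : (i <= c)%N -> f \in homog i -> tfalg_eval f = word_sum i word_eval f.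
Proof.
move=> lei fi; rewrite /tfalg_eval big_mkord (bigD1 (Ordinal (lei : (i < c.+1)%N))) //=.
rewrite big1 ?addr0 // => k; rewrite -val_eqE => neqki.
exact: word_sum_homog_neq fi neqki.
Qed.

Lemma tfalg_eval1 : tfalg_eval 1 = 1.
Proof.
by rewrite (tfalg_eval_homog (i := 0%N)) ?homog0_1 // word_sum0n coefw1 scale1r /word_eval big_nil.
Qed.

Lemma tfalg_eval_letter x : (0 < c)%N -> tfalg_eval (letter x) = a x.
Proof.
move=> c_gt0; rewrite (tfalg_eval_homog c_gt0 (letter_homog _ _ _)) word_sum_letter //.
by rewrite /word_eval big_seq1.
Qed.

Lemma word_sum_word_evalM k l f g :
  word_sum k word_eval f * word_sum l word_eval g =
  \sum_(u : k.-tuple A) \sum_(v : l.-tuple A) (coefw f u * coefw g v) *: word_eval (u ++ v).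
Proof.
rewrite mulr_suml; apply: eq_bigr => u _; rewrite mulr_sumr; apply: eq_bigr => v _.
by rewrite -scalerAl -scalerAr scalerA /word_eval big_cat.
Qed.

Hypothesis word_eval_eq0 : forall w, (c < size w)%N -> word_eval w = 0.

Lemma tfalg_evalM f g : tfalg_eval (f * g) = tfalg_eval f * tfalg_eval g.
Proof.
rewrite /tfalg_eval truncated_cauchy_product => [|k l ltc]; last first.
  rewrite word_sum_word_evalM big1 // => u _; apply: big1 => v _.
  by rewrite word_eval_eq0 ?scaler0 // size_cat !size_tuple.
apply: eq_big_nat => n /andP[_ lenc]; rewrite big_mkord (reindex_inj rev_ord_inj) /=.
transitivity (\sum_(k < n.+1) \sum_(w : n.-tuple A)
    (coefw f (take k w) * coefw g (drop k w)) *: word_eval w).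
  rewrite exchange_big; apply: eq_bigr => w _; rewrite -scaler_suml coefwM ?size_tuple //.
  by rewrite /conv size_tuple.
apply: eq_bigr => k _; have lekn : (k <= n)%N by rewrite -ltnS.
rewrite subKn // word_sum_word_evalM.
rewrite (sum_tuple_cat (k := k) (l := n - k)
  (fun w => (coefw f (take k w) * coefw g (drop k w)) *: word_eval w)) ?subnKC //.
apply: eq_bigr => u _; apply: eq_bigr => v _.
by rewrite take_size_cat ?drop_size_cat ?size_tuple.
Qed.

Lemma tfalg_evalX f n : tfalg_eval (f ^+ n) = tfalg_eval f ^+ n.
Proof. by elim: n => [|n IHn]; rewrite ?tfalg_eval1 // !exprS tfalg_evalM IHn. Qed.

End Evaluation.

Lemma word_eval_aug1_eq0 (A B : finType) (R : comNzRingType) (c : nat)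
    (a : A -> tfalg B R c) (w : seq A) :
  (forall x, a x \in aug 1) -> (c < size w)%N -> word_eval a w = 0.
Proof.
move=> a1 ltc; apply: (aug_eq0_gt ltc); rewrite /word_eval; elim: w {ltc} => [|x w IHw].
  by rewrite big_nil; apply/augP.
by rewrite big_cons /= -add1n; apply: augM.
Qed.

(** * Truncated exponentials *)

Definition lieb (R : pzRingType) (x y : R) := x * y - y * x.
Arguments lieb {R} x y.

Section LieBracket.
Variables (R : comNzRingType) (S : algType R).
Implicit Types x : S.

Fact lieb_is_bilinear : bilinear_for *:%R *:%R (@lieb S).
Proof.
by split=> z k x y; rewrite /lieb mulrDl mulrDr -scalerAl -scalerAr opprD addrACA -scalerBr.
Qed.
HB.instance Definition _ :=
  bilinear_isBilinear.Build R S S S *:%R *:%R (@lieb S) lieb_is_bilinear.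

Lemma lieb1l x : lieb 1 x = 0.
Proof. by rewrite /lieb mul1r mulr1 subrr. Qed.

Lemma lieb1r x : lieb x 1 = 0.
Proof. by rewrite /lieb mul1r mulr1 subrr. Qed.

Lemma liebMl x y z : lieb (x * y) z = x * lieb y z + lieb x z * y.
Proof. by rewrite /lieb mulrBr mulrBl !mulrA addrA subrK. Qed.

Lemma lieb_jacobi x y z : lieb (lieb x y) z = lieb x (lieb y z) + lieb (lieb x z) y.
Proof.
by rewrite [lieb x y]/lieb linearBl /= !liebMl opprD [- (y * _) - _]addrC addrACA.
Qed.

End LieBracket.

Lemma lieb_aug (A : finType) (R : comNzRingType) (c i j : nat) (f g : tfalg A R c) :
  f \in aug i -> g \in aug j -> lieb f g \in aug (i + j)%N.
Proof. by move=> fi gj; apply: rpredB; [|rewrite addnC]; apply: augM. Qed.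

Section DividedPowers.
Variables (F : fieldType) (c : nat).
Hypothesis fact_neq0 : c`!%:R != 0 :> F.

Lemma natr_neq0_of_fact n : (0 < n <= c)%N -> n%:R != 0 :> F.
Proof.
move=> n_bnd; have /dvdnP[m eqm] := dvdn_fact n_bnd.
by apply: contraNneq fact_neq0 => n0; rewrite eqm natrM n0 mulr0.
Qed.

Lemma natr_fact_neq0 n : (n <= c)%N -> n`!%:R != 0 :> F.
Proof.
elim: n => [|n IHn] len; first by rewrite oner_neq0.
by rewrite factS natrM mulf_neq0 ?IHn ?natr_neq0_of_fact // ltnW.
Qed.

Variable S : algType F.
Implicit Types x y f : S.

Definition divpow y n : S := n`!%:R^-1 *: y ^+ n.

Lemma divpow0 y : divpow y 0 = 1.
Proof. by rewrite /divpow fact0 invr1 scale1r. Qed.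

Lemma divpow1 y : divpow y 1 = y.
Proof. by rewrite /divpow invr1 scale1r. Qed.

Lemma divpowS y n : (n < c)%N -> divpow y n * y = n.+1%:R *: divpow y n.+1.
Proof.
move=> ltn; rewrite /divpow -scalerAl -exprSr scalerA factS natrM invfM mulrA.
by rewrite mulfV ?mul1r ?natr_neq0_of_fact.
Qed.

Lemma divpowD_comm x y n : (n <= c)%N -> GRing.comm x y ->
  divpow (x + y) n = \sum_(0 <= k < n.+1) divpow x (n - k) * divpow y k.
Proof.
move=> len cxy; rewrite /divpow (exprDn_comm _ cxy) scaler_sumr big_mkord.
apply: eq_bigr => k _; rewrite -scalerAl -scalerAr scalerA -scaler_nat scalerA.
congr (_ *: _); have lekn : (k <= n)%N by rewrite -ltnS.
have fact_kn0 : ('C(n, k) * (k`! * (n - k)`!))%:R != 0 :> F by rewrite bin_fact ?natr_fact_neq0.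
rewrite -(bin_fact lekn); move: fact_kn0; rewrite !natrM !mulf_eq0 !negb_or.
by case/and3P=> bin0 k0 nk0; field; rewrite bin0 k0 nk0.
Qed.

Definition div_ad y k f : S := k`!%:R^-1 *: iter k (lieb^~ y) f.

Lemma div_adM y f k : (k < c)%N -> div_ad y k f * y = y * div_ad y k f + k.+1%:R *: div_ad y k.+1 f.
Proof.
move=> ltk; rewrite /div_ad scalerA factS natrM invfM mulrA mulfV ?natr_neq0_of_fact //.
by rewrite mul1r -scalerAl -scalerAr -scalerDr /= {2}/lieb addrC subrK.
Qed.

Lemma mul_divpow y f n : (n <= c)%N ->
  f * divpow y n = \sum_(0 <= k < n.+1) divpow y (n - k) * div_ad y k f.
Proof.
elim: n => [|n IHn] len.
  by rewrite big_nat1 !divpow0 mulr1 mul1r /div_ad fact0 invr1 scale1r.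
apply: (scalerI (natr_neq0_of_fact (n := n.+1) _)) => //.
rewrite scalerAr -divpowS // mulrA IHn 1?ltnW // mulr_suml scaler_sumr.
transitivity (\sum_(0 <= k < n.+1) ((n.+1 - k)%:R *: (divpow y (n.+1 - k) * div_ad y k f) +
    k.+1%:R *: (divpow y (n.+1 - k.+1) * div_ad y k.+1 f))).
  apply: eq_big_nat => k /andP[_ lekn]; have ltkc := leq_trans lekn len.
  rewrite -mulrA div_adM // mulrDr mulrA divpowS; last first.
    by apply: leq_ltn_trans len; rewrite leq_subr.
  by rewrite -subSn // subSS scalerAl scalerAr.
pose weight (m : nat -> nat) k := (m k)%:R *: (divpow y (n.+1 - k) * div_ad y k f).
rewrite big_split /=.
have -> : \sum_(0 <= k < n.+1) k.+1%:R *: (divpow y (n.+1 - k.+1) * div_ad y k.+1 f) =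
    \sum_(0 <= k < n.+2) weight id k by rewrite [RHS]big_nat_recl // [weight _ _]scale0r add0r.
have -> : \sum_(0 <= k < n.+1) (n.+1 - k)%:R *: (divpow y (n.+1 - k) * div_ad y k f) =
    \sum_(0 <= k < n.+2) weight (subn n.+1) k.
  by rewrite [RHS]big_nat_recr //= /weight subnn scale0r addr0.
rewrite -big_split; apply: eq_big_nat => k /andP[_ lekn] /=.
by rewrite -scalerDl -natrD subnK.
Qed.

End DividedPowers.

HB.lock Definition texp (A : finType) (F : fieldType) (c : nat) (f : tfalg A F c) :
  tfalg A F c := \sum_(0 <= n < c.+1) divpow f n.

Section Exponential.
Variables (A : finType) (F : fieldType) (c : nat).
Local Notation T := (tfalg A F c).
Implicit Types (f g x y : T).

Lemma divpow_aug k f n : f \in aug k -> divpow f n \in aug (n * k)%N.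
Proof. by move=> fk; apply/rpredZ/augX. Qed.

Lemma texp0 : texp (0 : T) = 1.
Proof.
rewrite !texp.unlock big_nat_recl // divpow0 big1 ?addr0 // => n _.
by rewrite /divpow expr0n scaler0.
Qed.

Lemma texp_aug k f : f \in aug k -> texp f - 1 \in aug k.
Proof.
move=> fk; rewrite !texp.unlock big_nat_recl // divpow0 addrC addKr.
by apply: rpred_sum => n _; apply/rpredZ; rewrite exprS; apply: augMr.
Qed.

Lemma texp_coef0 f : f \in aug 1 -> coefw (texp f) [::] == 1.
Proof. by move=> f1; rewrite -sub1_aug1 texp_aug. Qed.

Hypothesis fact_neq0 : c`!%:R != 0 :> F.

Lemma texp_leading k f : (0 < c)%N -> (0 < k)%N -> f \in aug k -> texp f - (1 + f) \in aug k.+1.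
Proof.
move=> c_gt0 k_gt0 fk; rewrite !texp.unlock big_ltn // big_ltn // divpow0 divpow1.
rewrite addrA (addrC (1 + f)) addrK big_nat; apply: rpred_sum => -[|[|n]] // _.
by apply: aug_le (divpow_aug _ fk); rewrite !mulSn; lia.
Qed.

Lemma exprB_aug i x y n : (0 < i)%N -> x \in aug 1 -> y \in aug i -> (0 < n)%N ->
  (x + y) ^+ n - x ^+ n \in aug (i + n.-1)%N.
Proof.
move=> i_gt0 x1 yi; case: n => // n _; elim: n => [|n IHn].
  by rewrite !expr1 addrC addKr addn0.
have -> : (x + y) ^+ n.+2 - x ^+ n.+2 =
    x * ((x + y) ^+ n.+1 - x ^+ n.+1) + y * (x + y) ^+ n.+1.
  by rewrite !(exprS _ n.+1) mulrDl mulrBr addrAC.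
apply: rpredD; first by rewrite /= addnS -[(i + n).+1]add1n; apply: augM.
by apply: augM => //; apply/aug1X/rpredD => //; apply: aug_le yi.
Qed.

Lemma texp_addr i x y : (0 < c)%N -> (0 < i)%N -> x \in aug 1 -> y \in aug i ->
  texp (x + y) - texp x * (1 + y) \in aug i.+1.
Proof.
move=> c_gt0 i_gt0 x1 yi.
have -> : texp (x + y) - texp x * (1 + y) =
    (texp (x + y) - texp x - y) - (texp x - 1) * y.
  by rewrite mulrDr mulr1 mulrBl mul1r opprB opprD !addrA subrK.
apply: rpredB; last by rewrite -add1n; apply: augM => //; apply: texp_aug.
rewrite !texp.unlock -[_ - \sum_(_ <= _ < _) _]sumrB big_ltn // big_ltn //.
rewrite !divpow0 !divpow1 subrr add0r.
rewrite [x + y - x]addrC addKr addrC addKr big_nat; apply: rpred_sum => -[|[|n]] // _.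
rewrite -scalerBr; apply/rpredZ.
by apply: aug_le (exprB_aug i_gt0 x1 yi _); rewrite //= addnS ltnS leq_addr.
Qed.

Lemma texpD_comm x y : x \in aug 1 -> y \in aug 1 -> GRing.comm x y ->
  texp (x + y) = texp x * texp y.
Proof.
move=> x1 y1 cxy; rewrite !texp.unlock truncated_cauchy_product => [|m k ltc].
  by apply: eq_big_nat => n /andP[_ len]; apply: (divpowD_comm fact_neq0).
apply: (aug_eq0_gt ltc).
by apply: augM; apply/rpredZ/aug1X.
Qed.

Lemma texpN x : x \in aug 1 -> texp x * texp (- x) = 1.
Proof.
move=> x1; rewrite -texpD_comm ?subrr ?texp0 ?rpredN //; exact: commrN.
Qed.

Lemma texpMn x n : x \in aug 1 -> texp (x *+ n) = texp x ^+ n.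
Proof.
move=> x1; elim: n => [|n IHn]; first by rewrite mulr0n texp0.
by rewrite mulrS texpD_comm ?IHn ?exprS ?rpredMn //; apply: commrMn.
Qed.

Lemma iter_lieb_aug y f k : y \in aug 1 -> iter k (lieb^~ y) f \in aug k.
Proof.
move=> y1; elim: k => [|k IHk] /=; first exact/augP.
by rewrite -addn1; apply: lieb_aug.
Qed.

Lemma texp_adjoint y f : y \in aug 1 ->
  f * texp y = texp y * \sum_(0 <= k < c.+1) div_ad y k f.
Proof.
move=> y1; rewrite !texp.unlock truncated_cauchy_product => [|m k ltc].
  by rewrite mulr_sumr; apply: eq_big_nat => n /andP[_ len]; apply: (mul_divpow fact_neq0).
by apply: (aug_eq0_gt ltc); apply: augM; apply/rpredZ; rewrite ?aug1X ?iter_lieb_aug.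
Qed.

Lemma divpow_homog i y n : y \in homog i -> divpow y n \in homog (n * i)%N.
Proof.
move=> yi; apply: rpredZ; elim: n => [|n IHn]; first exact: homog0_1.
by rewrite exprS mulSn homogM.
Qed.

Lemma euler_texp i y : (0 < i)%N -> y \in homog i -> euler (texp y) = texp y * euler y.
Proof.
move=> i_gt0 yi; have y1 := aug_le i_gt0 (homog_aug yi).
rewrite (euler_homog yi) texp.unlock linear_sum mulr_suml big_nat_recl //= big_nat_recr //=.
rewrite divpow0 euler1 add0r -scalerAr [divpow y c * y](_ : _ = 0) ?scaler0 ?addr0; last first.
  by apply: aug_eq0; rewrite -addn1; apply: augM => //; apply/rpredZ/aug1X.
apply: eq_big_nat => n /andP[_ ltn]; rewrite (euler_homog (divpow_homog _ yi)).
by rewrite -scalerAr (divpowS fact_neq0) // [RHS]scalerA mulnC natrM.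
Qed.

End Exponential.

Lemma tfalg_eval_texp (A B : finType) (F : fieldType) (c : nat) (a : A -> tfalg B F c)
    (f : tfalg A F c) :
  (forall x, a x \in aug 1) -> tfalg_eval a (texp f) = texp (tfalg_eval a f).
Proof.
move=> a1; rewrite !texp.unlock linear_sum; apply: eq_bigr => n _.
by rewrite linearZ /= tfalg_evalX // => w; exact: word_eval_aug1_eq0.
Qed.

(** * The Magnus group *)

Section MagnusGroup.
Variables (A : finType) (R : comNzRingType) (c : nat).
Local Notation T := (tfalg A R c).

Definition magnus := {f : T | coefw f [::] == 1}.
HB.instance Definition _ := Choice.on magnus.
Implicit Types u v : magnus.

Lemma magnus_aug1 u : val u - 1 \in aug 1.
Proof. by rewrite sub1_aug1 (valP u). Qed.

Fact magnus_mul_subproof u v : coefw (val u * val v) [::] == 1.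
Proof. by rewrite coefwM //= conv_nil (eqP (valP u)) (eqP (valP v)) mulr1. Qed.
Definition magnus_mul u v : magnus := Sub (val u * val v) (magnus_mul_subproof u v).

Fact magnus_one_subproof : coefw (1 : T) [::] == 1.
Proof. by rewrite coefw1. Qed.
Definition magnus_one : magnus := Sub (1 : T) magnus_one_subproof.

Fact magnus_inv_subproof u : coefw (\sum_(i < c.+1) (1 - val u) ^+ i) [::] == 1.
Proof.
rewrite -sub1_aug1 big_ord_recl expr0 addrC addKr; apply: rpred_sum => i _.
by rewrite lift0 exprS augMr // -opprB rpredN magnus_aug1.
Qed.
Definition magnus_inv u : magnus :=
  Sub (\sum_(i < c.+1) (1 - val u) ^+ i) (magnus_inv_subproof u).

Fact magnus_mulA : associative magnus_mul.
Proof. by move=> u v w; apply: val_inj; rewrite /= mulrA. Qed.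
Fact magnus_mul1g : left_id magnus_one magnus_mul.
Proof. by move=> u; apply: val_inj; rewrite /= mul1r. Qed.
Fact magnus_mulg1 : right_id magnus_one magnus_mul.
Proof. by move=> u; apply: val_inj; rewrite /= mulr1. Qed.

Fact mulr_magnus_inv u : val u * val (magnus_inv u) = 1.
Proof.
set x := 1 - val u; have x1 : x \in aug 1 by rewrite /x -opprB rpredN magnus_aug1.
have -> : val u = 1 - x by rewrite opprB addrC subrK.
by rewrite -opprB mulNr -subrX1 (aug_eq0 (aug1X _ x1)) sub0r opprK.
Qed.

Fact magnus_mulVg : left_inverse magnus_one magnus_inv magnus_mul.
Proof.
move=> u; apply: val_inj; rewrite /= -[RHS](mulr_magnus_inv u); apply/commr_sym/commr_sum => i _.
by apply/commrX/commrB; [apply: commr1 | ].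
Qed.
Fact magnus_mulgV : right_inverse magnus_one magnus_inv magnus_mul.
Proof. by move=> u; apply: val_inj; apply: mulr_magnus_inv. Qed.

HB.instance Definition _ := isGroup.Build magnus
  magnus_mulA magnus_mul1g magnus_mulg1 magnus_mulVg magnus_mulgV.

Lemma val_magnusM u v : val (u * v)%g = val u * val v. Proof. by []. Qed.
Lemma val_magnus1 : val (1%g : magnus) = 1. Proof. by []. Qed.

Lemma val_magnusX u n : val (u ^+ n)%g = val u ^+ n.
Proof. by elim: n => [|n IHn]; rewrite ?expg0 // expgS exprS val_magnusM IHn. Qed.

Lemma val_magnusVM u : val (u^-1)%g * val u = 1.
Proof. by rewrite -val_magnusM mulVg. Qed.

Lemma magnus_expg_pchar p u : p \in [pchar R] -> (c < p)%N -> (u ^+ p)%g = 1%g.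
Proof.
move=> pcharR ltcp; apply: val_inj; rewrite val_magnusX val_magnus1.
have pcharT : p \in [pchar T].
  by rewrite inE (pcharf_prime pcharR) -scaler_nat (pcharf0 pcharR) scale0r eqxx.
have /(pFrobenius_autD_comm pcharT) : GRing.comm 1 (val u - 1) by exact/commr_sym/commr1.
rewrite addrC subrK pFrobenius_autE => ->.
rewrite !pFrobenius_autE expr1n [X in _ + X](aug_eq0_gt ltcp) ?addr0 //.
by rewrite aug1X // magnus_aug1.
Qed.

Definition magnus_filt k : {pred magnus} := fun u => val u - 1 \in aug k.

Lemma magnus_filtP k u : reflect (val u - 1 \in aug k) (u \in magnus_filt k).
Proof. exact: idP. Qed.

Lemma magnus_filt1 u : u \in magnus_filt 1.
Proof. exact: magnus_aug1. Qed.

Lemma val_magnusM_sub1 u v :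
  val (u * v)%g - 1 = (val u - 1) + (val v - 1) + (val u - 1) * (val v - 1).
Proof.
rewrite val_magnusM -{1}(subrK 1 (val u)) -{1}(subrK 1 (val v)).
by rewrite mulrDl mulrDr mul1r mulr1 addrA addrK -addrA addrC.
Qed.

Fact magnus_filt1g k : 1%g \in magnus_filt k.
Proof. by apply/magnus_filtP; rewrite val_magnus1 subrr rpred0. Qed.

Fact magnus_filtM k : mulg_closed (magnus_filt k).
Proof.
move=> u v /magnus_filtP uk /magnus_filtP vk; apply/magnus_filtP; rewrite val_magnusM_sub1.
by apply: rpredD; [exact: rpredD | exact: augMr].
Qed.

Fact magnus_filtV k : invg_closed (magnus_filt k).
Proof.
move=> u /magnus_filtP uk; apply/magnus_filtP; rewrite -(val_magnusVM u) -opprB rpredN.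
by rewrite -[X in _ - X]mulr1 -mulrBr augMl.
Qed.

HB.instance Definition _ k := isInvClosed.Build magnus (magnus_filt k) (@magnus_filtV k).
HB.instance Definition _ k := isMul1Closed.Build magnus (magnus_filt k) (magnus_filt1g k).
HB.instance Definition _ k := isMulClosed.Build magnus (magnus_filt k) (@magnus_filtM k).

Lemma magnus_commg_sub1 u v :
  val [~ u, v]%g - 1 = val (u^-1 * v^-1)%g * lieb (val u - 1) (val v - 1).
Proof.
have -> : lieb (val u - 1) (val v - 1) = lieb (val u) (val v).
  by rewrite linearBl linearBr /= !lieb1l lieb1r !subr0.
rewrite /lieb mulrBr -!val_magnusM commgEl /conjg !mulgA; congr (_ - _).
by rewrite !mulgKV mulVg.
Qed.

Lemma magnus_commg_filt i j u v :
  u \in magnus_filt i -> v \in magnus_filt j -> [~ u, v]%g \in magnus_filt (i + j).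
Proof.
move=> /magnus_filtP ui /magnus_filtP vj; apply/magnus_filtP; rewrite magnus_commg_sub1.
exact/augMl/lieb_aug.
Qed.

Lemma homog_part_magnusM i u v : (0 < i)%N -> u \in magnus_filt i -> v \in magnus_filt i ->
  homog_part i (val (u * v)%g) = homog_part i (val u) + homog_part i (val v).
Proof.
move=> i_gt0 /magnus_filtP ui /magnus_filtP vi.
rewrite -(homog_part_sub1 _ i_gt0) val_magnusM_sub1 2!linearD /=.
rewrite !homog_part_sub1 // [X in _ + X]homog_part_eq0 ?addr0 //.
by apply: aug_le (augM ui vi); lia.
Qed.

Lemma homog_part_magnusV i u : (0 < i)%N -> u \in magnus_filt i ->
  homog_part i (val u^-1%g) = - homog_part i (val u).
Proof.
move=> i_gt0 ui; apply/eqP; rewrite -addr_eq0 -homog_part_magnusM ?gpredV //.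
by rewrite mulVg val_magnus1 -(homog_part_sub1 _ i_gt0) subrr linear0.
Qed.

Lemma homog_part_magnusR i j u v : (0 < i)%N -> (0 < j)%N ->
  u \in magnus_filt i -> v \in magnus_filt j ->
  homog_part (i + j)%N (val [~ u, v]%g) = lieb (homog_part i (val u)) (homog_part j (val v)).
Proof.
move=> i_gt0 j_gt0 /magnus_filtP ui /magnus_filtP vj.
have ij_gt0 : (0 < i + j)%N by rewrite addn_gt0 i_gt0.
rewrite -(homog_part_sub1 _ ij_gt0) magnus_commg_sub1.
move: (magnus_aug1 (u^-1 * v^-1)%g); move: (val _) => w w1.
rewrite -(subrK 1 w) mulrDl mul1r linearD /=.
rewrite [X in X + _]homog_part_eq0 ?add0r; last first.
  by rewrite -[(i + j).+1]add1n; apply: augM => //; apply: lieb_aug.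
rewrite /lieb linearB /= homog_partM // [(i + j)%N]addnC homog_partM //.
by rewrite !homog_part_sub1.
Qed.

Lemma magnus_filtS i u : (0 < i)%N -> u \in magnus_filt i -> homog_part i (val u) = 0 ->
  u \in magnus_filt i.+1.
Proof.
move=> i_gt0 /magnus_filtP ui hu0; apply/magnus_filtP; have := subr_homog_part_aug ui.
by rewrite homog_part_sub1 // hu0 subr0.
Qed.

Lemma magnus_filt_eq1 k u : (c < k)%N -> u \in magnus_filt k -> u = 1%g.
Proof.
move=> ltck /magnus_filtP uk; apply/val_inj/eqP.
by rewrite -subr_eq0 (aug_eq0_gt ltck uk).
Qed.

End MagnusGroup.

HB.lock Definition mexp (A : finType) (F : fieldType) (c : nat) (f : tfalg A F c) :
  magnus A F c := insubd (magnus_one A F c) (texp f).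

Section MagnusExponential.
Variables (A : finType) (F : fieldType) (c : nat).
Local Notation T := (tfalg A F c).
Implicit Types (f x : T).

Lemma val_mexp f : f \in aug 1 -> val (mexp f) = texp f.
Proof. by move=> f1; rewrite mexp.unlock insubdK //; apply: texp_coef0. Qed.

Lemma mexp0 : mexp (0 : T) = 1%g.
Proof. by apply: val_inj; rewrite val_mexp ?rpred0 // texp0. Qed.

Hypothesis fact_neq0 : c`!%:R != 0 :> F.

Lemma mexpN x : x \in aug 1 -> mexp (- x) = (mexp x)^-1%g.
Proof.
move=> x1; apply: (mulgI (mexp x)); rewrite mulgV; apply: val_inj.
by rewrite val_magnusM !val_mexp ?rpredN // texpN.
Qed.

Lemma mexpMn x n : x \in aug 1 -> mexp (x *+ n) = (mexp x ^+ n)%g.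
Proof.
move=> x1; apply: val_inj; rewrite [RHS]val_magnusX (val_mexp x1) val_mexp ?rpredMn //.
exact: texpMn.
Qed.

Lemma homog_part_mexp_letter a : (0 < c)%N -> homog_part 1 (val (mexp (letter a : T))) = letter a.
Proof.
move=> c_gt0; have a1 := @letter_aug A F c a.
have /homog_part_eq0/eqP := texp_leading fact_neq0 c_gt0 (ltn0Sn 0) a1.
rewrite val_mexp // linearB linearD /= subr_eq0 => /eqP->.
by rewrite (homog_part_of_homog _ (homog0_1 _ _ _)) add0r; apply/homogP/letter_homog.
Qed.

End MagnusExponential.

Definition word_prod (A : Type) (gT : groupType) (g : A -> gT) (w : seq A) : gT :=
  (\prod_(a <- w) g a)%g.

Lemma word_prod_nil (A : Type) (gT : groupType) (g : A -> gT) : word_prod g [::] = 1%g.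
Proof. exact: big_nil. Qed.

Lemma word_prod_cons (A : Type) (gT : groupType) (g : A -> gT) a w :
  word_prod g (a :: w) = (g a * word_prod g w)%g.
Proof. exact: big_cons. Qed.

Lemma word_prod_mexp_letter (A B : finType) (F : fieldType) (c : nat)
    (a : A -> tfalg B F c) (w : seq A) :
  (0 < c)%N -> (forall x, a x \in aug 1) ->
  val (word_prod (fun x => mexp (a x)) w) =
    tfalg_eval a (val (word_prod (fun x => mexp (letter x : tfalg A F c)) w)).
Proof.
move=> c_gt0 a1; elim: w => [|x w IHw]; first by rewrite !word_prod_nil tfalg_eval1.
rewrite !word_prod_cons !val_magnusM tfalg_evalM => [|u]; last exact: word_eval_aug1_eq0.
rewrite IHw (val_mexp (a1 x)) (val_mexp (letter_aug _ _ x)).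
by rewrite tfalg_eval_texp // tfalg_eval_letter.
Qed.

(** * Lie elements and words *)

Lemma fact_neq0_pchar (R : idomainType) p c : p \in [pchar R] -> (c < p)%N -> c`!%:R != 0 :> R.
Proof.
move=> pcharR; elim: c => [|c IHc] ltcp; first by rewrite oner_neq0.
rewrite factS natrM mulf_neq0 ?(IHc (ltnW ltcp)) //.
by rewrite -(dvdn_pcharf pcharR) gtnNdvd.
Qed.

Section LieElements.
Variables (A : finType) (F : fieldType) (p c : nat).
Local Notation T := (tfalg A F c).
Local Notation X := (@letter A F c).
Implicit Types (f g x y : T) (u v : magnus A F c).

Inductive Lie : T -> Prop :=
  | Lie_letter a : Lie (X a)
  | Lie0 : Lie 0
  | LieD f g of Lie f & Lie g : Lie (f + g)
  | Lie_lieb_letter f a of Lie f : Lie (lieb f (X a)).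

Hypothesis prime_field : forall k : F, exists n, k = n%:R.

Lemma LieZ k f : Lie f -> Lie (k *: f).
Proof.
move=> Lf; have [n ->] := prime_field k; rewrite scaler_nat.
by elim: n => [|n IHn]; [apply: Lie0 | rewrite mulrS; apply: LieD].
Qed.

Lemma Lie_sum I (r : seq I) (P : pred I) (h : I -> T) :
  (forall i, P i -> Lie (h i)) -> Lie (\sum_(i <- r | P i) h i).
Proof. by move=> Lh; elim/big_ind: _ => //; [apply: Lie0 | apply: LieD]. Qed.

Lemma Lie_lieb f g : Lie f -> Lie g -> Lie (lieb f g).
Proof.
move=> Lf Lg; elim: Lg f Lf => {g} [a|| g h _ IHg _ IHh|g a _ IHg] f Lf.
- exact: Lie_lieb_letter.
- by rewrite linear0r; apply: Lie0.
- by rewrite linearDr; apply: LieD; [apply: IHg | apply: IHh].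
have -> : lieb f (lieb g (X a)) = lieb (lieb f g) (X a) + (-1) *: lieb (lieb f (X a)) g.
  by rewrite lieb_jacobi scaleN1r addrK.
by apply: LieD; [apply/Lie_lieb_letter/IHg | apply/LieZ/IHg/Lie_lieb_letter].
Qed.

Lemma Lie_aug1 f : Lie f -> f \in aug 1.
Proof.
elim=> {f} [a||f g _ f1 _ g1|f a _ f1]; rewrite ?rpred0 ?letter_aug //; first exact: rpredD.
exact: aug_le (lieb_aug f1 (letter_aug _ _ a)).
Qed.

Lemma homog_part_lieb_letter i f a :
  homog_part i.+1 (lieb f (X a)) = lieb (homog_part i f) (X a).
Proof.
have Xa := letter_homog F c a.
rewrite /lieb linearB /= -{1}addn1 (homog_part_homogMr _ _ Xa).
by rewrite -add1n (homog_part_homogMl _ _ Xa).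
Qed.

Lemma Lie_homog_part i f : Lie f -> Lie (homog_part i f).
Proof.
move=> Lf; case: i => [|i].
  by rewrite homog_part_eq0 ?Lie_aug1 //; apply: Lie0.
elim: Lf i => {f} [a||f g _ IHf _ IHg|f a Lf IHf] i.
- rewrite (homog_part_of_homog _ (letter_homog _ _ a)).
  by case: eqP => _; [apply: Lie_letter | apply: Lie0].
- by rewrite linear0; apply: Lie0.
- by rewrite linearD; apply: LieD; [apply: IHf | apply: IHg].
rewrite homog_part_lieb_letter; apply: Lie_lieb_letter; case: i => [|i]; last exact: IHf.
by rewrite homog_part_eq0 ?Lie_aug1 //; apply: Lie0.
Qed.

Hypotheses (pcharF : p \in [pchar F]) (c_lt_p : (c < p)%N).
Let fact_neq0 : c`!%:R != 0 :> F := fact_neq0_pchar pcharF c_lt_p.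

Lemma magnus_invg_expg u : u^-1%g = (u ^+ p.-1)%g.
Proof.
apply: (mulIg u); rewrite mulVg -expgSr prednK ?prime_gt0 ?(pcharf_prime pcharF) //.
by rewrite (magnus_expg_pchar _ pcharF).
Qed.

(* Both conditions are stable under products and hold for exponentials of
   homogeneous Lie elements; the second makes the leading term of [u] Lie, as
   its degree is invertible in [F]. *)
Definition grouplike u :=
  (forall f, Lie f -> Lie (val (u^-1)%g * f * val u)) /\
  Lie (val (u^-1)%g * euler (val u)).

Lemma grouplike1 : grouplike 1%g.
Proof.
split=> [f Lf|]; first by rewrite invg1 val_magnus1 mul1r mulr1.
by rewrite val_magnus1 euler1 mulr0; apply: Lie0.
Qed.

Lemma grouplikeM u v : grouplike u -> grouplike v -> grouplike (u * v)%g.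
Proof.
move=> [conju eu] [conjv ev]; split=> [f Lf|]; rewrite invMg !val_magnusM.
  by rewrite !mulrA -[_ * _ * f]mulrA -[_ * (_ * f) * _]mulrA; apply/conjv/conju.
rewrite eulerM mulrDr; apply: LieD.
  by rewrite !mulrA -[_ * _ * euler _]mulrA; apply: conjv.
by rewrite !mulrA -[_ * _ * val u]mulrA val_magnusVM mulr1.
Qed.

Lemma grouplike_word_prod (B : Type) (h : B -> magnus A F c) w :
  (forall b, grouplike (h b)) -> grouplike (word_prod h w).
Proof.
move=> gh; elim: w => [|b w IHw]; first by rewrite word_prod_nil; apply: grouplike1.
by rewrite word_prod_cons; apply: grouplikeM.
Qed.

Lemma grouplikeV u : grouplike u -> grouplike u^-1%g.
Proof.
move=> gu; rewrite magnus_invg_expg.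
by elim: p.-1 => [|n IHn]; [apply: grouplike1 | rewrite expgS; apply: grouplikeM].
Qed.

Lemma grouplike_mexp i y : (0 < i)%N -> y \in homog i -> Lie y -> grouplike (mexp y).
Proof.
move=> i_gt0 yi Ly; have y1 := Lie_aug1 Ly.
have mexpVK f : val (mexp y)^-1%g * (texp y * f) = f.
  by rewrite mulrA -(val_mexp y1) val_magnusVM mul1r.
split=> [f Lf|]; last first.
  rewrite val_mexp // (euler_texp fact_neq0 i_gt0 yi) mexpVK (euler_homog yi); exact: LieZ.
rewrite -mulrA val_mexp // (texp_adjoint fact_neq0) // mexpVK.
apply: Lie_sum => k _; apply: LieZ; elim: k => //= k IHk; exact: Lie_lieb.
Qed.

Lemma homog_part_euler i f : homog_part i (euler f) = i%:R *: homog_part i f.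
Proof.
apply: tfalgP => w _; rewrite coefwZ !coefw_homog_part coefw_euler.
by case: eqP => [->|_]; rewrite ?mul0r ?mulr0 // !mul1r.
Qed.

Lemma homog_part0_magnus u : homog_part 0 (val u) = 1.
Proof.
apply: tfalgP => w _; rewrite coefw_homog_part coefw1 /nilp.
by case: w => [|a w]; rewrite ?mul0r //= mul1r (eqP (valP u)).
Qed.

Lemma grouplike_leading i u : (0 < i <= c)%N -> grouplike u -> u \in magnus_filt i ->
  Lie (homog_part i (val u)).
Proof.
move=> i_bnd [_ eu] /magnus_filtP ui; have eui : euler (val u) \in aug i.
  by rewrite -[val u](subrK 1) linearD /= euler1 addr0 euler_aug.
have inv0 : val u^-1%g \in aug 0 by apply/augP.
have := Lie_homog_part (0 + i)%N eu.
rewrite homog_partM // homog_part0_magnus mul1r homog_part_euler => /(LieZ i%:R^-1).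
by rewrite scalerA mulVf ?scale1r // (natr_neq0_of_fact fact_neq0).
Qed.

Definition letter_word u := exists w, u = word_prod (fun a => mexp (X a)) w.

Lemma letter_word1 : letter_word 1%g.
Proof. by exists [::]; rewrite word_prod_nil. Qed.

Lemma letter_word_mexp a : letter_word (mexp (X a)).
Proof. by exists [:: a]; rewrite word_prod_cons word_prod_nil mulg1. Qed.

Lemma letter_wordM u v : letter_word u -> letter_word v -> letter_word (u * v)%g.
Proof. by move=> [w ->] [w' ->]; exists (w ++ w'); rewrite /word_prod big_cat. Qed.

Lemma letter_wordV u : letter_word u -> letter_word u^-1%g.
Proof.
move=> wu; rewrite magnus_invg_expg.
by elim: p.-1 => [|n IHn]; [apply: letter_word1 | rewrite expgS; apply: letter_wordM].
Qed.

Lemma letter_wordR u v : letter_word u -> letter_word v -> letter_word [~ u, v]%g.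
Proof.
move=> wu wv; exact (letter_wordM (letter_wordV wu)
  (letter_wordM (letter_wordV wv) (letter_wordM wu wv))).
Qed.

Lemma grouplike_letter_word u : letter_word u -> grouplike u.
Proof.
case=> w ->; apply: grouplike_word_prod => a.
exact: grouplike_mexp (letter_homog _ _ a) (Lie_letter a).
Qed.

Hypothesis c_gt0 : (0 < c)%N.

Lemma letter_word_leading f i : Lie f -> (0 < i)%N -> exists u, [/\ letter_word u,
  u \in magnus_filt i & homog_part i (val u) = homog_part i f].
Proof.
have leading0 j (g : T) : (0 < j)%N -> homog_part j g = 0 -> exists u, [/\ letter_word u,
    u \in magnus_filt j & homog_part j (val u) = homog_part j g].
  move=> j_gt0 g0; exists 1%g; split; [exact: letter_word1 | exact: magnus_filt1g |].
  by rewrite g0 val_magnus1 (homog_part_of_homog _ (homog0_1 _ _ _)) gtn_eqF.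
move=> Lf; elim: Lf i => {f} [a||f g _ IHf _ IHg|f a Lf IHf] i i_gt0.
- have [->|neq1] := eqVneq i 1%N; last first.
    by apply: leading0; rewrite // (homog_part_of_homog _ (letter_homog _ _ a)) (negPf neq1).
  exists (mexp (X a)); rewrite magnus_filt1; split=> //; first exact: letter_word_mexp.
  by rewrite (homog_part_mexp_letter fact_neq0) // (homogP _ _ (letter_homog _ _ a)).
- by apply: leading0; rewrite ?linear0.
- have [u [wu ui hu]] := IHf i i_gt0; have [v [wv vi hv]] := IHg i i_gt0.
  exists (u * v)%g; split; [exact: letter_wordM | exact: gpredM |].
  by rewrite homog_part_magnusM // hu hv linearD.
case: i i_gt0 => [|[|i]] // _.
  apply: leading0 => //; rewrite homog_part_lieb_letter homog_part_eq0 ?Lie_aug1 //.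
  exact: linear0l.
have [u [wu ui hu]] := IHf i.+1 isT; exists [~ u, mexp (X a)]%g.
rewrite -[i.+2]addn1 magnus_commg_filt ?magnus_filt1 //; split=> //.
  exact/letter_wordR/letter_word_mexp.
rewrite homog_part_magnusR ?magnus_filt1 // hu (homog_part_mexp_letter fact_neq0) //.
by rewrite addn1 homog_part_lieb_letter.
Qed.

Lemma grouplike_filt_word n i u : (c < n + i)%N -> (0 < i)%N ->
  grouplike u -> u \in magnus_filt i -> letter_word u.
Proof.
have trivial_word j v : (c < j)%N -> v \in magnus_filt j -> letter_word v.
  by move=> ltcj vj; rewrite (magnus_filt_eq1 ltcj vj); apply: letter_word1.
elim: n i u => [|n IHn] i u ltc i_gt0 gu ui; first exact: trivial_word ui.
have [ltci|leic] := ltnP c i; first exact: trivial_word ui.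
have Lhu : Lie (homog_part i (val u)) by apply: grouplike_leading; rewrite ?i_gt0.
have [v [wv vi hv]] := letter_word_leading Lhu i_gt0.
rewrite -[u](mulKVg v); apply: letter_wordM => //; apply: (IHn i.+1) => //.
- by rewrite addnS.
- exact/grouplikeM/gu/grouplikeV/grouplike_letter_word.
apply: magnus_filtS; rewrite ?gpredM ?gpredV //.
rewrite homog_part_magnusM ?gpredV // homog_part_magnusV // hv.
by rewrite (homogP _ _ (homog_part_homog _ _)) addNr.
Qed.

Lemma grouplike_word u : grouplike u -> letter_word u.
Proof.
by move=> gu; apply: (grouplike_filt_word (n := c) (i := 1)); rewrite ?addn1 ?magnus_filt1.
Qed.

Lemma homog_Lie_word i f : (0 < i)%N -> f \in homog i -> Lie f ->
  exists w, forall (B : finType) (a : A -> tfalg B F c), (forall d, a d \in aug 1) ->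
    word_prod (fun d => mexp (a d)) w = mexp (tfalg_eval a f).
Proof.
move=> i_gt0 fi Lf.
have [w eqw] := grouplike_word (grouplike_mexp i_gt0 fi Lf).
exists w => B a a1; apply: val_inj; rewrite word_prod_mexp_letter // -eqw.
have eval_aug g : g \in aug 1 -> tfalg_eval a g \in aug 1.
  move=> /augP g1; apply: rpred_sum => -[|k] _ /=.
    by rewrite word_sum0n g1 // scale0r rpred0.
  apply: rpred_sum => u _; apply: rpredZ; case/tupleP: u => d u.
  by rewrite /word_eval big_cons augMr.
by rewrite !val_mexp ?tfalg_eval_texp ?eval_aug ?Lie_aug1.
Qed.

End LieElements.

Definition word_op (w : seq bool) (gT : groupType) (x y : gT) : gT :=
  word_prod (fun b : bool => if b then x else y) w.
Arguments word_op w {gT} x y.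

Lemma word_op_nil (gT : groupType) (x y : gT) : word_op [::] x y = 1%g.
Proof. exact: word_prod_nil. Qed.

Lemma word_op_cons b w (gT : groupType) (x y : gT) :
  word_op (b :: w) x y = ((if b then x else y) * word_op w x y)%g.
Proof. exact: word_prod_cons. Qed.

Lemma mem_word_op w (gT : finGroupType) (G : {group gT}) x y :
  x \in G -> y \in G -> word_op w x y \in G.
Proof. by move=> Gx Gy; apply: group_prod => -[]. Qed.

Lemma word_op_morph w (gT hT : groupType) (f : gT -> hT) :
  {morph f : x y / (x * y)%g} -> {morph f : x y / word_op w x y}.
Proof.
move=> fM x y; have f1 : f 1%g = 1%g by apply: (mulgI (f 1%g)); rewrite -fM !mulg1.
by elim: w => [|[] w IHw]; rewrite ?word_op_nil // !word_op_cons fM IHw.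
Qed.

Lemma word_op_commute w (gT : groupType) (x y : gT) : commute x y ->
  word_op w x y = (word_op w x 1 * word_op w 1 y)%g.
Proof.
move=> cxy; elim: w => [|[] w IHw]; rewrite ?word_op_nil ?mulg1 // !word_op_cons IHw mul1g mulgA //.
rewrite mulgA; congr (_ * _)%g; apply/commute_sym.
elim: w {IHw} => [|[] w IHw]; rewrite ?word_op_nil ?word_op_cons ?mul1g //.
  exact/commute_sym/commute1.
exact/commute_sym/commuteM/commute_sym.
Qed.

Section LazardWords.
Variables (F : fieldType) (p c : nat).
Hypothesis prime_field : forall k : F, exists n, k = n%:R.
Hypotheses (pcharF : p \in [pchar F]) (c_lt_p : (c < p)%N) (c_gt0 : (0 < c)%N).

Lemma exists_word_op i (f : tfalg bool F c) : (0 < i)%N -> f \in homog i -> Lie f ->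
  exists w, forall (B : finType) (x y : tfalg B F c), x \in aug 1 -> y \in aug 1 ->
    word_op w (mexp x) (mexp y) = mexp (tfalg_eval (fun b : bool => if b then x else y) f).
Proof.
move=> i_gt0 fi Lf; have [w evalw] := homog_Lie_word prime_field pcharF c_lt_p c_gt0 i_gt0 fi Lf.
exists w => B x y x1 y1; rewrite -evalw => [|[]] //.
by apply: eq_bigr => -[].
Qed.

Lemma exists_addition_word : exists w, forall (B : finType) (x y : tfalg B F c),
  x \in aug 1 -> y \in aug 1 -> word_op w (mexp x) (mexp y) = mexp (x + y).
Proof.
have [||w evalw] := exists_word_op (f := letter true + letter false) (ltn0Sn 0).
- by rewrite rpredD ?letter_homog.
- by apply: LieD; apply: Lie_letter.
exists w => B x y x1 y1; rewrite evalw // linearD /= !tfalg_eval_letter //.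
Qed.

Lemma exists_bracket_word : exists w, forall (B : finType) (x y : tfalg B F c),
  x \in aug 1 -> y \in aug 1 -> word_op w (mexp x) (mexp y) = mexp (lieb x y).
Proof.
have [||w evalw] := exists_word_op (f := lieb (letter true) (letter false)) (ltn0Sn 1).
- by apply: rpredB; apply: (homogM (i := 1) (j := 1)); apply: letter_homog.
- by apply: Lie_lieb_letter; apply: Lie_letter.
exists w => B x y x1 y1; rewrite evalw // /lieb linearB /= !tfalg_evalM ?tfalg_eval_letter //;
  by move=> u; apply: word_eval_aug1_eq0 => -[].
Qed.

Variable A : finType.
Local Notation T := (tfalg A F c).

Lemma grouplike_mexpD (f g : T) : Lie f -> Lie g -> grouplike (mexp f) -> grouplike (mexp g) ->
  grouplike (mexp (f + g)).
Proof.
have [w sumw] := exists_addition_word.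
move=> Lf Lg gf gg; rewrite -sumw ?Lie_aug1 //; apply: grouplike_word_prod => //; by case.
Qed.

Lemma grouplike_exp_approx (u : magnus A F c) i : grouplike u -> (0 < i)%N -> (i <= c.+1)%N ->
  exists f, [/\ Lie f, grouplike (mexp f) & val u - texp f \in aug i].
Proof.
move=> gu; elim: i => // i IHi _ lei; have fact0 := fact_neq0_pchar pcharF c_lt_p.
have [->|i_gt0] := posnP i.
  exists 0; rewrite mexp0 texp0 magnus_aug1; split=> //; [exact: Lie0 | exact: grouplike1].
have [f [Lf gf uf]] := IHi i_gt0 (ltnW lei); have f1 := Lie_aug1 Lf.
pose v := ((mexp f)^-1 * u)%g.
have mexpM_v : texp f * val v = val u by rewrite -val_mexp // -val_magnusM mulKVg.
have vi : v \in magnus_filt i.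
  apply/magnus_filtP; rewrite -(val_magnusVM (mexp f)) val_magnusM -mulrBr val_mexp //.
  exact: augMl.
have gv : grouplike v := grouplikeM (grouplikeV pcharF c_lt_p gf) gu.
pose g := homog_part i (val v); have gi : g \in homog i := homog_part_homog _ _.
have Lg : Lie g by apply: (grouplike_leading _ pcharF c_lt_p) => //; rewrite i_gt0.
exists (f + g); split; first exact: LieD.
  by apply: grouplike_mexpD => //; apply: (grouplike_mexp _ pcharF c_lt_p i_gt0).
have -> : val u - texp (f + g) =
    texp f * (val v - 1 - g) - (texp (f + g) - texp f * (1 + g)).
  by rewrite -addrA -opprD mulrBr mexpM_v opprB addrA subrK.
apply: rpredB; last exact: texp_addr (homog_aug gi).
rewrite augMl // /g -homog_part_sub1 //; apply/subr_homog_part_aug.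
exact/magnus_filtP.
Qed.

Lemma grouplike_exp (u : magnus A F c) : grouplike u -> exists2 f, Lie f & u = mexp f.
Proof.
move=> gu; have [f [Lf _ uf]] := grouplike_exp_approx gu (ltn0Sn c) (leqnn _).
exists f => //; apply/val_inj/eqP.
by rewrite (val_mexp (Lie_aug1 Lf)) -subr_eq0 (aug_eq0 uf).
Qed.

End LazardWords.

(** * Additive functions on the lower central series *)

Lemma lcn_commg (gT : finGroupType) (G : {group gT}) (i j : nat) :
  ([~: 'L_i.+1(G), 'L_j.+1(G)] \subset 'L_(i + j).+2(G))%g.
Proof.
elim: j i => [|j IHj] i; first by rewrite addn0 lcn1 lcnSn.
set N := ('L_(i + j.+1).+2(G))%G.
have nN (K : {group gT}) : (K \subset G -> K \subset 'N(N))%g.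
  by move=> sKG; apply: subset_trans sKG (lcn_norm _ _).
have sLG k : ('L_k(G) \subset G)%g by apply: lcn_sub.
have nNL k := nN ('L_k(G))%G (sLG k); have nNG := nN G (subxx _).
have quo_commg1 (K1 K2 K3 : {group gT}) : (K1 \subset G -> K2 \subset G -> K3 \subset G ->
    [~: K1, K2, K3] \subset N -> [~: K1 / N, K2 / N, K3 / N] = 1)%g.
  move=> s1 s2 s3 sN; rewrite -!quotientR ?comm_subG ?nN //; apply/trivgP.
  by rewrite quotient_sub1 // (subset_trans sN) // normG.
have quo_lcn1 : ([~: 'L_j.+1(G) / N, G / N, 'L_i.+1(G) / N] = 1)%g.
  apply: (@three_subgroup _ (G / N) ('L_i.+1(G) / N) ('L_j.+1(G) / N))%G.
    apply: (quo_commg1 G ('L_i.+1(G))%G ('L_j.+1(G))%G) => //=.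
    by rewrite (commGC G) -lcnSn /N addnS -addSn IHj.
  apply: (quo_commg1 ('L_i.+1(G))%G ('L_j.+1(G))%G G) => //=.
  by rewrite /N addnS; exact: (commSg G (IHj i)).
have nNLG : [~: 'L_j.+1(G), G]%g \subset 'N(N)%g by exact: comm_subG (nNL j.+1) nNG.
have nNLGL := comm_subG nNLG (nNL i.+1).
by rewrite commGC -(quotient_sub1 nNLGL) (quotientR nNLG (nNL _)) (quotientR (nNL _) nNG) quo_lcn1.
Qed.

Lemma mem_lcn_commg (gT : finGroupType) (G : {group gT}) (i j : nat) (x y : gT) :
  (0 < i)%N -> (0 < j)%N -> x \in 'L_i(G)%g -> y \in 'L_j(G)%g ->
  [~ x, y]%g \in 'L_(i + j)(G)%g.
Proof.
case: i => // i _; case: j => // j _ Lx Ly; rewrite addnS addSn.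
exact: subsetP (lcn_commg _ _ _) _ (mem_commg Lx Ly).
Qed.

Section LcnAdditive.
Variables (gT : finGroupType) (G : {group gT}) (V : zmodType).
Local Notation L k := ('L_k(G)%g).
Implicit Types (phi psi : gT -> V) (x y z : gT) (i j k : nat).

(* Equivalently, [phi] is a homomorphism to [V] from the factor
   ['L_k(G) / 'L_k.+1(G)] of the lower central series. *)
Definition lcn_additive k phi :=
  {in L k &, {morph phi : x y / (x * y)%g >-> x + y}} /\ {in L k.+1, forall x, phi x = 0}.

Lemma lcn_le i j x : (i <= j)%N -> x \in L j -> x \in L i.
Proof. by move=> leij; apply: subsetP (lcn_sub_leq _ leij) _. Qed.

Lemma mem_lcnJ k x y : x \in L k -> y \in G -> (x ^ y)%g \in L k.
Proof. by move=> Lx Gy; rewrite memJ_norm // (subsetP (lcn_norm _ _)). Qed.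

Lemma mem_lcn_commgG k x y : (0 < k)%N -> x \in L k -> y \in G -> [~ x, y]%g \in L k.+1.
Proof. by move=> k_gt0 Lx Gy; rewrite -addn1; apply: mem_lcn_commg; rewrite ?lcn1. Qed.

Lemma lcn_additive1 k phi : lcn_additive k phi -> phi 1%g = 0.
Proof. by case=> _ -> //; apply: group1. Qed.

Lemma lcn_additiveV k phi x : lcn_additive k phi -> x \in L k -> phi x^-1%g = - phi x.
Proof.
move=> phi_add Lx; apply/eqP; rewrite -addr_eq0 -(proj1 phi_add) ?groupV //.
by rewrite mulVg (lcn_additive1 phi_add).
Qed.

Lemma lcn_additiveJ k phi x y : (0 < k)%N -> lcn_additive k phi -> x \in L k -> y \in G ->
  phi (x ^ y)%g = phi x.
Proof.
move=> k_gt0 [phiM phi0] Lx Gy; have Lxy := mem_lcn_commgG k_gt0 Lx Gy.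
by rewrite conjg_mulR phiM ?(phi0 _ Lxy) ?addr0 //; exact: lcn_le (leqnSn k) Lxy.
Qed.

Lemma lcn_additive_commgl i j phi y : (0 < i)%N -> (0 < j)%N ->
  lcn_additive (i + j) phi -> y \in L j -> lcn_additive i (fun x => phi [~ x, y]%g).
Proof.
move=> i_gt0 j_gt0 phi_add Ly; have [phiM phi0] := phi_add.
have Gx k x : x \in L k -> x \in G by apply/subsetP/lcn_sub.
split=> [x x' Lx Lx'|x Lx]; last by apply: phi0; rewrite -addSn; apply: mem_lcn_commg.
have Lxy : [~ x, y]%g \in L (i + j) by apply: mem_lcn_commg.
have Lxy' : [~ x', y]%g \in L (i + j) by apply: mem_lcn_commg.
rewrite commMgJ phiM ?(lcn_additiveJ _ phi_add) ?addn_gt0 ?i_gt0 ?(Gx i) //.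
by apply: mem_lcnJ; rewrite ?(Gx i).
Qed.

Lemma lcn_additive_commgr i j phi x : (0 < i)%N -> (0 < j)%N ->
  lcn_additive (i + j) phi -> x \in L i -> lcn_additive j (fun y => phi [~ x, y]%g).
Proof.
move=> i_gt0 j_gt0 phi_add Lx; have [phiM phi0] := phi_add.
have Gy k y : y \in L k -> y \in G by apply/subsetP/lcn_sub.
split=> [y y' Ly Ly'|y Ly]; last by apply: phi0; rewrite -addnS; apply: mem_lcn_commg.
have Lxy : [~ x, y]%g \in L (i + j) by apply: mem_lcn_commg.
have Lxy' : [~ x, y']%g \in L (i + j) by apply: mem_lcn_commg.
rewrite commgMJ phiM ?(lcn_additiveJ _ phi_add) ?addn_gt0 ?i_gt0 ?(Gy j) 1?addrC //.
by apply: mem_lcnJ; rewrite ?(Gy j).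
Qed.

Lemma lcn_additive_jacobi i j k phi x y z : (0 < i)%N -> (0 < j)%N -> (0 < k)%N ->
  lcn_additive (i + j + k) phi -> x \in L i -> y \in L j -> z \in L k ->
  phi [~ x, y, z]%g + phi [~ y, z, x]%g + phi [~ z, x, y]%g = 0.
Proof.
have hall_witt_term a b d u v w : (0 < a)%N -> (0 < b)%N -> (0 < d)%N ->
    lcn_additive (a + b + d) phi -> u \in L a -> v \in L b -> w \in L d ->
    phi ([~ u, v^-1, w] ^ v)%g = - phi [~ u, v, w]%g /\ ([~ u, v^-1, w] ^ v)%g \in L (a + b + d).
  move=> a_gt0 b_gt0 d_gt0 phi_add Lu Lv Lw; have ab_gt0 : (0 < a + b)%N by rewrite addn_gt0 a_gt0.
  have Gv : v \in G by apply: subsetP (lcn_sub _ _) _ Lv.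
  have Luvw : [~ u, v^-1, w]%g \in L (a + b + d) by rewrite !mem_lcn_commg ?groupV.
  split; last exact: mem_lcnJ.
  rewrite (lcn_additiveJ _ phi_add) ?addn_gt0 ?a_gt0 //.
  have phi_w := lcn_additive_commgl ab_gt0 d_gt0 phi_add Lw.
  exact: lcn_additiveV (lcn_additive_commgr a_gt0 b_gt0 phi_w Lu) Lv.
move=> i_gt0 j_gt0 k_gt0 phi_add Lx Ly Lz.
have phi_add2 : lcn_additive (j + k + i) phi by rewrite addnC addnA.
have phi_add3 : lcn_additive (k + i + j) phi by rewrite -addnA addnC.
have [phi1 L1] := hall_witt_term _ _ _ _ _ _ i_gt0 j_gt0 k_gt0 phi_add Lx Ly Lz.
have [phi2 L2] := hall_witt_term _ _ _ _ _ _ j_gt0 k_gt0 i_gt0 phi_add2 Ly Lz Lx.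
have [phi3 L3] := hall_witt_term _ _ _ _ _ _ k_gt0 i_gt0 j_gt0 phi_add3 Lz Lx Ly.
have [phiM _] := phi_add; have := congr1 phi (Hall_Witt_identity x y z).
rewrite addnC addnA in L2; rewrite -addnA addnC in L3.
rewrite (lcn_additive1 phi_add) (phiM _ _ (groupM L1 L2) L3) (phiM _ _ L1 L2).
rewrite phi1 phi2 phi3 -!opprD => /eqP.
by rewrite oppr_eq0 => /eqP.
Qed.

Lemma lcn_additive_derivation i j k phi x y z : (0 < i)%N -> (0 < j)%N -> (0 < k)%N ->
  lcn_additive (i + j + k) phi -> x \in L i -> y \in L j -> z \in L k ->
  phi [~ x, [~ y, z]]%g = phi [~ x, y, z]%g - phi [~ x, z, y]%g.
Proof.
move=> i_gt0 j_gt0 k_gt0 phi_add Lx Ly Lz.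
have /eqP := lcn_additive_jacobi i_gt0 j_gt0 k_gt0 phi_add Lx Ly Lz.
have Lyz : [~ y, z]%g \in L (j + k) by apply: mem_lcn_commg.
have Lxz : [~ x, z]%g \in L (i + k) by apply: mem_lcn_commg.
have -> : phi [~ y, z, x]%g = - phi [~ x, [~ y, z]]%g.
  by rewrite -invgR (lcn_additiveV phi_add) // -addnA mem_lcn_commg ?addn_gt0 ?j_gt0.
have phi_y : lcn_additive (i + k) (fun t => phi [~ t, y]%g).
  by apply: lcn_additive_commgl j_gt0 _ Ly; rewrite ?addn_gt0 ?i_gt0 // addnAC.
rewrite -(invgR x z) (lcn_additiveV phi_y) // addrAC subr_eq0 => /eqP-> //.
Qed.

Lemma lcn_additive_eq_gen k phi psi (S : {set gT}) : lcn_additive k phi -> lcn_additive k psi ->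
  S \subset L k -> {in S, phi =1 psi} -> {in <<S>>%g, phi =1 psi}.
Proof.
move=> phi_add psi_add sSL eqS; pose E := [set x in L k | phi x == psi x].
suff /subsetP sSE : (<<S>> \subset E)%g by move=> x /sSE; rewrite inE => /andP[_ /eqP].
have gE : group_set E.
  apply/group_setP; split=> [|x y]; rewrite !inE.
    by rewrite group1 (lcn_additive1 phi_add) (lcn_additive1 psi_add) eqxx.
  case/andP=> Lx /eqP eqx /andP[Ly /eqP eqy].
  by rewrite groupM // (proj1 phi_add) // (proj1 psi_add) // eqx eqy eqxx.
rewrite (gen_subG S (Group gE)); apply/subsetP=> x Sx; rewrite inE (subsetP sSL) //.
by rewrite eqS ?eqxx.
Qed.

End LcnAdditive.

Lemma lcn_additive_comp (gT : finGroupType) (G : {group gT}) (V W : zmodType)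
    (f : {additive V -> W}) k (phi : gT -> V) :
  lcn_additive G k phi -> lcn_additive G k (f \o phi).
Proof.
case=> phiM phi0; split=> [x y Lx Ly|x Lx] /=; first by rewrite phiM // raddfD.
by rewrite phi0 // raddf0.
Qed.

Section LcnAdditiveGenerated.
Variables (A : finType) (gT : finGroupType) (g : A -> gT) (V : zmodType).
Local Notation G := <<[set g a | a : A]>>%G.
Implicit Types phi psi : gT -> V.

Lemma mem_gen_range a : g a \in G.
Proof. exact/mem_gen/imset_f. Qed.

Lemma lcn_additive_eq1 phi psi : lcn_additive G 1 phi -> lcn_additive G 1 psi ->
  (forall a, phi (g a) = psi (g a)) -> {in G, phi =1 psi}.
Proof.
move=> phi_add psi_add eqg; apply: (lcn_additive_eq_gen phi_add psi_add).
  by rewrite lcn1 subset_gen.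
by move=> _ /imsetP[a _ ->].
Qed.

Lemma lcn_additive_eqS k phi psi : (0 < k)%N ->
  lcn_additive G k.+1 phi -> lcn_additive G k.+1 psi ->
  (forall b a, b \in 'L_k(G)%g -> phi [~ b, g a]%g = psi [~ b, g a]%g) ->
  {in 'L_k.+1(G)%g, phi =1 psi}.
Proof.
case: k => // k _ phi_add psi_add eqg; rewrite lcnSn.
apply: (lcn_additive_eq_gen phi_add psi_add); first by rewrite lcnSn subset_gen.
move=> _ /imset2P[b y Lb Gy ->]; rewrite -[k.+2]addn1 in phi_add psi_add.
have phi_b := lcn_additive_commgr (ltn0Sn _) (ltn0Sn _) phi_add Lb.
have psi_b := lcn_additive_commgr (ltn0Sn _) (ltn0Sn _) psi_add Lb.
by apply: (lcn_additive_eq1 phi_b psi_b) Gy => a; apply: eqg.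
Qed.

End LcnAdditiveGenerated.

(** * The Dynkin map and relative freeness *)

Section Dynkin.
Variables (A : finType) (R : comNzRingType) (c : nat) (gT : finGroupType) (g : A -> gT).
Local Notation G := <<[set g a | a : A]>>%G.
Local Notation L k := ('L_k(G)%g).
Variable lead : nat -> gT -> tfalg A R c.
Hypothesis lead_additive : forall k, (0 < k)%N -> lcn_additive G k (lead k).
Hypothesis lead_gen : forall x, lead 1 (g x) = letter x.
Hypothesis lead_commg : forall k b x, (0 < k)%N -> b \in L k ->
  lead k.+1 [~ b, g x]%g = lieb (lead k b) (letter x).

Definition iter_commg a s := foldl (fun b x => [~ b, g x]%g) a s.

Variables (V : lmodType R) (n : nat) (eta : gT -> V).
Hypotheses (le_n_c : (n <= c)%N) (eta_additive : lcn_additive G n eta).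

Lemma iter_commg_additive j s : (0 < j)%N -> (j + size s)%N = n ->
  lcn_additive G j (fun a => eta (iter_commg a s)).
Proof.
elim: s j => [|x s IHs] j j_gt0 szs; first by rewrite -[j]addn0 szs.
have szs' : (j + 1 + size s)%N = n by rewrite -addnA add1n.
by apply: lcn_additive_commgl (IHs _ _ szs') _; rewrite ?addn_gt0 ?j_gt0 ?lcn1 ?mem_gen_range.
Qed.

(* On the lower central series iterated commutators behave like left-normed Lie
   brackets, so summing them over the words of the leading term of [b], weighted
   by its coefficients, performs the Dynkin substitution. *)
Lemma dynkin_bracket k b j a s : (0 < k)%N -> b \in L k -> (0 < j)%N -> a \in L j ->
  (j + k + size s)%N = n ->
  word_sum k (fun u => eta (iter_commg a (u ++ s))) (lead k b) = eta (iter_commg [~ a, b]%g s).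
Proof.
move=> k_gt0; elim: k k_gt0 b j a s => // k IHk _ b j a s Lb j_gt0 La szs.
have lhs_add := lcn_additive_comp (word_sum k.+1 (fun u => eta (iter_commg a (u ++ s))))
  (lead_additive (ltn0Sn k)).
have s_add : lcn_additive G (j + k.+1) (fun z => eta (iter_commg z s)).
  by apply: iter_commg_additive; rewrite // addn_gt0 j_gt0.
have rhs_add := lcn_additive_commgr j_gt0 (ltn0Sn k) s_add La.
case: (posnP k) => [k0|k_gt0].
  rewrite k0 in lhs_add rhs_add Lb *; apply: (lcn_additive_eq1 lhs_add rhs_add) Lb => x.
  by rewrite /= lead_gen word_sum_letter //; lia.
move: b Lb; apply: (lcn_additive_eqS k_gt0 lhs_add rhs_add) => b x Lb.
have Gx : g x \in L 1 by rewrite lcn1 mem_gen_range.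
rewrite /= lead_commg // /lieb linearB /= word_sumM_letter ?word_sum_letterM; try lia.
rewrite (eq_wsum (H' := fun u => eta (iter_commg a (u ++ x :: s)))); last first.
  by move=> u _; rewrite cat_rcons.
rewrite (IHk k_gt0 b j a (x :: s)) //=; last by lia.
rewrite (IHk k_gt0 b j.+1 [~ a, g x]%g) ?mem_lcn_commgG ?mem_gen_range //; last by lia.
rewrite -addn1 addnA in s_add.
by rewrite [RHS](lcn_additive_derivation j_gt0 k_gt0 (ltn0Sn 0) s_add La Lb Gx).
Qed.

Lemma dynkin_degree k b s : (0 < k)%N -> b \in L k -> (k + size s)%N = n ->
  word_sum k (fun u => eta (if u ++ s is x :: v then iter_commg (g x) v else 1%g)) (lead k b) =
    k%:R *: eta (iter_commg b s).
Proof.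
pose dynkin u := eta (if u is x :: v then iter_commg (g x) v else 1%g).
rewrite -/(dynkin _) => k_gt0; elim: k k_gt0 b s => // k IHk _ b s Lb szs.
have lhs_add := lcn_additive_comp (word_sum k.+1 (fun u => dynkin (u ++ s)))
  (lead_additive (ltn0Sn k)).
have s_add := iter_commg_additive (ltn0Sn k) szs.
have rhs_add := lcn_additive_comp ( *:%R k.+1%:R : V -> V) s_add.
case: (posnP k) => [k0|k_gt0].
  rewrite k0 in lhs_add rhs_add Lb *; apply: (lcn_additive_eq1 lhs_add rhs_add) Lb => x.
  by rewrite /= lead_gen word_sum_letter ?scale1r //; lia.
move: b Lb; apply: (lcn_additive_eqS k_gt0 lhs_add rhs_add) => b x Lb.
have Gx : g x \in L 1 by rewrite lcn1 mem_gen_range.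
rewrite /= lead_commg // /lieb linearB /= word_sumM_letter ?word_sum_letterM; try lia.
rewrite (eq_wsum (H' := fun u => dynkin (u ++ x :: s))); last by move=> u _; rewrite cat_rcons.
rewrite (IHk k_gt0 b (x :: s)) //=; last by lia.
rewrite (dynkin_bracket k_gt0 Lb (ltn0Sn 0) Gx) ?add1n //.
rewrite -(invgR b) (lcn_additiveV s_add) ?mem_lcn_commgG ?mem_gen_range //.
by rewrite opprK -natr1 scalerDl scale1r.
Qed.

Lemma dynkin_kernel b : (0 < n)%N -> b \in L n -> lead n b = 0 -> n%:R *: eta b = 0.
Proof.
move=> n_gt0 Lb lead0; have := dynkin_degree (s := [::]) n_gt0 Lb (addn0 n).
by rewrite lead0 linear0 => <-.
Qed.

End Dynkin.

Lemma lcn_factor_coordinates (p : nat) (gT : finGroupType) (G : {group gT}) (n : nat) :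
  prime p -> (0 < n)%N -> (forall x, x \in G -> x ^+ p = 1)%g ->
  exists (d : nat) (eta : gT -> 'rV['F_p]_d), lcn_additive G n eta /\
    {in 'L_n(G)%g, forall x, eta x = 0 -> x \in 'L_n.+1(G)%g}.
Proof.
move=> p_pr n_gt0 expG; pose Q := ('L_n(G) / 'L_n.+1(G))%G.
have nL : 'L_n(G)%g \subset 'N('L_n.+1(G))%g by apply: normal_norm (lcn_normalS _ _).
have nLx x : x \in 'L_n(G)%g -> x \in 'N('L_n.+1(G))%g by apply: subsetP.
have abQ : (p.-abelem Q)%g.
  rewrite abelemE //; apply/andP; split.
    by apply: abelianS (center_abelian (G / 'L_n.+1(G))%G); apply: lcn_central.
  apply/exponentP=> _ /morphimP[x Nx Lx ->].
  by rewrite -morphX // expG ?morph1 //; apply: subsetP (lcn_sub n G) _ Lx.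
have [Q1|ntQ] := eqVneq (Q : {set _}) 1%g.
  exists 0%N, (fun=> 0); split; first by split=> [x y _ _|x _]; rewrite ?addr0.
  by move/trivgP: Q1; rewrite quotient_sub1 // => /subsetP sL x Lx _; apply: sL.
exists _, (fun x => abelem_rV abQ ntQ (coset 'L_n.+1(G) x)); split; [split=> [x y Lx Ly|x Lx]|].
- by rewrite morphM ?nLx // abelem_rV_M // mem_quotient.
- by rewrite coset_id // morph1.
move=> x Lx eta0; apply: coset_idr; first exact: nLx.
apply: (abelem_rV_inj (abelE := abQ) (ntE := ntQ)); rewrite ?group1 ?mem_quotient //.
by rewrite eta0 morph1.
Qed.

HB.instance Definition _ (A : finType) (p c : nat) := Finite.on (tfalg A 'F_p c).
HB.instance Definition _ (A : finType) (p c : nat) := Finite.on (magnus A 'F_p c).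

Section RelativelyFree.
Variables (A : finType) (p c : nat).
Hypotheses (p_prime : prime p) (c_lt_p : (c < p)%N) (c_gt0 : (0 < c)%N).
Variables (gT : finGroupType) (g : A -> gT).
Hypotheses (expG : forall x : gT, (x ^+ p = 1)%g) (classG : 'L_c.+1([set: gT])%g = 1%g).
Local Notation magnus := (magnus A 'F_p c).
Local Notation X := (@letter A 'F_p c).

(** The subgroup generated by the pairs [(exp X_a, g a)] is the graph of a
    homomorphism: an element that is trivial in the first coordinate is killed
    degree by degree, since the Dynkin map sends its leading term to a nonzero
    multiple of its class in the lower central series. *)
Definition magnus_graph : {group magnus * gT} := <<[set (mexp (X a), g a) | a : A]>>%G.

Lemma lcn_magnus_filt k (u : magnus) : (0 < k)%N -> u \in 'L_k([set: magnus])%g ->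
  u \in magnus_filt k.
Proof.
case: k => // k _; elim: k u => [|k IHk] u; first by rewrite magnus_filt1.
have gF : group_set [set v : magnus | v \in magnus_filt k.+2].
  apply/group_setP; split=> [|v w]; rewrite !inE; [exact: magnus_filt1g | exact: gpredM].
rewrite lcnSn => Lu; suff : u \in Group gF by rewrite inE.
apply: subsetP u Lu; rewrite gen_subG; apply/subsetP => _ /imset2P[v w Lv _ ->].
by rewrite inE -[k.+2]addn1 magnus_commg_filt ?magnus_filt1 ?IHk.
Qed.

Lemma lcn_prod (hT kT : finGroupType) (G : {group hT * kT}) k (x : hT * kT) :
  x \in 'L_k(G)%g -> x.1 \in 'L_k([set: hT])%g /\ x.2 \in 'L_k([set: kT])%g.
Proof.
move=> Lx; split.
  have := mem_morphim [morphism of @fst hT kT] (in_setT x) Lx.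
  by rewrite morphim_lcn ?subsetT //; apply/subsetP/lcnS/subsetT.
have := mem_morphim [morphism of @snd hT kT] (in_setT x) Lx.
by rewrite morphim_lcn ?subsetT //; apply/subsetP/lcnS/subsetT.
Qed.

Lemma fst_commg (hT kT : finGroupType) (x y : hT * kT) : [~ x, y]%g.1 = [~ x.1, y.1]%g.
Proof. by []. Qed.

Definition graph_lead k (b : magnus * gT) := homog_part k (val b.1).

Lemma graph_lead_additive k : (0 < k)%N -> lcn_additive magnus_graph k (graph_lead k).
Proof.
move=> k_gt0; split=> [x y /lcn_prod[Lx _] /lcn_prod[Ly _]|x /lcn_prod[Lx _]].
  by rewrite /graph_lead homog_part_magnusM // lcn_magnus_filt.
rewrite /graph_lead -homog_part_sub1 //; apply/homog_part_eq0/magnus_filtP.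
exact: lcn_magnus_filt.
Qed.

Lemma magnus_graph_functional m h h' :
  (m, h) \in magnus_graph -> (m, h') \in magnus_graph -> h = h'.
Proof.
move=> Gh Gh'; apply/eqP; rewrite eq_mulVg1; apply/eqP; set x := (h^-1 * h')%g.
have Gx : (1%g, x) \in magnus_graph.
  have -> : (1%g, x) = ((m, h)^-1 * (m, h'))%g by congr (_, _); rewrite /= mulVg.
  by rewrite groupM ?groupV.
have expgE z n : (z ^+ n)%g = (z.1 ^+ n, z.2 ^+ n)%g :> magnus * gT.
  by elim: n => [|n IHn] //; rewrite !expgS IHn.
have pcharF := pchar_Fp p_prime.
have exp_graph z : z \in magnus_graph -> (z ^+ p = 1)%g.
  by move=> _; rewrite expgE expG (magnus_expg_pchar _ pcharF).
suff Lx n : (n <= c)%N -> (1%g, x) \in 'L_n.+1(magnus_graph)%g.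
  by have [_] := lcn_prod (Lx c (leqnn c)); rewrite classG => /set1P.
elim: n => [_|n IHn ltn]; first by rewrite lcn1.
have Lx := IHn (ltnW ltn).
have [d [eta [eta_add eta_inj]]] := lcn_factor_coordinates p_prime (ltn0Sn n) exp_graph.
have fact_neq0 := fact_neq0_pchar pcharF c_lt_p.
apply: eta_inj => //; apply: (scalerI (natr_neq0_of_fact (n := n.+1) fact_neq0 ltn)).
rewrite scaler0; apply: (dynkin_kernel graph_lead_additive _ _ ltn eta_add) => //.
- by move=> a; apply: homog_part_mexp_letter.
- move=> k b a k_gt0 /lcn_prod[Lb _]; have bk := lcn_magnus_filt k_gt0 Lb.
  rewrite -[X in lieb _ X](homog_part_mexp_letter fact_neq0 a c_gt0) -[k.+1]addn1.
  rewrite /graph_lead fst_commg.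
  exact: homog_part_magnusR k_gt0 (ltn0Sn 0) bk (magnus_filt1 _).
by rewrite /graph_lead (homog_part_of_homog _ (homog0_1 _ _ _)).
Qed.

End RelativelyFree.

(** * The Lazard operations *)

Definition class_exponent (p c : nat) (gT : finGroupType) :=
  (forall x : gT, (x ^+ p = 1)%g) /\ 'L_c.+1([set: gT])%g = 1%g.

Record lazard_system (p c : nat) := LazardSystem {
  lazard_prime : prime p;
  lazard_ltp : (c < p)%N;
  lazard_class_gt0 : (0 < c)%N;
  add_word : seq bool;
  bracket_word : seq bool;
  add_wordE : forall (A : finType) (f g : tfalg A 'F_p c), f \in aug 1 -> g \in aug 1 ->
    word_op add_word (mexp f) (mexp g) = mexp (f + g);
  bracket_wordE : forall (A : finType) (f g : tfalg A 'F_p c), f \in aug 1 -> g \in aug 1 ->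
    word_op bracket_word (mexp f) (mexp g) = mexp (lieb f g) }.

Lemma Fp_prime_field (p : nat) (k : 'F_p) : exists n, k = n%:R.
Proof. by exists (k : nat); rewrite natr_Zp. Qed.

Lemma lazard_system_inhabited (p c : nat) :
  prime p -> (c < p)%N -> (0 < c)%N -> inhabited (lazard_system p c).
Proof.
move=> p_pr lt_cp c_gt0; have pcharF := pchar_Fp p_pr.
have [wa addE] := exists_addition_word (@Fp_prime_field p) pcharF lt_cp c_gt0.
have [wb brE] := exists_bracket_word (@Fp_prime_field p) pcharF lt_cp c_gt0.
exact: inhabits (LazardSystem p_pr lt_cp c_gt0 addE brE).
Qed.

Lemma word_op_pair w (gT hT : finGroupType) (u v : gT) (h k : hT) :
  word_op w (u, h) (v, k) = (word_op w u v, word_op w h k).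
Proof. by elim: w => [|[] w IHw]; rewrite ?word_op_nil // !word_op_cons IHw. Qed.

Section LazardIdentities.
Variables (p c : nat) (S : lazard_system p c).
Local Notation add := (word_op (add_word S)).
Local Notation br := (word_op (bracket_word S)).

Let p_prime := lazard_prime S.
Let c_lt_p := lazard_ltp S.
Let c_gt0 := lazard_class_gt0 S.
Let fact_neq0 := fact_neq0_pchar (pchar_Fp p_prime) c_lt_p.

Section LazardRelation.
Variables (A : finType) (gT : finGroupType) (g : A -> gT).
Implicit Types (f : tfalg A 'F_p c) (h k : gT).

(* [h] is the value at [g] of a word whose value at the letters of the free
   group is [exp f]. *)
Definition lazard_rel f h := f \in aug 1 /\ (mexp f, h) \in magnus_graph p c g.

Lemma lazard_rel_functional f f' h h' : class_exponent p c gT ->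
  lazard_rel f h -> lazard_rel f' h' -> f = f' -> h = h'.
Proof.
move=> [expG classG] [_ Gh] [_ Gh'] eqf; rewrite -eqf in Gh'.
exact: (magnus_graph_functional p_prime c_lt_p c_gt0 expG classG Gh Gh').
Qed.

Lemma lazard_rel_letter a : lazard_rel (letter a) (g a).
Proof. by split; [apply: letter_aug | apply/mem_gen/imset_f]. Qed.

Lemma lazard_relD f f' h h' :
  lazard_rel f h -> lazard_rel f' h' -> lazard_rel (f + f') (add h h').
Proof.
move=> [f1 Gh] [f'1 Gh']; split; first exact: rpredD.
by rewrite -(add_wordE S f1 f'1) -word_op_pair mem_word_op.
Qed.

Lemma lazard_rel_lieb f f' h h' :
  lazard_rel f h -> lazard_rel f' h' -> lazard_rel (lieb f f') (br h h').
Proof.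
move=> [f1 Gh] [f'1 Gh']; split; first exact: aug_le (lieb_aug f1 f'1).
by rewrite -(bracket_wordE S f1 f'1) -word_op_pair mem_word_op.
Qed.

Lemma lazard_rel0 : lazard_rel 0 1%g.
Proof. by split; [apply: rpred0 | rewrite mexp0 group1]. Qed.

Lemma lazard_relN f h : lazard_rel f h -> lazard_rel (- f) h^-1%g.
Proof.
move=> [f1 Gh]; split; first by rewrite rpredN.
by rewrite (mexpN fact_neq0 f1) -[(_, _)]/((mexp f, h)^-1)%g groupV.
Qed.

Lemma lazard_relMn f h n : lazard_rel f h -> lazard_rel (f *+ n) (h ^+ n)%g.
Proof.
move=> [f1 Gh]; split; first exact: rpredMn.
rewrite (mexpMn fact_neq0 _ f1); elim: n => [|n IHn]; first exact: group1.
by rewrite !expgS; apply: (groupM Gh IHn).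
Qed.

End LazardRelation.

Section Identities.
Variable gT : finGroupType.
Hypothesis G_ce : class_exponent p c gT.
Implicit Types x y z : gT.

Definition triple x y z (o : option bool) : gT :=
  match o with Some true => x | Some false => y | None => z end.

Let relx x y z := lazard_rel_letter (triple x y z) (Some true).
Let rely x y z := lazard_rel_letter (triple x y z) (Some false).
Let relz x y z := lazard_rel_letter (triple x y z) None.

Lemma lazard_addC : commutative (add : gT -> gT -> gT).
Proof.
move=> x y; have [rx ry] := (relx x y 1, rely x y 1)%g.
exact: (lazard_rel_functional G_ce (lazard_relD rx ry) (lazard_relD ry rx) (addrC _ _)).
Qed.

Lemma lazard_addA : associative (add : gT -> gT -> gT).
Proof.
move=> x y z; have [[rx ry] rz] := (relx x y z, rely x y z, relz x y z).
exact: (lazard_rel_functional G_ce (lazard_relD rx (lazard_relD ry rz))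
  (lazard_relD (lazard_relD rx ry) rz) (addrA _ _ _)).
Qed.

Lemma lazard_add0 : right_id 1%g (add : gT -> gT -> gT).
Proof.
move=> x; have rx := relx x 1%g 1%g.
exact: (lazard_rel_functional G_ce (lazard_relD rx (lazard_rel0 _)) rx (addr0 _)).
Qed.

Lemma lazard_addV x : add x x^-1%g = 1%g.
Proof.
have rx := relx x 1%g 1%g.
exact: (lazard_rel_functional G_ce (lazard_relD rx (lazard_relN rx)) (lazard_rel0 _) (subrr _)).
Qed.

Lemma lazard_addX x n : add x (x ^+ n)%g = (x ^+ n.+1)%g.
Proof.
have rx := relx x 1%g 1%g.
exact: (lazard_rel_functional G_ce (lazard_relD rx (lazard_relMn n rx))
  (lazard_relMn n.+1 rx) (esym (mulrS _ _))).
Qed.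

Lemma lazard_bracketDl x y z : br (add x y) z = add (br x z) (br y z).
Proof.
have [[rx ry] rz] := (relx x y z, rely x y z, relz x y z).
apply: (lazard_rel_functional G_ce (lazard_rel_lieb (lazard_relD rx ry) rz)
  (lazard_relD (lazard_rel_lieb rx rz) (lazard_rel_lieb ry rz))).
exact: linearDl.
Qed.

Lemma lazard_bracketDr x y z : br z (add x y) = add (br z x) (br z y).
Proof.
have [[rx ry] rz] := (relx x y z, rely x y z, relz x y z).
apply: (lazard_rel_functional G_ce (lazard_rel_lieb rz (lazard_relD rx ry))
  (lazard_relD (lazard_rel_lieb rz rx) (lazard_rel_lieb rz ry))).
exact: linearDr.
Qed.

Lemma lazard_bracket1r x : br x 1%g = 1%g.
Proof.
have rx := relx x 1%g 1%g; have r0 := lazard_rel0 (triple x 1 1)%g.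
exact: (lazard_rel_functional G_ce (lazard_rel_lieb rx r0) r0 (linear0r _ _)).
Qed.

Lemma lazard_bracket1l x : br 1%g x = 1%g.
Proof.
have rx := relx x 1%g 1%g; have r0 := lazard_rel0 (triple x 1 1)%g.
exact: (lazard_rel_functional G_ce (lazard_rel_lieb r0 rx) r0 (linear0l _ _)).
Qed.

Lemma lazard_bracket_commute x y : commute x y -> br x y = 1%g.
Proof. by move/(word_op_commute _)->; rewrite lazard_bracket1r lazard_bracket1l mulg1. Qed.

Lemma lazard_bracket_lcn (k : nat) x y : (0 < k)%N ->
  y \in 'L_k([set: gT])%g -> br x y \in 'L_k.+1([set: gT])%g.
Proof.
move=> k_gt0 Ly; set N := ('L_k.+1([set: gT]))%G.
have nN z : z \in 'N(N)%g by apply: (subsetP (lcn_norm _ _)); rewrite inE.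
have cosetM : {morph coset N : a b / (a * b)%g} by move=> a b; rewrite morphM.
apply: coset_idr => //; rewrite (word_op_morph _ cosetM) word_op_commute.
  rewrite -[X in (word_op _ _ X * _)%g](morph1 (coset_morphism N)).
  rewrite -[X in (_ * word_op _ X _)%g](morph1 (coset_morphism N)).
  by rewrite -!(word_op_morph _ cosetM) lazard_bracket1r lazard_bracket1l morph1 mulg1.
apply/commgP; rewrite -morphR //; apply/eqP/coset_id.
by rewrite -invgR groupV mem_lcn_commgG ?inE.
Qed.

Lemma lazard_engel x y : iter c (br x) y = 1%g.
Proof.
have [_ classG] := G_ce.
have iter_lcn n : iter n (br x) y \in 'L_n.+1([set: gT])%g.
  by elim: n => [|n IHn]; rewrite ?lcn1 ?inE // iterS lazard_bracket_lcn.
by have := iter_lcn c; rewrite classG => /set1P.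
Qed.

End Identities.

Lemma exists_lazard_product : exists2 f : tfalg bool 'F_p c, Lie f &
  (mexp (letter true : tfalg bool 'F_p c) * mexp (letter false))%g = mexp f.
Proof.
have pcharF := pchar_Fp p_prime; have prime_field := @Fp_prime_field p.
apply: (grouplike_exp prime_field pcharF c_lt_p c_gt0).
have exp_letter b : grouplike (mexp (letter b : tfalg bool 'F_p c)).
  apply: (grouplike_mexp prime_field pcharF c_lt_p (ltn0Sn 0)); first exact: letter_homog.
  exact: Lie_letter.
exact: grouplikeM.
Qed.

Section LazardMorphism.
Variables (gT hT : finGroupType) (f : gT -> hT).
Hypotheses (G_ce : class_exponent p c gT) (H_ce : class_exponent p c hT).
Hypotheses (f_add : {morph f : x y / add x y}) (f_br : {morph f : x y / br x y}).

Lemma lazard_add_morph1 : f 1%g = 1%g.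
Proof.
have := lazard_add0 H_ce (f 1%g); rewrite -(lazard_addV H_ce (f 1%g)) (lazard_addA H_ce).
by rewrite -f_add (lazard_add0 G_ce).
Qed.

Lemma Lie_lazard_rel (A : finType) (g : A -> gT) (g' : A -> hT) e :
  (forall a, f (g a) = g' a) -> Lie e ->
  exists2 h, lazard_rel g e h & lazard_rel g' e (f h).
Proof.
move=> f_g; elim=> {e} [a||e e' _ [h Gh Hh] _ [h' Gh' Hh']|e a _ [h Gh Hh]].
- by exists (g a); rewrite ?f_g; apply: lazard_rel_letter.
- by exists 1%g; rewrite ?lazard_add_morph1; apply: lazard_rel0.
- by exists (add h h'); rewrite ?f_add; apply: lazard_relD.
exists (br h (g a)); rewrite ?f_br ?f_g; apply: lazard_rel_lieb => //;
  exact: lazard_rel_letter.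
Qed.

(* The product of two elements is the value of a term in the Lazard operations. *)
Lemma lazard_morph : {morph f : x y / (x * y)%g}.
Proof.
move=> x y; have [e Le eqe] := exists_lazard_product.
pose pair (kT : finGroupType) (a b : kT) (t : bool) := if t then a else b.
have mul_rel (kT : finGroupType) (a b : kT) : lazard_rel (pair kT a b) e (a * b)%g.
  split; first exact: Lie_aug1.
  have [_ Ga] := lazard_rel_letter (pair kT a b) true.
  have [_ Gb] := lazard_rel_letter (pair kT a b) false.
  by rewrite -eqe; apply: (groupM Ga Gb).
have [|h Gh Hh] := Lie_lazard_rel (g := pair gT x y) (g' := pair hT (f x) (f y)) _ Le.
  by case.
rewrite -(lazard_rel_functional G_ce Gh (mul_rel _ x y) erefl).
exact: (lazard_rel_functional H_ce Hh (mul_rel _ _ _) erefl).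
Qed.

End LazardMorphism.

(* If the brackets vanish then inversion, which is the opposite for the addition,
   preserves the Lazard operations. *)
Lemma lazard_bracket_trivial_abelian (gT : finGroupType) : class_exponent p c gT ->
  (forall x y : gT, br x y = 1%g) -> abelian [set: gT].
Proof.
move=> G_ce br1.
have invM : {morph (fun z : gT => z^-1%g) : x y / (x * y)%g}.
  apply: lazard_morph => // x y; last by rewrite !br1 invg1.
  have rx := lazard_rel_letter (triple x y 1)%g (Some true).
  have ry := lazard_rel_letter (triple x y 1)%g (Some false).
  exact: (lazard_rel_functional G_ce (lazard_relN (lazard_relD rx ry))
    (lazard_relD (lazard_relN rx) (lazard_relN ry)) (opprD _ _)).
by apply/centsP=> x _ y _; apply: invg_inj; rewrite invM -invMg.
Qed.

End LazardIdentities.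

(** * The Lie algebra of a group *)

Section LazardAlgebra.
Variables (p c : nat) (S : lazard_system p c) (gT : finGroupType).
Hypothesis G_ce : class_exponent p c gT.

(* The proof is an argument so that the instances below can be inferred. *)
Definition lazard_algebra of lazard_system p c & class_exponent p c gT : Type := gT.
Local Notation L := (lazard_algebra S G_ce).
HB.instance Definition _ := Finite.on L.
Implicit Types x y z : L.

Definition lazard_zero : L := 1%g.
Definition lazard_opp x : L := (x^-1)%g.
Definition lazard_add x y : L := word_op (add_word S) x y.
Definition lazard_bracket x y : L := word_op (bracket_word S) x y.

Fact lazard_add0l : left_id lazard_zero lazard_add.
Proof. by move=> x; rewrite /lazard_add (lazard_addC S G_ce) (lazard_add0 S G_ce). Qed.
Fact lazard_addNl : left_inverse lazard_zero lazard_opp lazard_add.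
Proof. by move=> x; rewrite /lazard_add (lazard_addC S G_ce) (lazard_addV S G_ce). Qed.

HB.instance Definition _ := GRing.isZmodule.Build L
  (lazard_addA S G_ce : associative lazard_add) (lazard_addC S G_ce : commutative lazard_add)
  lazard_add0l lazard_addNl.

Lemma lazard_mulrn x n : x *+ n = (x ^+ n)%g.
Proof. by elim: n => [|n IHn]; rewrite ?mulr0n // mulrS IHn; apply: lazard_addX. Qed.

Definition lazard_scale (k : 'F_p) x : L := x *+ (k : nat).

Lemma lazard_mulrn_mod x n : x *+ (n %% p) = x *+ n.
Proof.
have xp : x *+ p = 0 by rewrite lazard_mulrn; exact: (proj1 G_ce).
by rewrite {2}(divn_eq n p) mulrnDr mulnC mulrnA xp mul0rn add0r.
Qed.

Lemma lazard_scale_nat n x : lazard_scale n%:R x = x *+ n.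
Proof. by rewrite /lazard_scale val_Fp_nat ?(lazard_prime S) // lazard_mulrn_mod. Qed.

Fact lazard_scaleA a b x : lazard_scale a (lazard_scale b x) = lazard_scale (a * b) x.
Proof.
by rewrite -[a]natr_Zp -[b]natr_Zp -natrM !lazard_scale_nat -mulrnA mulnC.
Qed.
Fact lazard_scale1 : left_id 1 lazard_scale.
Proof. by move=> x; rewrite -[1]/(1%:R) lazard_scale_nat. Qed.
Fact lazard_scaleDr : right_distributive lazard_scale +%R.
Proof. by move=> a x y; rewrite /lazard_scale mulrnDl. Qed.
Fact lazard_scaleDl x : {morph lazard_scale^~ x : a b / a + b}.
Proof.
by move=> a b; rewrite -[a]natr_Zp -[b]natr_Zp -natrD !lazard_scale_nat mulrnDr.
Qed.

HB.instance Definition _ := GRing.Zmodule_isLmodule.Build 'F_p L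
  lazard_scaleA lazard_scale1 lazard_scaleDr lazard_scaleDl.

Lemma lazard_scaleE (k : 'F_p) x : k *: x = (x ^+ k)%g.
Proof. exact: lazard_mulrn. Qed.

End LazardAlgebra.

Lemma Fp_scalable (p : nat) (U V : lmodType 'F_p) (f : U -> V) :
  {morph f : x y / x + y} -> scalable f.
Proof.
move=> fD k x; have f0 : f 0 = 0 by apply: (addrI (f 0)); rewrite -fD !addr0.
have fMn n : f (x *+ n) = f x *+ n by elim: n => [|n IHn]; rewrite ?mulr0n // !mulrS fD IHn.
by rewrite -[k]natr_Zp !scaler_nat.
Qed.

Lemma Fp_linear (p : nat) (U V : lmodType 'F_p) (f : U -> V) :
  {morph f : x y / x + y} -> linear f.
Proof. by move=> fD k x y; rewrite fD (Fp_scalable fD). Qed.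

Section LazardBracket.
Variables (p c : nat) (S : lazard_system p c) (gT : finGroupType).
Hypothesis G_ce : class_exponent p c gT.
Local Notation L := (lazard_algebra S G_ce).
Local Notation br := (@lazard_bracket p c S gT G_ce).

Fact lazard_bracket_is_bilinear : bilinear_for *:%R *:%R br.
Proof.
split=> z; apply: Fp_linear => x y; first exact: lazard_bracketDl G_ce x y z.
exact: lazard_bracketDr G_ce x y z.
Qed.
HB.instance Definition _ :=
  bilinear_isBilinear.Build 'F_p L L L *:%R *:%R br lazard_bracket_is_bilinear.

End LazardBracket.

(** * Central extensions by bilinear cocycles *)

Lemma isog_setTP (gT hT : finGroupType) :
  ([set: gT] \isog [set: hT])%g <->
  exists2 f : gT -> hT, {morph f : x y / (x * y)%g} & bijective f.
Proof.
split=> [/isogP[f injf imf]|[f fM bijf]].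
  exists f; first by move=> x y; rewrite morphM ?inE.
  apply: inj_card_bij; first by move=> x y; apply: (injmP injf); rewrite inE.
  by rewrite -!cardsT -imf leq_morphim.
pose fm := Morphism (in2W fM : {in [set: gT] &, {morph f : x y / (x * y)%g}}).
apply/isogP; exists fm; first by apply/injmP => x y _ _; apply: bij_inj.
apply/eqP; rewrite -subTset; apply/subsetP=> y _; have [g _ gK] := bijf.
by rewrite -(gK y); apply: mem_morphim; rewrite inE.
Qed.

Section CocycleExtension.
Variables (R : nzRingType) (U W : finLmodType R) (beta : {bilinear U -> U -> W}).

Definition cocycle_ext of {bilinear U -> U -> W} := (U * W)%type.
Local Notation E := (cocycle_ext beta).
HB.instance Definition _ := Finite.on E.
Implicit Types (u v : U) (w : W) (a b : E).

Definition ext_mul a b : E := (a.1 + b.1, a.2 + b.2 + beta a.1 b.1).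
Definition ext_one : E := (0, 0).
Definition ext_inv a : E := (- a.1, - a.2 + beta a.1 a.1).

Fact ext_mulA : associative ext_mul.
Proof.
move=> [u w] [u' w'] [u'' w'']; congr (_, _); rewrite /= ?addrA // linearDl linearDr.
rewrite -!addrA; congr (_ + (_ + _)); rewrite [RHS]addrCA; congr (_ + _).
by rewrite addrC -addrA.
Qed.

Fact ext_mul1 : left_id ext_one ext_mul.
Proof. by move=> [u w]; congr (_, _); rewrite /= add0r // linear0l addr0. Qed.

Fact ext_mulV : left_inverse ext_one ext_inv ext_mul.
Proof.
move=> [u w]; congr (_, _); first exact: addNr.
by rewrite /= linearNl addrAC addrK addNr.
Qed.

HB.instance Definition _ := Finite_isGroup.Build E ext_mulA ext_mul1 ext_mulV.

Definition commutator_form u v := beta u v - beta v u.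

Lemma commutator_form0l u : commutator_form 0 u = 0.
Proof. by rewrite /commutator_form linear0l linear0r subrr. Qed.

Lemma ext_mulE a b : (a * b)%g = (a.1 + b.1, a.2 + b.2 + beta a.1 b.1) :> E.
Proof. by []. Qed.

Lemma ext_commgE a b : [~ a, b]%g = (0, commutator_form a.1 b.1) :> E.
Proof.
apply: (mulgI (b * a)%g); rewrite -commgC !ext_mulE /= linear0r !addr0 addrC; congr (_, _).
by rewrite /commutator_form [beta a.1 b.1 - _]addrC addrA addrK [b.2 + a.2]addrC.
Qed.

Lemma ext_expgE a n : (a ^+ n)%g = (a.1 *+ n, a.2 *+ n + beta a.1 a.1 *+ 'C(n, 2)) :> E.
Proof.
elim: n => [|n IHn]; first by rewrite expg0 !mulr0n addr0.
rewrite expgSr IHn ext_mulE /=; congr (_, _); first by rewrite mulrSr.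
rewrite linearMnl binS bin1 mulrnDr mulrSr -!addrA; congr (_ + _).
by rewrite addrCA; congr (_ + _); rewrite addrC.
Qed.

Lemma ext_expg_pchar p a : odd p -> p \in [pchar R] -> (a ^+ p)%g = 1%g.
Proof.
move=> p_odd pcharR; have p_pr := pcharf_prime pcharR.
have mulrn_p (X : lmodType R) (x : X) : x *+ p = 0.
  by rewrite -scaler_nat (pcharf0 pcharR) scale0r.
have /dvdnP[k bin_p2] : (p %| 'C(p, 2))%N by rewrite prime_dvd_bin // odd_prime_gt2.
by rewrite ext_expgE bin_p2 mulrnA !mulrn_p addr0.
Qed.

Lemma lcn3_ext : 'L_3([set: E])%g = 1%g.
Proof.
have L2_fst x : x \in 'L_2([set: E])%g -> x.1 = 0.
  rewrite lcnSn => /gen_prodgP[n [h inh ->]].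
  elim: n h inh => [|n IHn] h inh; first by rewrite big_ord0.
  rewrite big_ord_recl ext_mulE /= IHn => [|i]; last exact: inh.
  by have /imset2P[y z _ _ ->] := inh ord0; rewrite ext_commgE addr0.
apply/eqP; rewrite (lcnSn 1) -subG1 gen_subG.
apply/subsetP=> _ /imset2P[x y /L2_fst x1 _ ->].
by rewrite ext_commgE x1 commutator_form0l set11.
Qed.

Lemma abelian_ext : abelian [set: E] -> forall u v, commutator_form u v = 0.
Proof.
move=> /centsP cE u v; have /commgP := cE (u, 0) (in_setT _) (v, 0) (in_setT _).
by rewrite ext_commgE => /eqP[].
Qed.

Definition commutant u : {set U} := [set v | commutator_form u v == 0].

Definition nondegenerate_form := forall u, (forall v, commutator_form u v = 0) -> u = 0.

Lemma ext_central w b : (((0, w) : E) * b)%g = (b * ((0, w) : E))%g.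
Proof. by rewrite !ext_mulE /= linear0l linear0r !addr0 add0r addrC [b.2 + w]addrC. Qed.

End CocycleExtension.

Section ExtensionMorphisms.
Variables (R S : nzRingType) (U1 W1 : finLmodType R) (U2 W2 : finLmodType S).
Variables (beta1 : {bilinear U1 -> U1 -> W1}) (beta2 : {bilinear U2 -> U2 -> W2}).
Local Notation E1 := (cocycle_ext beta1).
Local Notation E2 := (cocycle_ext beta2).

Lemma cocycle_morph_isog (f : U1 -> U2) (g : W1 -> W2) :
  {morph f : u v / u + v} -> {morph g : u v / u + v} -> bijective f -> bijective g ->
  (forall u v, g (beta1 u v) = beta2 (f u) (f v)) -> ([set: E1] \isog [set: E2])%g.
Proof.
move=> fD gD [f' fK f'K] [g' gK g'K] g_beta; apply/isog_setTP.
exists (fun a : E1 => (f a.1, g a.2) : E2).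
  by move=> [u w] [u' w']; rewrite !ext_mulE /= fD !gD g_beta.
by exists (fun a : E2 => (f' a.1, g' a.2) : E1) => -[u w]; rewrite /= ?fK ?gK ?f'K ?g'K.
Qed.

Lemma ext_morph_center (f : E1 -> E2) w : nondegenerate_form beta2 ->
  {morph f : x y / (x * y)%g} -> bijective f -> (f (0, w)).1 = 0.
Proof.
move=> nondeg fM [g _ gK]; apply: nondeg => u.
have : commute (f (0, w)) (f (g (u, 0))) by rewrite /commute -!fM ext_central.
by rewrite gK => /commgP/eqP; rewrite ext_commgE => /(congr1 snd).
Qed.

Lemma ext_morph_fst (f : E1 -> E2) u w : nondegenerate_form beta2 ->
  {morph f : x y / (x * y)%g} -> bijective f -> (f (u, w)).1 = (f (u, 0)).1.
Proof.
move=> nondeg fM bijf.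
have -> : (u, w) = (((u, 0%R) : E1) * ((0%R, w) : E1))%g.
  by rewrite ext_mulE /= linear0r !addr0 add0r.
by rewrite fM ext_mulE /= (ext_morph_center _ nondeg) // addr0.
Qed.

End ExtensionMorphisms.

Lemma ext_isog_form (R S : nzRingType) (U1 W1 : finLmodType R) (U2 W2 : finLmodType S)
    (beta1 : {bilinear U1 -> U1 -> W1}) (beta2 : {bilinear U2 -> U2 -> W2}) :
  nondegenerate_form beta1 -> nondegenerate_form beta2 ->
  ([set: cocycle_ext beta1] \isog [set: cocycle_ext beta2])%g ->
  exists (f : U1 -> U2) (g : W1 -> W2), [/\ bijective f, {morph f : u v / u + v},
    forall u v, g (commutator_form beta1 u v) = commutator_form beta2 (f u) (f v)
    & forall w, (g w == 0) = (w == 0)].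
Proof.
move=> nondeg1 nondeg2 /isog_setTP[h hM bijh]; have [h' hK h'K] := bijh.
have bijh' : bijective h' by exists h.
have h'M : {morph h' : x y / (x * y)%g} by move=> x y; apply: (can_inj hK); rewrite hM !h'K.
have h1 : h 1%g = 1%g by apply: (mulgI (h 1%g)); rewrite -hM !mulg1.
have hR : {morph h : x y / [~ x, y]%g}.
  have hV x : h x^-1%g = (h x)^-1%g by apply: (mulgI (h x)); rewrite -hM !mulgV.
  by move=> x y; rewrite /commg /conjg !hM !hV.
have h_center w : h (0, w) = (0, (h (0, w)).2).
  by rewrite {1}[h _]surjective_pairing (ext_morph_center _ nondeg2 hM bijh).
exists (fun u => (h (u, 0)).1), (fun w => (h (0, w)).2); split.
- exists (fun u => (h' (u, 0)).1) => u.
    by rewrite -(ext_morph_fst _ (h (u, 0)).2 nondeg1 h'M bijh') -surjective_pairing hK.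
  by rewrite -(ext_morph_fst _ (h' (u, 0)).2 nondeg2 hM bijh) -surjective_pairing h'K.
- move=> u v; rewrite -(ext_morph_fst (u + v) (beta1 u v) nondeg2 hM bijh).
  by rewrite -[RHS]/((h (u, 0) * h (v, 0))%g.1) -hM ext_mulE /= addr0 add0r.
- move=> u v; have := hR (u, 0) (v, 0).
  by rewrite !ext_commgE /= => ->.
move=> w; apply/eqP/eqP=> [hw0|->]; last by rewrite -[(0, 0)]/(1%g : cocycle_ext beta1) h1.
have : h (0, w) = h 1%g by rewrite h_center hw0 h1.
by move/(can_inj hK) => -[].
Qed.

(** * The class two group of an algebra *)

Section NilAlternating.
Variables (F : fieldType) (L : lmodType F) (br : {bilinear L -> L -> L}).
Implicit Types (x y : L) (k : F).

Definition nil_alternating := [/\ forall x, br x x = 0,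
  forall x y, exists n, iter n (br x) y = 0
  & exists2 z, z != 0 & forall y, br z y = 0].

Hypothesis br_nil : nil_alternating.

Lemma nil_alternatingC x y : br y x = - br x y.
Proof.
have [alt _ _] := br_nil; apply/eqP; rewrite -addr_eq0 addrC.
by have := alt (x + y); rewrite linearDl !linearDr !alt add0r addr0 => ->.
Qed.

Lemma nil_alternating_eigen x y k : br x y = k *: y -> k *: y = 0.
Proof.
have [_ nil _] := br_nil => eqxy; have [n] := nil x y.
have -> : iter n (br x) y = k ^+ n *: y.
  by elim: n => [|n IHn]; rewrite ?scale1r //= IHn linearZr_LR /= eqxy scalerA exprSr.
have [-> _|k0 /eqP] := eqVneq k 0; first by rewrite scale0r.
by rewrite scaler_eq0 expf_eq0 (negPf k0) andbF => /eqP->; rewrite scaler0.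
Qed.

Lemma nil_alternating_fix x y k : y = k *: br x y -> y = 0.
Proof.
have [_ nil _] := br_nil => eqy; have [n iter0] := nil x y.
have -> : y = k ^+ n *: iter n (br x) y; last by rewrite iter0 scaler0.
elim: n {iter0} => [|n IHn]; first by rewrite scale1r.
by rewrite [LHS]eqy {1}IHn linearZr_LR /= scalerA -exprS.
Qed.

End NilAlternating.

Section Gadget.
Variables (F : finFieldType) (L : finLmodType F) (br : {bilinear L -> L -> L}).

Definition gadget_base := (L * (F^o * F^o))%type.
Definition gadget_fiber := (L * L)%type.
HB.instance Definition _ := GRing.Lmodule.on gadget_base.
HB.instance Definition _ := Finite.on gadget_base.
HB.instance Definition _ := GRing.Lmodule.on gadget_fiber.
HB.instance Definition _ := Finite.on gadget_fiber.
Implicit Types (u v : gadget_base) (x y z : L).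

Definition gadget_cocycle u v : gadget_fiber :=
  (br u.1 v.1 + u.2.1 *: v.1, u.2.2 *: v.1).

Fact gadget_cocycle_is_bilinear : bilinear_for *:%R *:%R gadget_cocycle.
Proof.
split=> w k u v; congr (_, _); rewrite /= ?linearPl ?linearPr /=.
- rewrite -[(_ *: _ : F^o)]/(k * u.2.1) scalerDl scalerDr scalerA; exact: addrACA.
- by rewrite -[(_ *: _ : F^o)]/(k * u.2.2) scalerDl scalerA.
- by rewrite !scalerDr scalerA mulrC -scalerA; exact: addrACA.
by rewrite scalerDr !scalerA mulrC.
Qed.
HB.instance Definition _ := bilinear_isBilinear.Build F gadget_base gadget_base gadget_fiber
  *:%R *:%R gadget_cocycle gadget_cocycle_is_bilinear.

Definition gadget := cocycle_ext gadget_cocycle.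

HB.instance Definition _ := FinGroup.on gadget.

Lemma card_gadget : #|{: gadget}| = (#|L| ^ 3 * #|F| ^ 2)%N.
Proof. by rewrite !card_prod; ring. Qed.

Lemma gadget_nonabelian : (1 < #|L|)%N -> ~~ abelian [set: gadget].
Proof.
move=> L_gt1; have [x x0] : exists x : L, x != 0.
  apply/existsP; apply: contraTT L_gt1; rewrite negb_exists -leqNgt => /forallP L0.
  by apply/card_le1_eqP => x y _ _; rewrite (eqP (negbNE (L0 x))) (eqP (negbNE (L0 y))).
apply: contra x0 => /abelian_ext/(_ (0, (1, 0)) (x, (0, 0)))/(congr1 fst).
by rewrite /= linear0l linear0r scaler0 scale1r add0r addr0 subr0 => ->.
Qed.

Lemma gadget_in_B p : odd p -> p \in [pchar F] -> (1 < #|L|)%N -> p.-nat #|L| -> p.-nat #|F| ->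
  in_B p 2 (#|L| ^ 3 * #|F| ^ 2) [set: gadget]%G.
Proof.
move=> p_odd pcharF L_gt1 pL pF; have p_pr := pcharf_prime pcharF.
have cardG : #|[set: gadget]| = (#|L| ^ 3 * #|F| ^ 2)%N by rewrite cardsT card_gadget.
have pG : (p.-group [set: gadget])%g by rewrite /pgroup cardG pnatM !pnatX pL pF.
have nabG := gadget_nonabelian L_gt1.
split=> //; last first.
  have : (exponent [set: gadget] %| p)%N.
    by apply/exponentP=> x _; apply: (ext_expg_pchar _ p_odd pcharF).
  have [_ pdiv] := primeP p_pr => /pdiv/orP[|/eqP//].
  rewrite -dvdn1 -trivg_exponent => /eqP G1; have := nabG.
  by rewrite (_ : [set: gadget] = 1%g) ?abelian1 //; exact: G1.
apply/eqP; rewrite eqn_leq; apply/andP; split; last by rewrite ltnNge nil_class1.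
apply/(lcn_nil_classP 2 (pgroup_nil pG)); exact: lcn3_ext.
Qed.

Hypothesis br_nil : nil_alternating br.
Local Notation form := (commutator_form gadget_cocycle).

Lemma gadget_formE x y (s t s' t' : F) : form (x, (s, t)) (y, (s', t')) =
  (br x y *+ 2 + s *: y - s' *: x, t *: y - t' *: x).
Proof.
congr (_, _) => //=; rewrite (nil_alternatingC br_nil x y) opprD opprK mulr2n.
by rewrite -!addrA; congr (_ + _); rewrite addrCA.
Qed.

Definition gadget_kernel : {set gadget_base} := [set v | v.1 == 0].

Lemma card_gadget_kernel : #|gadget_kernel| = (#|F| ^ 2)%N.
Proof.
have -> : gadget_kernel = [set (0, st) | st : F^o * F^o].
  apply/setP=> -[x st]; rewrite inE; apply/eqP/imsetP=> [/= ->|[st' _ [->]]] //.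
  by exists st.
by rewrite card_imset ?card_prod // => st st' [].
Qed.

Lemma commutant_kernel v : v \in gadget_kernel -> v != 0 ->
  commutant gadget_cocycle v = gadget_kernel.
Proof.
case: v => [x [s t]]; rewrite inE => /eqP/= -> nz; apply/setP=> -[y [s' t']].
rewrite !inE gadget_formE linear0l mul0rn add0r !scaler0 !subr0 /=.
rewrite xpair_eqE !scaler_eq0 -orb_andl orbC; case: eqVneq => //= _.
apply: contraNF nz => /andP[/eqP-> /eqP->]; exact: eqxx.
Qed.

Lemma commutant_generic v u : v.1 != 0 -> v.2 != 0 ->
  u \in commutant gadget_cocycle v -> exists k, u = k *: v.
Proof.
case: v u => [x [s t]] [y [s' t']] /= x0 st0; have [alt _ _] := br_nil.
rewrite inE gadget_formE xpair_eqE !subr_eq0 => /andP[/eqP eq1 /eqP eq2].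
have scale_x : injective ( *:%R^~ x).
  by move=> k k' /eqP; rewrite -subr_eq0 -scalerBl scaler_eq0 (negPf x0) orbF subr_eq0 => /eqP.
have [s0|s0] := eqVneq s 0.
  have t0 : t != 0 by apply: contraNneq st0 => ->; rewrite s0.
  have eqy : y = (t' / t) *: x by rewrite mulrC -scalerA -eq2 scalerA mulVf ?scale1r.
  exists (t' / t); rewrite -[RHS]/((t' / t) *: x, (t' / t * s, t' / t * t)) -eqy s0 mulr0 mulfVK //.
  congr (_, (_, _)); apply: scale_x; rewrite /= -eq1 s0 !scale0r addr0 eqy.
  by rewrite linearZr_LR /= alt scaler0 mul0rn.
pose k := s' / s; have ks : s' = k * s by rewrite mulfVK.
have br_shift : br x (y - k *: x) = br x y by rewrite linearBr linearZr_LR /= alt scaler0 subr0.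
have eqy : y = k *: x.
  apply/eqP; rewrite -subr_eq0; apply/eqP.
  apply: (nil_alternating_fix br_nil (x := x) (k := - (s^-1 * 2%:R))).
  rewrite br_shift scaleNr -[(_ * 2%:R) *: _]scalerA scaler_nat -[br x y *+ 2](addrK (s *: y)) eq1.
  by rewrite scalerBr opprB !scalerA mulVf // scale1r mulrC.
exists k; rewrite -[RHS]/(k *: x, (k * s, k * t)) -eqy -ks; congr (_, (_, _)).
by apply: scale_x; rewrite /= -eq2 eqy scalerA mulrC.
Qed.

Lemma card_commutant_generic v : v.1 != 0 -> v.2 != 0 ->
  (#|commutant gadget_cocycle v| <= #|F|)%N.
Proof.
move=> x0 st0; have sub : commutant gadget_cocycle v \subset [set k *: v | k : F].
  by apply/subsetP=> u /(commutant_generic x0 st0)[k ->]; apply: imset_f.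
by apply: leq_trans (subset_leq_card sub) (leq_imset_card _ _).
Qed.

Lemma card_commutant_central z : (forall y, br z y = 0) ->
  (#|L| <= #|commutant gadget_cocycle (z, (0, 0))%R|)%N.
Proof.
move=> zc; have inj0 : injective (fun y : L => (y, (0, 0)) : gadget_base) by move=> y y' [].
rewrite -cardsT -(card_imset _ inj0) subset_leq_card //; apply/subsetP=> _ /imsetP[y _ ->].
by rewrite inE gadget_formE zc mul0rn !scale0r add0r !subr0.
Qed.

Lemma gadget_nondegenerate : nondegenerate_form gadget_cocycle.
Proof.
have [_ _ [z z0 _]] := br_nil => v v0; apply/eqP; apply: contraT => nz.
have Kv : v \in gadget_kernel.
  have /eqP := v0 (0, (1, 0)); case: (v) => [x [s t]]; rewrite gadget_formE xpair_eqE inE /=.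
  by rewrite linear0r mul0rn add0r scaler0 scale1r sub0r oppr_eq0 => /andP[].
have : (z, (0, 0)) \in commutant gadget_cocycle v by rewrite inE v0.
by rewrite commutant_kernel // inE (negPf z0).
Qed.

End Gadget.

Arguments gadget_kernel {F L}.

Section GadgetFormMorphism.
Variables (F : finFieldType) (L1 L2 : finLmodType F).
Variables (br1 : {bilinear L1 -> L1 -> L1}) (br2 : {bilinear L2 -> L2 -> L2}).
Hypotheses (br1_nil : nil_alternating br1) (br2_nil : nil_alternating br2).
Local Notation form1 := (commutator_form (gadget_cocycle br1)).
Local Notation form2 := (commutator_form (gadget_cocycle br2)).
Variable f : gadget_base L1 -> gadget_base L2.
Hypotheses (f_bij : bijective f) (fD : {morph f : u v / u + v}).
Hypothesis f_form0 : forall u v, (form2 (f u) (f v) == 0) = (form1 u v == 0).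

Lemma form_morph0 : f 0 = 0.
Proof. by apply: (addrI (f 0)); rewrite -fD !addr0. Qed.

Lemma commutant_form_morph u :
  commutant (gadget_cocycle br2) (f u) = f @: commutant (gadget_cocycle br1) u.
Proof.
have [g fK gK] := f_bij; apply/setP=> v; rewrite -{1}(gK v) inE f_form0.
apply/idP/imsetP=> [form0|[v' + ->]]; last by rewrite inE fK.
by exists (g v); rewrite ?inE ?gK.
Qed.

(* Otherwise [f v] commutes only with its multiples, or lies in [L2]; in the
   latter case the centralizer of a central element of [L2], which contains
   [L2], has the order of the kernel. *)
Lemma form_morph_kernel v : (#|F| ^ 2 < #|L2|)%N -> v \in gadget_kernel ->
  f v \in gadget_kernel.
Proof.
move=> L2_big Kv; have [->|v0] := eqVneq v 0; first by rewrite form_morph0 inE.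
have f_inj := bij_inj f_bij; have F_gt1 : (1 < #|F|)%N by apply: card_finNzRing_gt1.
have card_commutant u : u \in gadget_kernel -> u != 0 ->
    #|commutant (gadget_cocycle br2) (f u)| = (#|F| ^ 2)%N.
  by move=> Ku u0; rewrite commutant_form_morph card_imset // commutant_kernel ?card_gadget_kernel.
rewrite inE; apply: contraT => fv0; have [fv2|fv2] := eqVneq (f v).2 0; last first.
  have := card_commutant_generic br2_nil fv0 fv2.
  by rewrite card_commutant // -{2}[#|F|]expn1 leq_exp2l.
have [_ _ [z z0 zc]] := br2_nil.
have : (z, (0, 0)) \in commutant (gadget_cocycle br2) (f v).
  rewrite inE [f v]surjective_pairing fv2 gadget_formE // (nil_alternatingC br2_nil) zc.
  by rewrite oppr0 mul0rn !scale0r add0r !subr0.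
rewrite commutant_form_morph commutant_kernel // => /imsetP[u Ku fu].
have u0 : u != 0 by apply: contraNneq z0 => u0; move: fu; rewrite u0 form_morph0 => -[->].
have := card_commutant_central br2_nil zc.
by rewrite fu card_commutant // leqNgt L2_big.
Qed.

End GadgetFormMorphism.

Section TwistedMorphism.
Variables (F : finFieldType) (L1 L2 : finLmodType F).
Variables (br1 : {bilinear L1 -> L1 -> L1}) (br2 : {bilinear L2 -> L2 -> L2}).
Hypotheses (br1_nil : nil_alternating br1) (br2_nil : nil_alternating br2).
Variables (f : L1 -> L2) (a : L1 -> F) (alpha : F).
Hypotheses (f_inj : injective f) (f0 : f 0 = 0).
Hypothesis f_twist : forall x y,
  alpha *: f (br1 x y) *+ 2 = br2 (f x) (f y) *+ 2 + a x *: f y - a y *: f x.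

Lemma twist_central z y : (forall y, br1 z y = 0) ->
  a z *: f y = br2 (f y) (f z) *+ 2 + a y *: f z.
Proof.
move=> zc; apply/eqP; rewrite eq_sym -subr_eq0 -f_twist (nil_alternatingC br1_nil) zc.
by rewrite oppr0 f0 scaler0 mul0rn.
Qed.

Lemma twist_central0 z : (#|F| < #|L1|)%N -> (forall y, br1 z y = 0) -> a z = 0.
Proof.
move=> L1_big zc; apply: contraTeq L1_big => az0; rewrite -leqNgt.
have [alt _ _] := br2_nil.
have brz y : br2 (f z) (f y) = 0.
  apply: (nil_alternating_fix br2_nil (x := f z) (k := - ((a z)^-1 * 2%:R))).
  apply: (scalerI az0); rewrite -linearZr_LR /= (twist_central y zc) linearDr linearMnr /=.
  rewrite linearZr_LR /= alt scaler0 addr0 (nil_alternatingC br2_nil (f z)) linearNr /=.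
  by rewrite scalerA mulrN mulrA mulfV // mul1r scaleNr scaler_nat mulNrn.
have scale_f y : a z *: f y = a y *: f z.
  by rewrite (twist_central y zc) (nil_alternatingC br2_nil) brz oppr0 mul0rn add0r.
apply: (leq_card a) => y y' eqa; apply/f_inj/(scalerI az0).
by rewrite !scale_f eqa.
Qed.

Lemma twist_trivial x : (#|F| < #|L1|)%N -> a x = 0.
Proof.
move=> L1_big; have [_ _ [z z0 zc]] := br1_nil.
have fz0 : f z != 0 by rewrite -f0 (inj_eq f_inj).
have /esym/eqP := twist_central x zc; rewrite (twist_central0 L1_big zc) scale0r.
rewrite addr_eq0 -scaler_nat -linearZl_LR -scaleNr /= => /eqP/(nil_alternating_eigen br2_nil)/eqP.
by rewrite scaler_eq0 (negPf fz0) orbF oppr_eq0 => /eqP.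
Qed.

End TwistedMorphism.

Section GadgetIsomorphism.
Variables (F : finFieldType) (L1 L2 : finLmodType F).
Variables (br1 : {bilinear L1 -> L1 -> L1}) (br2 : {bilinear L2 -> L2 -> L2}).
Hypotheses (br1_nil : nil_alternating br1) (br2_nil : nil_alternating br2).
Hypotheses (two_neq0 : 2%:R != 0 :> F) (card_L : #|L1| = #|L2|).
Hypothesis L2_big : (#|F| ^ 2 < #|L2|)%N.
Local Notation form1 := (commutator_form (gadget_cocycle br1)).
Local Notation form2 := (commutator_form (gadget_cocycle br2)).

Variables (f : gadget_base L1 -> gadget_base L2) (g : gadget_fiber L1 -> gadget_fiber L2).
Hypotheses (f_bij : bijective f) (fD : {morph f : u v / u + v}).
Hypothesis g_form : forall u v, g (form1 u v) = form2 (f u) (f v).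
Hypothesis g_eq0 : forall w, (g w == 0) = (w == 0).

Let base x : gadget_base L1 := (x, (0, 0)).
Let fL x := (f (base x)).1.
Let a x := (f (base x)).2.1.

Let form_eq0 u v : (form2 (f u) (f v) == 0) = (form1 u v == 0).
Proof. by rewrite -g_form g_eq0. Qed.

Lemma gadget_fL_additive : {morph fL : x y / x + y}.
Proof.
move=> x y; rewrite /fL (_ : base (x + y) = base x + base y) ?fD //.
by congr (_, (_, _)); rewrite addr0.
Qed.

Let fL0 : fL 0 = 0.
Proof. by apply: (addrI (fL 0)); rewrite -gadget_fL_additive !addr0. Qed.

Lemma gadget_fL_bijective : bijective fL.
Proof.
have [f' fK f'K] := f_bij; have f'_bij : bijective f' by exists f.
have f'D : {morph f' : u v / u + v} by move=> u v; apply: (can_inj fK); rewrite fD !f'K.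
have f'_form0 u v : (form1 (f' u) (f' v) == 0) = (form2 u v == 0) by rewrite -form_eq0 !f'K.
have L1_big : (#|F| ^ 2 < #|L1|)%N by rewrite card_L.
apply: inj_card_bij; last by rewrite card_L.
have fL_ker x : fL x = 0 -> x = 0.
  move=> fLx0; have Kfx : f (base x) \in gadget_kernel by rewrite inE -/(fL x) fLx0.
  have := form_morph_kernel br2_nil br1_nil f'_bij f'D f'_form0 L1_big Kfx.
  by rewrite fK inE => /eqP.
move=> x y eqf; apply/eqP; rewrite -subr_eq0; apply/eqP/fL_ker.
by apply: (addIr (fL y)); rewrite -gadget_fL_additive subrK add0r.
Qed.

Lemma gadget_twist : exists alpha, forall x y,
  alpha *: fL (br1 x y) *+ 2 = br2 (fL x) (fL y) *+ 2 + a x *: fL y - a y *: fL x.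
Proof.
pose e : gadget_base L1 := (0, (1, 0)); pose alpha : F := (f e).2.1.
have f_base x : f (base x) = (fL x, (a x, (f (base x)).2.2)).
  by rewrite [f _]surjective_pairing [(f _).2]surjective_pairing.
have f_e : f e = (0, (alpha, (f e).2.2)).
  have : f e \in gadget_kernel.
    by apply: (form_morph_kernel br1_nil br2_nil f_bij fD form_eq0 L2_big); rewrite inE.
  rewrite inE => /eqP fe1.
  by rewrite [f _]surjective_pairing [(f _).2]surjective_pairing fe1.
have g_fst x : (g (x, 0)).1 = alpha *: fL x.
  have -> : (x, 0) = form1 e (base x).
    by rewrite gadget_formE // linear0l mul0rn add0r scale1r !scale0r !subr0.
  by rewrite g_form f_e f_base gadget_formE //= linear0l mul0rn add0r scaler0 subr0.
exists alpha => x y; have -> : alpha *: fL (br1 x y) *+ 2 = alpha *: fL (br1 x y *+ 2).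
  by rewrite !mulr2n gadget_fL_additive scalerDr.
rewrite -g_fst; have -> : (br1 x y *+ 2, 0) = form1 (base x) (base y).
  by rewrite gadget_formE // !scale0r !subr0 addr0.
by rewrite g_form (f_base x) (f_base y) gadget_formE.
Qed.

Lemma gadget_form_algebra_iso : (exists x y, br2 x y != 0) ->
  exists h : L1 -> L2, [/\ bijective h, {morph h : x y / x + y}
    & {morph h : x y / br1 x y >-> br2 x y}].
Proof.
move=> [x0 [y0 br0]]; have [alpha twist] := gadget_twist.
have fL_bij := gadget_fL_bijective; have fL_inj := bij_inj fL_bij.
have L1_gtF : (#|F| < #|L1|)%N.
  by rewrite card_L (leq_trans _ L2_big) // ltnS -{1}[#|F|]expn1 leq_pexp2l // (cardD1 0).
have a0 x : a x = 0 := twist_trivial br1_nil br2_nil fL_inj fL0 twist x L1_gtF.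
have scale_br x y : alpha *: fL (br1 x y) = br2 (fL x) (fL y).
  apply: (scalerI two_neq0); rewrite !scaler_nat twist !a0.
  by rewrite !scale0r subr0 addr0.
have alpha0 : alpha != 0.
  apply: contraNneq br0 => al0; have [h' _ h'K] := fL_bij.
  by rewrite -(h'K x0) -(h'K y0) -scale_br al0 scale0r.
exists (fun x => alpha^-1 *: fL x); split=> [|x y|x y].
- apply: (bij_comp (f := fun u => alpha^-1 *: u) _ fL_bij).
  by exists (fun u => alpha *: u) => u; rewrite scalerA ?mulfV ?mulVf ?scale1r.
- by rewrite gadget_fL_additive scalerDr.
by rewrite linearZl_LR linearZr_LR /= -scale_br !scalerA mulfVK.
Qed.

End GadgetIsomorphism.

Lemma gadget_isog_algebra (F : finFieldType) (L1 L2 : finLmodType F)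
    (br1 : {bilinear L1 -> L1 -> L1}) (br2 : {bilinear L2 -> L2 -> L2}) :
  nil_alternating br1 -> nil_alternating br2 -> 2%:R != 0 :> F ->
  #|L1| = #|L2| -> (#|F| ^ 2 < #|L2|)%N -> (exists x y, br2 x y != 0) ->
  ([set: gadget br1] \isog [set: gadget br2])%g ->
  exists h : L1 -> L2, [/\ bijective h, {morph h : x y / x + y}
    & {morph h : x y / br1 x y >-> br2 x y}].
Proof.
move=> nil1 nil2 two0 card_L L2_big br2_neq0 iso.
have nondeg1 := gadget_nondegenerate nil1; have nondeg2 := gadget_nondegenerate nil2.
have [f [g [f_bij fD g_form g_eq0]]] := ext_isog_form nondeg1 nondeg2 iso.
exact: (gadget_form_algebra_iso nil1 nil2 two0 card_L L2_big f_bij fD g_form g_eq0).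
Qed.

Lemma algebra_gadget_isog (F : finFieldType) (L1 L2 : finLmodType F)
    (br1 : {bilinear L1 -> L1 -> L1}) (br2 : {bilinear L2 -> L2 -> L2}) (h : L1 -> L2) :
  bijective h -> linear h -> {morph h : x y / br1 x y >-> br2 x y} ->
  ([set: gadget br1] \isog [set: gadget br2])%g.
Proof.
move=> [h' hK h'K] h_lin h_br.
have hD : {morph h : x y / x + y} by move=> x y; rewrite -[x]scale1r h_lin !scale1r.
have h0 : h 0 = 0 by apply: (addrI (h 0)); rewrite -hD !addr0.
have hZ k x : h (k *: x) = k *: h x by rewrite -[k *: x]addr0 h_lin h0 addr0.
apply: (@cocycle_morph_isog _ _ _ _ _ _ (gadget_cocycle br1) (gadget_cocycle br2)
  (fun u => (h u.1, u.2)) (fun w => (h w.1, h w.2))).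
- by move=> [x st] [x' st']; congr (_, _); apply: hD.
- by move=> [x y] [x' y']; congr (_, _); apply: hD.
- by exists (fun u => (h' u.1, u.2)) => -[x st]; rewrite /= ?hK ?h'K.
- by exists (fun w => (h' w.1, h' w.2)) => -[x y]; rewrite /= ?hK ?h'K.
by move=> [x [s t]] [x' [s' t']]; rewrite /gadget_cocycle /= hD h_br !hZ.
Qed.

Local Close Scope ring_scope.

(** * Compiling expressions and bounded loops *)

Definition runs_within (P : prog) (s : state) (t : nat) (s' : state) :=
  exists2 t', t' <= t & exec P s t' s'.

Lemma exec_runs P s t s' : exec P s t s' -> runs_within P s t s'.
Proof. by exists t. Qed.

Lemma runs_within_le P s t t' s' : t <= t' -> runs_within P s t s' -> runs_within P s t' s'.
Proof. by move=> le_t [u le_u exec_u]; exists u => //; apply: leq_trans le_t. Qed.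

Lemma runs_seq P Q s1 s2 s3 t1 t2 :
  runs_within P s1 t1 s2 -> runs_within Q s2 t2 s3 -> runs_within (Seq P Q) s1 (t1 + t2) s3.
Proof.
move=> [u1 le1 exec1] [u2 le2 exec2].
by exists (u1 + u2); [apply: leq_add | apply: ExecSeq exec1 exec2].
Qed.

Lemma runs_while d P n (I : nat -> state -> Prop) (T : nat -> nat) s :
  (forall k s, k <= n -> I k s -> reg s d = n - k) ->
  (forall k s, k < n -> I k s -> exists2 s', runs_within P s (T k) s' & I k.+1 s') ->
  I 0 s -> exists2 s', runs_within (While d P) s (\sum_(k < n) (T k).+1 + 1) s' & I n s'.
Proof.
move=> counter body; rewrite -(big_mkord xpredT (fun k => (T k).+1)).
suff loop m k s0 : n - k = m -> k <= n -> I k s0 ->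
    exists2 s', runs_within (While d P) s0 (\sum_(k <= i < n) (T i).+1 + 1) s' & I n s'.
  exact: loop.
elim: m k s0 => [|m IHm] k s0 eq_m le_kn Ik; have d_val := counter k s0 le_kn Ik.
  have eq_kn : k = n by lia.
  exists s0; last by rewrite -eq_kn.
  by rewrite eq_kn big_geq //; apply: exec_runs; apply: ExecWhileF; rewrite d_val.
have lt_kn : k < n by lia.
have [s' [t le_t exec_body] Is'] := body k s0 lt_kn Ik.
have [|s'' [u le_u exec_loop] Is''] := IHm k.+1 s' _ lt_kn Is'; first by lia.
exists s'' => //; exists (t + u).+1; last first.
  by apply: ExecWhileT exec_body exec_loop; rewrite d_val eq_m.
by rewrite big_ltn // !addSn ltnS -addnA leq_add.
Qed.

Definition agree_below (K : nat) (s s' : state) :=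
  Defs.mem s = Defs.mem s' /\ forall r, r < K -> reg s r = reg s' r.

Lemma agree_below_refl K s : agree_below K s s.
Proof. by []. Qed.

Lemma agree_below_trans K s1 s2 s3 :
  agree_below K s1 s2 -> agree_below K s2 s3 -> agree_below K s1 s3.
Proof. by move=> [m12 r12] [m23 r23]; split=> [|r lt_r]; rewrite ?m12 // r12 ?r23. Qed.

Lemma agree_below_le K K' s s' : K <= K' -> agree_below K' s s' -> agree_below K s s'.
Proof. by move=> leK [eq_m eq_r]; split=> // r lt_r; apply/eq_r/(leq_trans lt_r). Qed.

Lemma agree_below_set_reg K s x v : K <= x -> agree_below K (set_reg s x v) s.
Proof. by move=> leK; split=> // r lt_r; rewrite /= /upd ltn_eqF // (leq_trans lt_r). Qed.

Lemma reg_set_reg s x v r : reg (set_reg s x v) r = if r == x then v else reg s r.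
Proof. by []. Qed.

Inductive expr :=
  | EReg of nat | EConst of nat | EAdd of expr & expr | ESub of expr & expr
  | EMul of expr & expr | EMem of expr.

Fixpoint eval (e : expr) (s : state) : nat :=
  match e with
  | EReg x => reg s x
  | EConst k => k
  | EAdd e1 e2 => eval e1 s + eval e2 s
  | ESub e1 e2 => eval e1 s - eval e2 s
  | EMul e1 e2 => eval e1 s * eval e2 s
  | EMem e1 => Defs.mem s (eval e1 s)
  end.

(* A product is computed by repeated addition, as many times as its left factor. *)
Fixpoint ecost (e : expr) (s : state) : nat :=
  match e with
  | EReg _ | EConst _ => 1
  | EAdd e1 e2 | ESub e1 e2 => ecost e1 s + ecost e2 s + 1
  | EMul e1 e2 => ecost e1 s + ecost e2 s + (3 * eval e1 s + 4)
  | EMem e1 => ecost e1 s + 1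
  end.

Fixpoint expr_below (K : nat) (e : expr) : bool :=
  match e with
  | EReg x => x < K
  | EConst _ => true
  | EAdd e1 e2 | ESub e1 e2 | EMul e1 e2 => expr_below K e1 && expr_below K e2
  | EMem e1 => expr_below K e1
  end.

Definition multiply (d : nat) : prog :=
  Seq (Const d.+2 0) (Seq (Const d.+3 1)
    (Seq (While d (Seq (Add d.+2 d.+2 d.+1) (Defs.Sub d d d.+3))) (Copy d d.+2))).

(* The value is left in register [d]; the registers above [d] are scratch. *)
Fixpoint compile_expr (d : nat) (e : expr) : prog :=
  match e with
  | EReg x => Copy d x
  | EConst k => Const d k
  | EAdd e1 e2 => Seq (compile_expr d e1) (Seq (compile_expr d.+1 e2) (Add d d d.+1))
  | ESub e1 e2 => Seq (compile_expr d e1) (Seq (compile_expr d.+1 e2) (Defs.Sub d d d.+1))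
  | EMul e1 e2 => Seq (compile_expr d e1) (Seq (compile_expr d.+1 e2) (multiply d))
  | EMem e1 => Seq (compile_expr d e1) (Fetch d d)
  end.

Lemma expr_below_le K K' e : K <= K' -> expr_below K e -> expr_below K' e.
Proof.
move=> leK; elim: e => //= [x|e1 IH1 e2 IH2|e1 IH1 e2 IH2|e1 IH1 e2 IH2];
  by [move/leq_trans; apply | case/andP=> /IH1-> /IH2->].
Qed.

Lemma eval_agree K e s s' : expr_below K e -> agree_below K s s' -> eval e s = eval e s'.
Proof.
move=> + [eq_m eq_r]; elim: e => /= [x|//|e1 IH1 e2 IH2|e1 IH1 e2 IH2|e1 IH1 e2 IH2|e1 IH1].
- exact: eq_r.
- by case/andP=> /IH1-> /IH2->.
- by case/andP=> /IH1-> /IH2->.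
- by case/andP=> /IH1-> /IH2->.
by move/IH1->; rewrite eq_m.
Qed.

Lemma ecost_agree K e s s' : expr_below K e -> agree_below K s s' -> ecost e s = ecost e s'.
Proof.
move=> + agree; elim: e => //= [e1 IH1 e2 IH2|e1 IH1 e2 IH2|e1 IH1 e2 IH2|e1 IH1].
- by case/andP=> /IH1-> /IH2->.
- by case/andP=> /IH1-> /IH2->.
- by case/andP=> below1 below2; rewrite IH1 // IH2 // (eval_agree below1 agree).
by move/IH1->.
Qed.

Definition computes (d : nat) (P : prog) (s : state) (t v : nat) :=
  exists s', [/\ runs_within P s t s', reg s' d = v & agree_below d s' s].

Lemma computes_set_reg d P s v : exec P s 1 (set_reg s d v) -> computes d P s 1 v.
Proof.
move=> execP; exists (set_reg s d v); split; first exact: exec_runs.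
  by rewrite reg_set_reg eqxx.
exact: agree_below_set_reg.
Qed.

Lemma computes_multiply d s :
  computes d (multiply d) s (3 * reg s d + 4) (reg s d * reg s d.+1).
Proof.
set n := reg s d; pose s1 := set_reg (set_reg s d.+2 0) d.+3 1.
pose I k s' := [/\ reg s' d = n - k, reg s' d.+2 = k * reg s d.+1,
  reg s' d.+3 = 1, reg s' d.+1 = reg s d.+1 & agree_below d s' s].
have [||| s2 run2 [_ prod2 _ _ agree2]] := @runs_while d
    (Seq (Add d.+2 d.+2 d.+1) (Defs.Sub d d d.+3)) n I (fun=> 2) s1.
- by move=> k s' _ [].
- move=> k s' lt_kn [ed ed2 ed3 ed1 agree].
  pose s2 := set_reg s' d.+2 (reg s' d.+2 + reg s' d.+1).
  exists (set_reg s2 d (reg s2 d - reg s2 d.+3)).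
    by apply: exec_runs; apply: (ExecSeq (t1 := 1) (t2 := 1) (s2 := s2)); constructor.
  split; rewrite /s2 ?reg_set_reg ?eqxx; repeat (case: eqP => ?); try lia.
  apply: agree_below_trans (agree_below_set_reg _ _ (leqnn d)) _.
  by apply: agree_below_trans agree; apply: agree_below_set_reg; lia.
- split; rewrite /s1 ?reg_set_reg ?eqxx; repeat (case: eqP => ?); try lia.
  by apply: (agree_below_trans (s2 := set_reg s d.+2 0)); apply: agree_below_set_reg; lia.
exists (set_reg s2 d (reg s2 d.+2)); split.
- apply: (runs_within_le (t := 1 + (1 + (\sum_(k < n) 3 + 1 + 1)))).
    by rewrite sum_nat_const card_ord; lia.
  apply: runs_seq (exec_runs (ExecConst _ _ _)) _.
  apply: runs_seq (exec_runs (ExecConst _ _ _)) _.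
  by apply: runs_seq run2 (exec_runs (ExecCopy _ _ _)).
- by rewrite reg_set_reg eqxx.
exact: agree_below_trans (agree_below_set_reg _ _ (leqnn d)) agree2.
Qed.

Lemma computes_binary (op : nat -> nat -> nat) (T : nat -> nat) d P P1 P2 s t1 t2 v1 v2 :
  (forall s, computes d P s (T (reg s d)) (op (reg s d) (reg s d.+1))) ->
  computes d P1 s t1 v1 -> (forall s', agree_below d s' s -> computes d.+1 P2 s' t2 v2) ->
  computes d (Seq P1 (Seq P2 P)) s (t1 + t2 + T v1) (op v1 v2).
Proof.
move=> comp_op [s1 [run1 eq1 agree1]] comp2.
have [s2 [run2 eq2 [eq_m eq_r]]] := comp2 s1 agree1.
have [s3 [run3 eq3 agree3]] := comp_op s2.
rewrite eq2 eq_r // eq1 in run3 eq3; exists s3; split=> //.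
  by rewrite -addnA; apply: runs_seq run1 (runs_seq run2 run3).
apply: agree_below_trans agree3 (agree_below_trans _ agree1).
by split=> // r lt_r; apply/eq_r/ltnW.
Qed.

Lemma compile_expr_correct d e s :
  expr_below d e -> computes d (compile_expr d e) s (ecost e s) (eval e s).
Proof.
have binary (op : nat -> nat -> nat) T P e1 e2 d' s' :
    (forall s, computes d' (P d') s (T (reg s d')) (op (reg s d') (reg s d'.+1))) ->
    (forall d s, expr_below d e1 -> computes d (compile_expr d e1) s (ecost e1 s) (eval e1 s)) ->
    (forall d s, expr_below d e2 -> computes d (compile_expr d e2) s (ecost e2 s) (eval e2 s)) ->
    expr_below d' e1 && expr_below d' e2 ->
    computes d' (Seq (compile_expr d' e1) (Seq (compile_expr d'.+1 e2) (P d'))) s'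
      (ecost e1 s' + ecost e2 s' + T (eval e1 s')) (op (eval e1 s') (eval e2 s')).
  move=> comp_op IH1 IH2 /andP[below1 below2]; apply: computes_binary => //; first exact: IH1.
  move=> s'' agree; rewrite -(ecost_agree below2 agree) -(eval_agree below2 agree).
  exact/IH2/(expr_below_le (leqnSn d')).
elim: e d s => [x|k|e1 IH1 e2 IH2|e1 IH1 e2 IH2|e1 IH1 e2 IH2|e1 IH1] d s /=.
- by move=> _; apply: computes_set_reg; constructor.
- by move=> _; apply: computes_set_reg; constructor.
- apply: (binary addn (fun=> 1) (fun d => Add d d d.+1)) => // s'.
  by apply: computes_set_reg; constructor.
- apply: (binary subn (fun=> 1) (fun d => Defs.Sub d d d.+1)) => // s'.
  by apply: computes_set_reg; constructor.
- exact: (binary muln (fun n => 3 * n + 4) multiply _ _ _ _ (computes_multiply d)).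
move=> below1; have [s1 [run1 eq1 agree1]] := IH1 d s below1.
exists (set_reg s1 d (Defs.mem s1 (reg s1 d))); split.
- by apply: runs_seq run1 (exec_runs _); constructor.
- by rewrite reg_set_reg eqxx eq1 (proj1 agree1).
exact: agree_below_trans (agree_below_set_reg _ _ (leqnn d)) agree1.
Qed.

Inductive cmd :=
  | Asg of nat & expr | Put of expr & expr | CSeq of cmd & cmd | For of nat & expr & cmd.

Fixpoint run (c : cmd) (s : state) : state :=
  match c with
  | Asg x e => set_reg s x (eval e s)
  | Put a e => set_mem s (eval a s) (eval e s)
  | CSeq c1 c2 => run c2 (run c1 s)
  | For x e c1 => iteri (eval e s) (fun k s' => run c1 (set_reg s' x k)) s
  end.

Fixpoint cost (c : cmd) (s : state) : nat :=
  match c with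
  | Asg x e => ecost e s + 1
  | Put a e => ecost a s + ecost e s + 1
  | CSeq c1 c2 => cost c1 s + cost c2 (run c1 s)
  | For x e c1 => ecost e s + 3 + \sum_(k < eval e s)
      (cost c1 (set_reg (iteri k (fun j s' => run c1 (set_reg s' x j)) s) x k) + 4)
  end.

Fixpoint cmd_below (K : nat) (c : cmd) : bool :=
  match c with
  | Asg x e => (x < K) && expr_below K e
  | Put a e => expr_below K a && expr_below K e
  | CSeq c1 c2 => cmd_below K c1 && cmd_below K c2
  | For x e c1 => [&& x < K, expr_below K e & cmd_below K c1]
  end.

Fixpoint compile_cmd (d : nat) (c : cmd) : prog :=
  match c with
  | Asg x e => Seq (compile_expr d e) (Copy x d)
  | Put a e => Seq (compile_expr d a) (Seq (compile_expr d.+1 e) (Store d d.+1))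
  | CSeq c1 c2 => Seq (compile_cmd d c1) (compile_cmd d c2)
  | For x e c1 => Seq (compile_expr d e) (Seq (Const d.+1 0) (Seq (Const d.+2 1)
      (While d (Seq (Copy x d.+1) (Seq (compile_cmd d.+3 c1)
        (Seq (Add d.+1 d.+1 d.+2) (Defs.Sub d d d.+2)))))))
  end.

(* The registers from [K] on are not visible to the source program; those
   below [d] may hold the counters of the enclosing loops. *)
Definition simulates (K d : nat) (P : prog) (s : state) (t : nat) (s' : state) :=
  forall u, agree_below K u s -> exists u', [/\ runs_within P u t u', agree_below K u' s'
    & forall r, K <= r < d -> reg u' r = reg u r].

Section CompileCmd.
Variable K : nat.

Lemma simulates_expr d e s u : K <= d -> expr_below K e -> agree_below K u s ->
  computes d (compile_expr d e) u (ecost e s) (eval e s).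
Proof.
move=> leK belowe agree; rewrite -(ecost_agree belowe agree) -(eval_agree belowe agree).
exact/compile_expr_correct/(expr_below_le leK).
Qed.

Lemma simulates_asg d x e s : K <= d -> x < K -> expr_below K e ->
  simulates K d (compile_cmd d (Asg x e)) s (cost (Asg x e) s) (run (Asg x e) s).
Proof.
move=> leK lt_x belowe u agree /=.
have [u1 [run1 eq1 agree1]] := simulates_expr leK belowe agree.
exists (set_reg u1 x (reg u1 d)); split=> [||r /andP[leKr lt_r]].
- by apply: runs_seq run1 (exec_runs _); constructor.
- have [eq_m eq_r] := agree_below_trans (agree_below_le leK agree1) agree; split=> // r lt_r.
  by rewrite !reg_set_reg eq1; case: eqP => // _; apply: eq_r.
by rewrite reg_set_reg gtn_eqF ?(leq_trans lt_x) // (proj2 agree1).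
Qed.

Lemma simulates_put d a e s : K <= d -> expr_below K a -> expr_below K e ->
  simulates K d (compile_cmd d (Put a e)) s (cost (Put a e) s) (run (Put a e) s).
Proof.
move=> leK belowa belowe u agree /=.
have [u1 [run1 eq1 agree1]] := simulates_expr leK belowa agree.
have agree1s := agree_below_trans (agree_below_le leK agree1) agree.
have [u2 [run2 eq2 agree2]] := simulates_expr (leqW leK) belowe agree1s.
exists (set_mem u2 (reg u2 d) (reg u2 d.+1)); split=> [||r /andP[leKr lt_r]].
- by rewrite -addnA; apply: runs_seq run1 (runs_seq run2 (exec_runs _)); constructor.
- have [eq_m eq_r] := agree_below_trans (agree_below_le (leqW leK) agree2) agree1s.
  by split=> //=; rewrite eq2 (proj2 agree2) // eq1 eq_m.
by rewrite /= (proj2 agree2) ?(proj2 agree1) // ltnW.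
Qed.

Lemma simulates_seq d P1 P2 s1 s2 s3 t1 t2 :
  simulates K d P1 s1 t1 s2 -> simulates K d P2 s2 t2 s3 ->
  simulates K d (Seq P1 P2) s1 (t1 + t2) s3.
Proof.
move=> sim1 sim2 u /sim1[u1 [run1 /sim2[u2 [run2 agree2 eq2]] eq1]].
by exists u2; split=> // [|r lt_r]; [apply: runs_seq run1 run2 | rewrite eq2 ?eq1].
Qed.

Lemma simulates_for d x e c s : K <= d -> x < K -> expr_below K e ->
  (forall s, simulates K d.+3 (compile_cmd d.+3 c) s (cost c s) (run c s)) ->
  simulates K d (compile_cmd d (For x e c)) s (cost (For x e c) s) (run (For x e c) s).
Proof.
move=> leK lt_x belowe sim_c u agree /=; set n := eval e s.
pose iterate k := iteri k (fun j s' => run c (set_reg s' x j)) s.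
have [u1 [run1 eq1 agree1]] := simulates_expr leK belowe agree.
pose u2 := set_reg (set_reg u1 d.+1 0) d.+2 1.
pose I k u' := [/\ reg u' d = n - k, reg u' d.+1 = k, reg u' d.+2 = 1,
  agree_below K u' (iterate k) & forall r, K <= r < d -> reg u' r = reg u r].
have [||| u3 run3 [_ _ _ agree3 eq3]] := @runs_while d (Seq (Copy x d.+1)
    (Seq (compile_cmd d.+3 c) (Seq (Add d.+1 d.+1 d.+2) (Defs.Sub d d d.+2)))) n I
    (fun k => cost c (set_reg (iterate k) x k) + 3) u2.
- by move=> k u' _ [].
- move=> k u' lt_kn [ed ed1 ed2 agree' eq']; pose v1 := set_reg u' x k.
  have agree_v1 : agree_below K v1 (set_reg (iterate k) x k).
    have [eq_m eq_r] := agree'; split=> [|r lt_r]; rewrite ?eq_m //= /upd.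
    by case: eqP => // _; apply: eq_r.
  have [v2 [run_v2 agree_v2 eq_v2]] := sim_c _ v1 agree_v1.
  have v2_reg r : K <= r < d.+3 -> reg v2 r = reg u' r.
    by move=> lt_r; rewrite eq_v2 // reg_set_reg gtn_eqF //; case/andP: lt_r => /(leq_trans lt_x).
  pose v3 := set_reg v2 d.+1 (reg v2 d.+1 + reg v2 d.+2).
  exists (set_reg v3 d (reg v3 d - reg v3 d.+2)).
    rewrite (_ : cost c _ + 3 = 1 + (cost c (set_reg (iterate k) x k) + (1 + 1))); last by lia.
    apply: (runs_seq (s2 := v1)); first by apply: exec_runs; rewrite /v1 -ed1; constructor.
    apply: runs_seq run_v2 (runs_seq (exec_runs (ExecAdd _ _ _ _)) _).
    exact: exec_runs (ExecSub _ _ _ _).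
  have := (v2_reg d, v2_reg d.+1, v2_reg d.+2); rewrite ed ed1 ed2 => -[[eqd eqd1] eqd2].
  rewrite /v3; split=> [||||r lt_r]; rewrite ?reg_set_reg; repeat (case: eqP => ?); try lia.
    apply: agree_below_trans agree_v2; apply: agree_below_trans (agree_below_set_reg _ _ leK) _.
    by apply: agree_below_set_reg; lia.
  by rewrite v2_reg ?eq' //; lia.
- split=> [||||r lt_r]; rewrite /u2 ?reg_set_reg; repeat (case: eqP => ?); try lia.
    apply: agree_below_trans agree; apply: agree_below_trans (agree_below_le leK agree1).
    by apply: agree_below_trans (agree_below_set_reg _ _ _) (agree_below_set_reg _ _ _); lia.
  by rewrite (proj2 agree1) //; lia.
exists u3; split=> //; apply: runs_within_le (runs_seq run1 (runs_seq (exec_runs (ExecConst _ _ _))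
  (runs_seq (exec_runs (ExecConst _ _ _)) run3))).
have -> : \sum_(k < n) (cost c (set_reg (iterate k) x k) + 3).+1
  = \sum_(k < n) (cost c (set_reg (iterate k) x k) + 4).
  by apply: eq_bigr => k _; rewrite -addnS.
by rewrite -[leqRHS]addnA [X in 1 + (1 + X)]addnC.
Qed.

Lemma compile_cmd_correct d c s : K <= d -> cmd_below K c ->
  simulates K d (compile_cmd d c) s (cost c s) (run c s).
Proof.
elim: c d s => [x e|a e|c1 IH1 c2 IH2|x e c IHc] d s leK.
- by case/andP; apply: simulates_asg.
- by case/andP; apply: simulates_put.
- by case/andP=> below1 below2; apply: simulates_seq; [apply: IH1 | apply: IH2].
case/and3P=> lt_x belowe belowc; apply: simulates_for => // s'; apply: IHc => //.
by rewrite ltnW // ltnW // ltnW.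
Qed.

End CompileCmd.

Definition hoare (P : state -> Prop) (c : cmd) (T : nat) (Q : state -> Prop) :=
  forall s, P s -> cost c s <= T /\ Q (run c s).

Lemma hoare_seq P Q R c1 c2 T1 T2 :
  hoare P c1 T1 Q -> hoare Q c2 T2 R -> hoare P (CSeq c1 c2) (T1 + T2) R.
Proof.
move=> h1 h2 s /h1[le1 /h2[le2 post]].
by split=> //; apply: leq_add.
Qed.

Lemma hoare_for (I : nat -> state -> Prop) x e c n T0 T :
  (forall s, I 0 s -> eval e s = n /\ ecost e s <= T0) ->
  (forall k s, k < n -> I k s ->
     cost c (set_reg s x k) <= T /\ I k.+1 (run c (set_reg s x k))) ->
  hoare (I 0) (For x e c) (T0 + 3 + n * (T + 4)) (I n).
Proof.
move=> bound body s I0 /=; have [-> le0] := bound s I0; rewrite -/run.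
have inv k : k <= n -> I k (iteri k (fun j s' => run c (set_reg s' x j)) s).
  by elim: k => // k IHk lt_kn; apply: (body k _ lt_kn (IHk (ltnW lt_kn))).2.
split; last exact: inv.
rewrite leq_add ?leq_add2r // -[n in n * _]card_ord -sum_nat_const; apply: leq_sum => k _.
by rewrite leq_add2r; apply: (body k _ (ltn_ord k) (inv k (ltnW (ltn_ord k)))).1.
Qed.

Fixpoint assigned (c : cmd) : seq nat :=
  match c with
  | Asg x _ => [:: x]
  | Put _ _ => [::]
  | CSeq c1 c2 => assigned c1 ++ assigned c2
  | For x _ c1 => x :: assigned c1
  end.

Lemma reg_run c s r : r \notin assigned c -> reg (run c s) r = reg s r.
Proof.
elim: c s => [x e|a e|c1 IH1 c2 IH2|x e c IHc] s //=.
- by rewrite mem_seq1 /upd => /negPf->.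
- by rewrite mem_cat negb_or => /andP[r1 r2]; rewrite IH2 ?IH1.
rewrite inE negb_or => /andP[/negPf r_x r_c].
by elim: (eval e s) => //= n IHn; rewrite IHc // reg_set_reg r_x.
Qed.

Fixpoint esize (e : expr) : nat :=
  match e with
  | EReg _ | EConst _ => 1
  | EAdd e1 e2 | ESub e1 e2 | EMul e1 e2 => (esize e1 + esize e2).+1
  | EMem e1 => (esize e1).+1
  end.

Fixpoint factors_le (V : nat) (e : expr) (s : state) : bool :=
  match e with
  | EReg _ | EConst _ => true
  | EAdd e1 e2 | ESub e1 e2 => factors_le V e1 s && factors_le V e2 s
  | EMul e1 e2 => [&& eval e1 s <= V, factors_le V e1 s & factors_le V e2 s]
  | EMem e1 => factors_le V e1 s
  end.

Lemma ecost_le V e s : factors_le V e s -> ecost e s <= esize e * (3 * V + 4).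
Proof.
elim: e => /= [x|k|e1 IH1 e2 IH2|e1 IH1 e2 IH2|e1 IH1 e2 IH2|e1 IH1].
- by move=> _; lia.
- by move=> _; lia.
- by case/andP=> /IH1 + /IH2; lia.
- by case/andP=> /IH1 + /IH2; lia.
- by case/and3P=> le_V /IH1 + /IH2; lia.
by move/IH1; lia.
Qed.

(** * Enumerating a table *)

Lemma nth_allpairs (S T R : Type) (f : S -> T -> R) (s : seq S) (t : seq T) x0 y0 z0 i j :
  i < size s -> j < size t ->
  nth z0 [seq f x y | x <- s, y <- t] (i * size t + j) = f (nth x0 s i) (nth y0 t j).
Proof.
elim: s i => [|x s IHs] [|i] //= lt_i lt_j; rewrite nth_cat size_map.
  by rewrite mul0n add0n lt_j (nth_map y0).
by rewrite mulSn -addnA ltnNge leq_addr /= addKn IHs.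
Qed.

Lemma index_map_in (T1 T2 : eqType) (f : T1 -> T2) (s : seq T1) x :
  {in s &, injective f} -> x \in s -> index (f x) (map f s) = index x s.
Proof.
elim: s => //= y s IHs f_inj; rewrite inE => /predU1P[->|xs]; first by rewrite !eqxx.
rewrite (inj_in_eq f_inj) ?mem_head ?inE ?xs ?orbT // IHs // => a b a_s b_s.
by apply: f_inj; rewrite inE ?a_s ?b_s orbT.
Qed.

Fixpoint digit_words (ns : seq nat) : seq (seq nat) :=
  if ns is n :: ns' then [seq k :: v | k <- iota 0 n, v <- digit_words ns'] else [:: [::]].

Fixpoint radix_value (ns v : seq nat) : nat :=
  match ns, v with
  | _ :: ns', k :: v' => k * (\prod_(n <- ns') n) + radix_value ns' v'
  | _, _ => 0
  end.

Lemma size_digit_words ns : size (digit_words ns) = \prod_(n <- ns) n.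
Proof.
by elim: ns => [|n ns IHns]; rewrite ?big_nil //= size_allpairs size_iota IHns big_cons.
Qed.

Lemma mem_digit_words ns v : (v \in digit_words ns) = all2 ltn v ns.
Proof.
elim: ns v => [|n ns IHns] [|k v] //=; first by apply/negP=> /allpairsP[[i w] []].
rewrite -IHns; apply/allpairsP/andP=> [[[i w] /= [i_n w_ns [-> ->]]]|[lt_k v_ns]].
  by move: i_n; rewrite mem_iota.
by exists (k, v); rewrite mem_iota.
Qed.

Lemma digit_words_uniq ns : uniq (digit_words ns).
Proof.
elim: ns => //= n ns IHns; apply: allpairs_uniq => //; first exact: iota_uniq.
by move=> [i v] [j w] _ _ [-> ->].
Qed.

Lemma digit_words_cat ns ms :
  digit_words (ns ++ ms) = [seq v ++ w | v <- digit_words ns, w <- digit_words ms].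
Proof.
elim: ns => [|n ns IHns] /=; first by rewrite cats0 map_id.
rewrite IHns; elim: (iota 0 n) => //= k l ->; rewrite allpairs_cat; congr (_ ++ _).
by rewrite allpairs_mapl map_allpairs.
Qed.

Lemma nth_digit_words ns v : v \in digit_words ns ->
  radix_value ns v < size (digit_words ns) /\ nth [::] (digit_words ns) (radix_value ns v) = v.
Proof.
rewrite mem_digit_words; elim: ns v => [|n ns IHns] [|k v] //= /andP[lt_k /IHns[lt_v nth_v]].
rewrite size_allpairs size_iota -size_digit_words; split; last first.
  by rewrite (nth_allpairs _ 0 [::]) ?size_iota // nth_iota // nth_v.
apply: leq_trans (_ : k.+1 * size (digit_words ns) <= _); last by rewrite leq_mul2r lt_k orbT.
by rewrite mulSn addnC ltn_add2r.
Qed.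

Lemma index_digit_words ns v :
  v \in digit_words ns -> index v (digit_words ns) = radix_value ns v.
Proof.
by case/nth_digit_words=> lt_v {1}<-; rewrite index_uniq ?digit_words_uniq.
Qed.

(* The length of the input, the order [N] of the group, the address of a copy
   of the table, the output address, and an auxiliary loop index. *)
Definition length_reg := 0.
Definition order_reg := 1.
Definition table_reg := 2.
Definition out_reg := 3.
Definition index_reg := 4.

Section Enumeration.
Variable p : nat.

(* A digit ranges over the elements of the group or over the residues mod [p]. *)
Definition boundE (b : bool) := if b then EReg order_reg else EConst p.
Definition weightE (bs : seq bool) := foldr (fun b => EMul (boundE b)) (EConst 1) bs.

Definition nest (xs : seq (nat * bool)) (c : cmd) : cmd :=
  foldr (fun xb => For xb.1 (boundE xb.2)) c xs.

Definition emit (e : expr) : cmd :=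
  CSeq (Put (EReg out_reg) e) (Asg out_reg (EAdd (EReg out_reg) (EConst 1))).

(* Adds 1 while [index_reg ^ 2 < length_reg]. *)
Definition rootE := EAdd (EReg order_reg) (ESub (EConst 1) (ESub (EConst 1)
  (ESub (EReg length_reg) (EMul (EReg index_reg) (EReg index_reg))))).

(* The copy is placed beyond the cells of the output. *)
Definition load_table (bs : seq bool) : cmd :=
  CSeq (Asg length_reg (EMem (EConst 0)))
  (CSeq (For index_reg (EReg length_reg) (Asg order_reg rootE))
  (CSeq (Asg table_reg (EAdd (weightE bs) (EConst 1)))
        (For index_reg (EReg length_reg) (Put (EAdd (EReg table_reg) (EReg index_reg))
          (EMem (EAdd (EConst 1) (EReg index_reg))))))).

Definition enumerate (xs : seq (nat * bool)) (e : expr) : cmd :=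
  CSeq (load_table (unzip2 xs))
  (CSeq (Asg out_reg (EConst 1))
  (CSeq (nest xs (emit e)) (Put (EConst 0) (ESub (EReg out_reg) (EConst 1))))).

Variable N : nat.
Definition bound (b : bool) := if b then N else p.

Lemma eval_boundE b s : reg s order_reg = N -> eval (boundE b) s = bound b.
Proof. by case: b. Qed.

Lemma eval_weightE bs s : reg s order_reg = N ->
  eval (weightE bs) s = \prod_(n <- map bound bs) n.
Proof.
move=> order_s; elim: bs => [|b bs IHbs]; first by rewrite big_nil.
by rewrite /= big_cons eval_boundE ?IHbs.
Qed.

Lemma factors_le_weightE bs s : reg s order_reg = N -> factors_le (N + p) (weightE bs) s.
Proof.
move=> order_s; elim: bs => //= b bs ->; rewrite eval_boundE //.
by case: b; rewrite ?leq_addl ?leq_addr.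
Qed.

Lemma assigned_nest xs c : assigned (nest xs c) = unzip1 xs ++ assigned c.
Proof. by elim: xs => //= xb xs ->. Qed.

Section Emission.
Variables (base : nat) (table : seq nat).

Definition table_at (s : state) := [/\ reg s order_reg = N, reg s table_reg = base
  & forall k, k < size table -> Defs.mem s (base + k) = nth 0 table k].

Definition emitted (out : seq nat) (s : state) := [/\ table_at s, reg s out_reg = (size out).+1
  & forall i, i < size out -> Defs.mem s i.+1 = nth 0 out i].

Lemma table_at_reg s s' : Defs.mem s' = Defs.mem s -> reg s' order_reg = reg s order_reg ->
  reg s' table_reg = reg s table_reg -> table_at s -> table_at s'.
Proof. by move=> eq_m eq_order eq_table [*]; split; rewrite ?eq_m ?eq_order ?eq_table. Qed.

Lemma emitted_set_reg out s x k : 3 < x -> emitted out s -> emitted out (set_reg s x k).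
Proof.
move=> lt_x [table_s out_s cells]; split=> //; last first.
  by rewrite reg_set_reg ltn_eqF.
by apply: table_at_reg table_s => //; rewrite reg_set_reg ltn_eqF // (ltn_trans _ lt_x).
Qed.

Definition emits (regs vals : seq nat) (c : cmd) (T : nat) (out' : seq nat) :=
  forall out s, size out + size out' < base -> emitted out s -> [seq reg s r | r <- regs] = vals ->
  cost c s <= T /\ emitted (out ++ out') (run c s).

Lemma emits_emit regs vals e val T :
  (forall s, table_at s -> [seq reg s r | r <- regs] = vals -> eval e s = val /\ ecost e s <= T) ->
  emits regs vals (emit e) (T + 6) [:: val].
Proof.
move=> eval_e out s lt_base [table_s out_s cells] eq_vals.
have [val_e cost_e] := eval_e s table_s eq_vals; rewrite addn1 in lt_base.
split; first by rewrite /=; lia.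
have [order_s base_s tab_s] := table_s; split.
- split=> // k lt_k; rewrite /= /upd -tab_s // ifN // out_s; apply/eqP; lia.
- by rewrite /= /upd eqxx out_s size_cat !addn1.
move=> i; rewrite size_cat addn1 ltnS /= /upd out_s eqSS nth_cat leq_eqVlt => /predU1P[->|lt_i].
  by rewrite eqxx ltnn subnn val_e.
by rewrite (ltn_eqF lt_i) lt_i cells.
Qed.

Lemma emits_for regs vals x b c T (g : nat -> seq nat) :
  3 < x -> x \notin regs -> {in regs, forall r, r \notin assigned c} ->
  (forall k, k < bound b -> emits (rcons regs x) (rcons vals k) c T (g k)) ->
  emits regs vals (For x (boundE b) c) (4 + bound b * (T + 4))
    (flatten [seq g k | k <- iota 0 (bound b)]).
Proof.
move=> lt_x x_regs frame_c emits_c out s lt_base emitted_s eq_vals.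
pose I k s' := emitted (out ++ flatten [seq g i | i <- iota 0 k]) s' /\
  {in regs, forall r, reg s' r = reg s r}.
have [|||le_T [emitted_run _]] := @hoare_for I x (boundE b) c (bound b) 1 T _ _ s.
- by move=> s0 [[[order_s0 _ _] _ _] _]; rewrite eval_boundE //; case: (b).
- move=> k s' lt_k [emitted_s' regs_s']; have split_k : iota 0 (bound b)
      = iota 0 k ++ k :: iota k.+1 (bound b - k.+1).
    by rewrite -{1}(subnKC lt_k) addSnnS iotaD.
  have [||le_T emitted_run] := emits_c k lt_k (out ++ flatten [seq g i | i <- iota 0 k])
    (set_reg s' x k) _ (emitted_set_reg k lt_x emitted_s').
  + apply: leq_ltn_trans lt_base; rewrite split_k map_cat flatten_cat /= !size_cat.
    by rewrite !addnA leq_addr.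
  + rewrite map_rcons reg_set_reg eqxx -eq_vals; congr (rcons _ _).
    apply/eq_in_map => r r_regs; rewrite reg_set_reg ifN ?regs_s' //.
    by apply: contraNneq x_regs => <-.
  split=> //; split; first by rewrite -addn1 iotaD map_cat flatten_cat /= cats0 catA.
  move=> r r_regs; rewrite reg_run ?frame_c // reg_set_reg ifN ?regs_s' //.
  by apply: contraNneq x_regs => <-.
- by split=> //; rewrite cats0.
by split.
Qed.

Definition nest_cost (ns : seq nat) (T : nat) := foldr (fun n t => 4 + n * (t + 4)) T ns.

Lemma emits_nest xs regs vals c T (f : seq nat -> nat) :
  all (ltn 3) (unzip1 xs) -> uniq (regs ++ unzip1 xs) ->
  {in regs ++ unzip1 xs, forall r, r \notin assigned c} ->
  (forall v, v \in digit_words (map bound (unzip2 xs)) ->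
     emits (regs ++ unzip1 xs) (vals ++ v) c T [:: f v]) ->
  emits regs vals (nest xs c) (nest_cost (map bound (unzip2 xs)) T)
    [seq f v | v <- digit_words (map bound (unzip2 xs))].
Proof.
elim: xs regs vals f => [|[x b] xs IHxs] regs vals f /=.
  by move=> _ _ _ emits_c; have := emits_c [::] isT; rewrite !cats0.
move=> /andP[lt_x lt_xs]; rewrite -cat_rcons => uniq_regs frame_c emits_c.
rewrite map_allpairs /allpairs_dep.
have [x_regs disjoint_xs] : x \notin regs /\ {in regs, forall r, r \notin unzip1 xs}.
  move: uniq_regs; rewrite cat_uniq rcons_uniq => /and3P[/andP[-> _] /hasPn disj _].
  by split=> // r r_regs; apply/negP=> /disj; rewrite mem_rcons inE r_regs orbT.
apply: emits_for => // [r r_regs|k lt_k].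
  rewrite assigned_nest mem_cat negb_or disjoint_xs //= frame_c //.
  by rewrite mem_cat mem_rcons inE r_regs orbT.
apply: IHxs => // v v_word; rewrite (cat_rcons k).
by apply: emits_c; apply/allpairsP; exists (k, v); rewrite mem_iota.
Qed.

End Emission.

Section LoadTable.
Variables (bs : seq bool) (table : seq nat).
Hypotheses (size_table : size table = N * N) (base_big : N * N <= \prod_(n <- map bound bs) n).
Let base := (\prod_(n <- map bound bs) n).+1.

Definition input_at (s : state) := reg s length_reg = N * N /\
  forall j, j < N * N -> Defs.mem s j.+1 = nth 0 table j.

Lemma hoare_order : hoare (fun s => input_at s /\ reg s order_reg = 0)
  (For index_reg (EReg length_reg) (Asg order_reg rootE))
  (1 + 3 + N * N * (3 * (N * N) + 20 + 4)) (fun s => input_at s /\ reg s order_reg = N).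
Proof.
pose I k s := input_at s /\ reg s order_reg = minn k N.
have step k s : k < N * N -> I k s -> cost (Asg order_reg rootE) (set_reg s index_reg k)
    <= 3 * (N * N) + 20 /\ I k.+1 (run (Asg order_reg rootE) (set_reg s index_reg k)).
  move=> lt_k [[len_s cells] order_s]; rewrite /= /upd /= len_s order_s; split; first by lia.
  split=> //=; rewrite /upd /=; case: (ltnP k N) => [lt_kN|le_Nk].
    by have : k * k < N * N by [apply: ltn_mul]; lia.
  by have : N * N <= k * k by [apply: leq_mul]; lia.
move=> s [input_s order_s].
have [||le_T [input_s' order_s']] :=
    @hoare_for I index_reg (EReg length_reg) _ (N * N) 1 _ _ step s.
- by move=> s' [[len_s' _] _].
- by rewrite /I order_s min0n.
split=> //; split=> //; rewrite order_s'; apply/minn_idPr.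
by case: (N) => // n; rewrite leq_pmulr.
Qed.

Lemma hoare_copy_table : hoare
  (fun s => [/\ input_at s, reg s order_reg = N & reg s table_reg = base])
  (For index_reg (EReg length_reg) (Put (EAdd (EReg table_reg) (EReg index_reg))
    (EMem (EAdd (EConst 1) (EReg index_reg)))))
  (1 + 3 + N * N * (8 + 4)) (table_at base table).
Proof.
pose I k s := [/\ input_at s, reg s order_reg = N, reg s table_reg = base
  & forall j, j < k -> Defs.mem s (base + j) = nth 0 table j].
move=> s [input_s order_s base_s].
have [|||le_T [_ order_s' base_s' copied]] := @hoare_for I index_reg (EReg length_reg)
  (Put (EAdd (EReg table_reg) (EReg index_reg)) (EMem (EAdd (EConst 1) (EReg index_reg))))
  (N * N) 1 8 _ _ s.
- by move=> s' [[len_s' _] _ _ _].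
- move=> k s' lt_k [[len_s' cells] order_s' base_s' copied]; split; first by rewrite /=; lia.
  split=> //; first split=> // j lt_j; rewrite /= /upd /= base_s'.
    by rewrite ifN ?cells //; apply/eqP; rewrite /base; lia.
  move=> j; rewrite eqn_add2l ltnS leq_eqVlt => /predU1P[->|lt_j].
    by rewrite eqxx cells.
  by rewrite (ltn_eqF lt_j) copied.
- by [].
by split=> //; split; rewrite ?size_table.
Qed.

Definition load_cost := 3 + ((1 + 3 + N * N * (3 * (N * N) + 20 + 4))
  + ((esize (weightE bs) * (3 * (N + p) + 4) + 3) + (1 + 3 + N * N * (8 + 4)))).

Lemma hoare_load_table :
  hoare (eq (input_state table)) (load_table bs) load_cost (table_at base table).
Proof.
apply: hoare_seq (hoare_seq hoare_order (hoare_seq _ hoare_copy_table)) => [_ <-|].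
  by rewrite /= /upd /= size_table.
move=> s [[len_s cells] order_s]; split; last first.
  by split; rewrite //= /upd /= ?eval_weightE ?addn1.
by have := ecost_le (factors_le_weightE bs order_s); rewrite /=; lia.
Qed.

End LoadTable.

Definition enumeration_cost (bs : seq bool) (T : nat) :=
  load_cost bs + (2 + (nest_cost (map bound bs) (T + 6) + 6)).

Lemma run_enumerate xs (table : seq nat) e (f : seq nat -> nat) T
    (base := (\prod_(n <- map bound (unzip2 xs)) n).+1) :
  size table = N * N -> N * N < base -> all (ltn 3) (unzip1 xs) -> uniq (unzip1 xs) ->
  (forall v s, v \in digit_words (map bound (unzip2 xs)) -> table_at base table s ->
     [seq reg s r | r <- unzip1 xs] = v -> eval e s = f v /\ ecost e s <= T) ->
  cost (enumerate xs e) (input_state table) <= enumeration_cost (unzip2 xs) T /\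
  output_word (run (enumerate xs e) (input_state table))
    = [seq f v | v <- digit_words (map bound (unzip2 xs))].
Proof.
move=> size_table base_big gt3_xs uniq_xs eval_e.
have start : hoare (table_at base table) (Asg out_reg (EConst 1)) 2 (emitted base table [::]).
  by move=> s table_s; split.
have enum : hoare (emitted base table [::]) (nest xs (emit e))
    (nest_cost (map bound (unzip2 xs)) (T + 6))
    (emitted base table [seq f v | v <- digit_words (map bound (unzip2 xs))]).
  move=> s emitted_s.
  apply: (@emits_nest base table xs [::] [::] _ _ f _ _ _ _ [::]) => // [r r_xs|v v_word|].
  - by rewrite /= inE; apply: contraTneq (allP gt3_xs r r_xs) => ->.
  - by apply: emits_emit => s' table_s'; apply: eval_e.
  by rewrite size_map size_digit_words.
have stop out : hoare (emitted base table out) (Put (EConst 0) (ESub (EReg out_reg) (EConst 1))) 6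
    (fun s => output_word s = out).
  move=> s [_ out_s cells]; split=> //; rewrite /output_word /= /upd /= out_s subn1 /=.
  by apply: (@eq_from_nth _ 0) => [|i]; rewrite size_mkseq // => lt_i; rewrite nth_mkseq ?cells.
exact: (hoare_seq (hoare_load_table size_table base_big)
  (hoare_seq start (hoare_seq enum (stop _))) (erefl _)).
Qed.

End Enumeration.

(** * The multiplication table of the gadget *)

Section Expressions.
Variable p : nat.

Definition tableE (e1 e2 : expr) : expr :=
  EMem (EAdd (EReg table_reg) (EAdd (EMul e1 (EReg order_reg)) e2)).

Definition powE (e : expr) (n : nat) : expr := iter n (tableE e) e.

(* The position of the unit is not known: it is computed as [e1 ^+ p]. *)
Definition wordE (w : seq bool) (e1 e2 : expr) : expr :=
  foldr (fun b => tableE (if b then e1 else e2)) (powE e1 p.-1) w.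

(* The value is 1 or 0, by truncated subtraction. *)
Definition equalE (e : expr) (k : nat) : expr :=
  ESub (EConst 1) (EAdd (ESub e (EConst k)) (ESub (EConst k) e)).

Fixpoint selectE (es e : expr) (ks : seq nat) : expr :=
  if ks is k :: ks' then EAdd (EMul (equalE es k) (powE e (k + p.-1))) (selectE es e ks')
  else EConst 0.

(* Selects among the values of [e ^+ k], in the form [e ^+ (k + p)]. *)
Definition scaleE (es e : expr) : expr := selectE es e (iota 0 p).

Definition addmodE (e1 e2 : expr) : expr :=
  ESub (EAdd e1 e2) (EMul (ESub (EConst 1) (ESub (EConst p) (EAdd e1 e2))) (EConst p)).

Fixpoint radixE (bs : seq bool) (es : seq expr) : expr :=
  match bs, es with
  | _ :: bs', e :: es' => EAdd (EMul e (weightE p bs')) (radixE bs' es')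
  | _, _ => EConst 0
  end.

Definition evaluates (V : nat) (s : state) (e : expr) (n : nat) := eval e s = n /\ factors_le V e s.

Section Evaluation.
Variables (gT : finGroupType) (sG : seq gT) (base : nat) (s : state).
Hypotheses (p_gt0 : 0 < p) (sG_full : forall x, x \in sG).
Local Notation N := (size sG).
Hypothesis table_s : table_at N base [seq index (x * y)%g sG | x <- sG, y <- sG] s.
Local Notation evaluates := (evaluates (N + p) s).
Local Notation denotes e x := (evaluates e (index x sG)).

Let index_lt (x : gT) : index x sG < N. Proof. by rewrite index_mem. Qed.

Lemma evaluates_table e1 e2 x1 x2 :
  denotes e1 x1 -> denotes e2 x2 -> denotes (tableE e1 e2) (x1 * x2)%g.
Proof.
have [order_s base_s cells] := table_s; move=> [eval1 le1] [eval2 le2]; split; last first.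
  by rewrite /= le1 le2 eval1 (leq_trans (ltnW (index_lt x1))) ?leq_addr.
rewrite /= base_s order_s eval1 eval2 cells.
  by rewrite (nth_allpairs _ 1%g 1%g) ?index_lt // !nth_index.
rewrite size_allpairs; apply: leq_trans (_ : (index x1 sG).+1 * N <= _).
  by rewrite mulSn addnC ltn_add2r index_lt.
by rewrite leq_mul2r index_lt orbT.
Qed.

Lemma evaluates_pow e x n : denotes e x -> denotes (powE e n) (x ^+ n.+1)%g.
Proof.
move=> den; elim: n => [|n IHn]; first by rewrite expg1.
by rewrite expgS; apply: evaluates_table.
Qed.

Hypothesis exponent_p : forall x : gT, (x ^+ p = 1)%g.

Lemma evaluates_word w e1 e2 x1 x2 :
  denotes e1 x1 -> denotes e2 x2 -> denotes (wordE w e1 e2) (word_op w x1 x2).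
Proof.
move=> den1 den2; elim: w => [|b w IHw].
  by rewrite word_op_nil -(exponent_p x1) -{2}(prednK p_gt0); apply: evaluates_pow.
by rewrite word_op_cons; apply: evaluates_table => //; case: b.
Qed.

Lemma evaluates_equal e n k : evaluates e n -> evaluates (equalE e k) (n == k).
Proof.
case=> eval_e le_e; split; last by rewrite /= le_e.
by rewrite /= eval_e; case: eqP => /=; lia.
Qed.

Lemma evaluates_select es e k x ks : uniq ks -> evaluates es k -> denotes e x ->
  evaluates (selectE es e ks) ((k \in ks) * index (x ^+ k)%g sG).
Proof.
move=> + eval_k den_x; elim: ks => //= j ks IHks /andP[j_ks /IHks[eval_ks le_ks]].
have [] := evaluates_pow (j + p.-1) den_x; have [] := evaluates_equal j eval_k.
rewrite -addnS (prednK p_gt0) expgD exponent_p mulg1.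
move: (equalE es j) (powE e _) => eqe powe eval_eq le_eq eval_pow le_pow.
split; last first.
  by rewrite /= eval_eq le_pow le_ks le_eq (leq_trans (leq_b1 _)) // addn_gt0 p_gt0 orbT.
rewrite /= eval_eq eval_pow eval_ks inE.
by case: eqP j_ks => [-> /negPf->|_ _]; rewrite ?mul1n ?addn0.
Qed.

Lemma evaluates_scale es e k x : k < p -> evaluates es k -> denotes e x ->
  denotes (scaleE es e) (x ^+ k)%g.
Proof.
move=> lt_k eval_k den_x; have := evaluates_select (iota_uniq 0 p) eval_k den_x.
by rewrite mem_iota lt_k mul1n.
Qed.

Lemma evaluates_addmod e1 e2 a b : a < p -> b < p -> evaluates e1 a -> evaluates e2 b ->
  evaluates (addmodE e1 e2) ((a + b) %% p).
Proof.
move=> lt_a lt_b [eval1 le1] [eval2 le2]; split; last first.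
  by rewrite /= le1 le2 /= andbT (leq_trans (leq_subr _ _)) // addn_gt0 p_gt0 orbT.
rewrite /= eval1 eval2; case: (leqP p (a + b)) => [le_p|lt_p].
  rewrite (_ : 1 - (p - (a + b)) = 1); last by lia.
  by rewrite mul1n -{2}(subnK le_p) modnDr modn_small //; lia.
by rewrite (_ : 1 - (p - (a + b)) = 0) ?mul0n ?subn0 ?modn_small //; lia.
Qed.

Lemma evaluates_radix bs es v : v \in digit_words (map (bound p N) bs) -> size es = size v ->
  (forall i, i < size v -> evaluates (nth (EConst 0) es i) (nth 0 v i)) ->
  evaluates (radixE bs es) (radix_value (map (bound p N) bs) v).
Proof.
have [order_s _ _] := table_s; rewrite mem_digit_words.
elim: bs es v => [|b bs IHbs] [|e es] [|k v] //= /andP[lt_k v_bs] [size_es] eval_es.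
have [eval_e le_e] := eval_es 0 isT.
have [eval_r le_r] := IHbs es v v_bs size_es (fun i => eval_es i.+1).
split; rewrite /= eval_e ?(eval_weightE _ _ order_s) ?eval_r //.
rewrite le_e le_r (factors_le_weightE _ _ order_s) !andbT.
by apply: leq_trans (ltnW lt_k) _; case: (b); rewrite ?leq_addr ?leq_addl.
Qed.

End Evaluation.
End Expressions.

Section GadgetTable.
Variables (p c : nat) (S : lazard_system p c).
Let p_prime := lazard_prime S.
Let p_gt0 := prime_gt0 p_prime.

(* An element of the gadget is coded by its coordinates in [L], [F], [F], [L], [L]. *)
Definition gadget_shape := [:: true; false; false; true; true].

(* The digits of the factors are held by the registers from 5 and from 10 on. *)
Definition product_digits : seq expr :=
  let left i := EReg (5 + i) in let right i := EReg (10 + i) in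
  let add := wordE p (add_word S) in
  [:: add (left 0) (right 0);
      addmodE p (left 1) (right 1);
      addmodE p (left 2) (right 2);
      add (add (left 3) (right 3))
          (add (wordE p (bracket_word S) (left 0) (right 0)) (scaleE p (left 1) (right 0)));
      add (add (left 4) (right 4)) (scaleE p (left 2) (right 0))].

Definition gadget_cmd : cmd :=
  enumerate p (zip (iota 5 10) (gadget_shape ++ gadget_shape))
    (radixE p gadget_shape product_digits).

Definition gadget_program : prog := compile_cmd 15 gadget_cmd.

Definition gadget_time (N : nat) : nat :=
  enumeration_cost p N (gadget_shape ++ gadget_shape)
    (esize (radixE p gadget_shape product_digits) * (3 * (N + p) + 4)).

Lemma expr_below_word K w e1 e2 :
  2 < K -> expr_below K e1 -> expr_below K e2 -> expr_below K (wordE p w e1 e2).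
Proof.
move=> K_gt2 below1 below2; have K_gt1 := ltnW K_gt2.
elim: w => [|b w IHw] /=; last by rewrite K_gt2 K_gt1 IHw !andbT; case: b.
by rewrite /powE; elim: p.-1 => //= n ->; rewrite K_gt2 K_gt1 below1.
Qed.

Lemma expr_below_scale K es e :
  2 < K -> expr_below K es -> expr_below K e -> expr_below K (scaleE p es e).
Proof.
move=> K_gt2 belows below; have K_gt1 := ltnW K_gt2.
rewrite /scaleE; elim: (iota 0 p) => //= k ks ->; rewrite belows andbT /powE.
by elim: (k + _) => //= n ->; rewrite K_gt2 K_gt1 below.
Qed.

Lemma cmd_below_gadget : cmd_below 15 gadget_cmd.
Proof. by rewrite /= !expr_below_word ?expr_below_scale //= ?expr_below_word ?expr_below_scale. Qed.

Variables (gT : finGroupType) (sG : seq gT).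
Hypotheses (G_ce : class_exponent p c gT) (sG_uniq : uniq sG) (sG_full : forall x, x \in sG).
Local Notation N := (size sG).
Local Notation table := [seq index (x * y)%g sG | x <- sG, y <- sG].
Local Notation br := (@lazard_bracket p c S gT G_ce).
Local Notation radices := (map (bound p N) gadget_shape).

Definition gadget_digits (z : gadget br) : seq nat :=
  [:: index (z.1.1 : gT) sG; z.1.2.1 : nat; z.1.2.2 : nat;
      index (z.2.1 : gT) sG; index (z.2.2 : gT) sG].

Definition gadget_of_digits (v : seq nat) : gadget br :=
  (((nth 1%g sG (nth 0 v 0) : lazard_algebra S G_ce), ((nth 0 v 1)%:R, (nth 0 v 2)%:R)),
   ((nth 1%g sG (nth 0 v 3) : lazard_algebra S G_ce),
    (nth 1%g sG (nth 0 v 4) : lazard_algebra S G_ce)))%R.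

Let ltn_Fp (k : 'F_p) : k < p.
Proof. by have := ltn_ord k; rewrite [X in _ < X](Fp_cast p_prime). Qed.

Lemma gadget_digits_word z : gadget_digits z \in digit_words radices.
Proof. by rewrite mem_digit_words /= !index_mem !sG_full !ltn_Fp. Qed.

Lemma gadget_digitsK : cancel gadget_digits gadget_of_digits.
Proof.
by case=> [[x [s t]] [u w]]; rewrite /gadget_of_digits /= !nth_index // !natr_Zp.
Qed.

Lemma gadget_of_digitsK : {in digit_words radices, cancel gadget_of_digits gadget_digits}.
Proof.
have natK k : k < p -> (k%:R%R : 'F_p) = k :> nat by move=> lt_k; rewrite val_Fp_nat // modn_small.
move=> v; rewrite mem_digit_words.
case: v => [|x [|s [|t [|u [|w [|]]]]]]; rewrite //= ?andbF // andbT.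
case/and5P=> lt_x lt_s lt_t lt_u lt_w.
by rewrite /gadget_digits /= !index_uniq ?natK.
Qed.

Lemma evaluates_product base s z z' : table_at N base table s ->
  [seq reg s r | r <- iota 5 10] = gadget_digits z ++ gadget_digits z' ->
  evaluates (N + p) s (radixE p gadget_shape product_digits)
    (radix_value radices (gadget_digits (z * z')%g)).
Proof.
move=> table_s; case: z z' => [[x [a b]] [u w]] [[x' [a' b']] [u' w']].
case=> r5 r6 r7 r8 r9 r10 r11 r12 r13 r14.
have reg_eval r n : reg s r = n -> evaluates (N + p) s (EReg r) n by [].
have den_word := evaluates_word p_gt0 sG_full table_s (proj1 G_ce).
have den_scale := evaluates_scale p_gt0 sG_full table_s (proj1 G_ce).
have den_addmod := evaluates_addmod (sG := sG) (s := s) p_gt0.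
apply: (evaluates_radix table_s) => [||i]; [exact: gadget_digits_word | by [] |].
case: i => [|[|[|[|[|i]]]]] // _ /=.
- by apply: den_word; apply: reg_eval.
- by rewrite [X in _ %% X](Fp_cast p_prime); apply: den_addmod => //; apply: reg_eval.
- by rewrite [X in _ %% X](Fp_cast p_prime); apply: den_addmod => //; apply: reg_eval.
- rewrite lazard_scaleE; apply: (den_word); first by apply: den_word; apply: reg_eval.
  apply: (den_word); first by apply: den_word; apply: reg_eval.
  by apply: den_scale => //; apply: reg_eval.
rewrite lazard_scaleE; apply: (den_word); first by apply: den_word; apply: reg_eval.
by apply: den_scale => //; apply: reg_eval.
Qed.

Definition gadget_list := [seq gadget_of_digits v | v <- digit_words radices].

Lemma gadget_list_uniq : uniq gadget_list.
Proof. by rewrite map_inj_in_uniq ?digit_words_uniq //; apply: can_in_inj gadget_of_digitsK. Qed.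

Lemma mem_gadget_list z : z \in gadget_list.
Proof. by rewrite -(gadget_digitsK z) map_f // gadget_digits_word. Qed.

Lemma index_gadget_list z : index z gadget_list = radix_value radices (gadget_digits z).
Proof.
rewrite -{1}(gadget_digitsK z) index_map_in ?gadget_digits_word //.
  by rewrite index_digit_words ?gadget_digits_word.
exact: can_in_inj gadget_of_digitsK.
Qed.

Lemma gadget_program_correct :
  outputs_within gadget_program table (gadget_time N)
    [seq index (x * y)%g gadget_list | x <- gadget_list, y <- gadget_list].
Proof.
pose f v := radix_value radices
  (gadget_digits (gadget_of_digits (take 5 v) * gadget_of_digits (drop 5 v))%g).
have digits5 v : v \in digit_words radices -> size v = 5.
  by move/gadget_of_digitsK <-.
have N_gt0 : 0 < N by have := sG_full 1%g; case: (sG).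
have [|||||le_time outE] :=
  @run_enumerate p N (zip (iota 5 10) (gadget_shape ++ gadget_shape)) table
    (radixE p gadget_shape product_digits) f
    (esize (radixE p gadget_shape product_digits) * (3 * (N + p) + 4)).
- by rewrite size_allpairs.
- rewrite ltnS unzip2_zip //= !big_cons big_nil /bound.
  have -> : N * (p * (p * (N * (N * (N * (p * (p * (N * (N * 1))))))))) = N * N * (N ^ 4 * p ^ 4).
    by ring.
  by rewrite leq_pmulr // muln_gt0 !expn_gt0 N_gt0 p_gt0.
- by [].
- by [].
- move=> v s; rewrite unzip1_zip // unzip2_zip // map_cat digit_words_cat.
  case/allpairsP=> vw [v_word w_word ->] table_s eq_regs.
  have [|-> /ecost_le] := @evaluates_product _ s (gadget_of_digits vw.1)
    (gadget_of_digits vw.2) table_s; first by rewrite !gadget_of_digitsK.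
  split=> //.
  by rewrite /f take_size_cat ?drop_size_cat ?digits5.
have [s' [[t le_t exec_t] [eq_mem _] _]] := compile_cmd_correct (leqnn 15)
  cmd_below_gadget (agree_below_refl 15 (input_state table)).
exists t, s'; split=> //; first exact: leq_trans le_t le_time.
rewrite /output_word eq_mem -/(output_word _) outE unzip2_zip //.
rewrite map_cat digit_words_cat map_allpairs allpairs_mapl allpairs_mapr.
apply/eq_in_allpairs => v1 v2 v1_word v2_word.
by rewrite /f take_size_cat ?drop_size_cat ?digits5 // index_gadget_list.
Qed.

Lemma cayley_table_gadget : cayley_table [set: gadget br]%G
  [seq index (x * y)%g gadget_list | x <- gadget_list, y <- gadget_list].
Proof.
by exists gadget_list; split=> // [|z]; rewrite ?gadget_list_uniq // inE mem_gadget_list.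
Qed.

End GadgetTable.

Definition polynomial_nat (f : nat -> nat) := exists P : {poly nat}, forall n, f n = P.[n]%R.

Lemma polynomial_nat_const k : polynomial_nat (fun=> k).
Proof. by exists k%:P%R => n; rewrite hornerC. Qed.

Lemma polynomial_nat_id : polynomial_nat id.
Proof. by exists 'X%R => n; rewrite hornerX. Qed.

Lemma polynomial_nat_add f g :
  polynomial_nat f -> polynomial_nat g -> polynomial_nat (fun n => f n + g n).
Proof. by move=> [P fP] [Q gQ]; exists (P + Q)%R => n; rewrite hornerD fP gQ. Qed.

Lemma polynomial_nat_mul f g :
  polynomial_nat f -> polynomial_nat g -> polynomial_nat (fun n => f n * g n).
Proof. by move=> [P fP] [Q gQ]; exists (P * Q)%R => n; rewrite hornerM fP gQ. Qed.

Lemma polynomial_gadget_time p c (S : lazard_system p c) : polynomial_nat (gadget_time S).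
Proof.
rewrite /gadget_time /enumeration_cost /load_cost /nest_cost /bound /=.
repeat first [exact: polynomial_nat_const | exact: polynomial_nat_id
  | apply: polynomial_nat_add | apply: polynomial_nat_mul].
Qed.

(** * The reduction *)

Lemma cayley_table_subg (gT : finGroupType) (G : {group gT}) w : cayley_table G w ->
  exists2 sG : seq (subg_of G), uniq sG /\ (forall x, x \in sG)
    & w = [seq index (x * y)%g sG | x <- sG, y <- sG].
Proof.
move=> [s [s_uniq sG ->]]; exists [seq subg G x | x <- s].
  split=> [|x]; last by rewrite -(sgvalK x) map_f // sG subgP.
  rewrite map_inj_in_uniq // => x y; rewrite !sG => Gx Gy /(congr1 sgval).
  by rewrite !subgK.
rewrite allpairs_mapl allpairs_mapr; apply/eq_in_allpairs => x y; rewrite !sG => Gx Gy.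
rewrite -subgM // index_map_in ?sG ?groupM // => x' y'; rewrite !sG => Gx' Gy' /(congr1 sgval).
by rewrite !subgK.
Qed.

Lemma isog_in_B p c N (gT hT : finGroupType) (G : {group gT}) (H : {group hT}) :
  (G \isog H)%g -> in_B p c N G -> in_B p c N H.
Proof.
move=> isoGH [pG clG expG cardG]; have nilG := pgroup_nil pG.
split; [by rewrite -(isog_pgroup _ isoGH) | by rewrite -(isog_nil_class isoGH) | |].
  by rewrite -(exponent_isog isoGH).
by rewrite -(card_isog isoGH).
Qed.

Section InB.
Variables (p c N : nat).
Hypotheses (p_prime : prime p) (c_gt0 : 0 < c).

Section Group.
Variable gT : finGroupType.
Hypothesis BG : in_B p c N [set: gT]%G.

Lemma in_B_class_exponent : class_exponent p c gT.
Proof.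
have [pG clG expG _] := BG; split=> [x|]; first by rewrite -expG expg_exponent ?inE.
by apply/(lcn_nil_classP c (pgroup_nil pG)); rewrite clG.
Qed.

Lemma in_B_card_gt1 : 1 < #|gT|.
Proof.
have [_ clG _ _] := BG; rewrite -cardsT cardG_gt1; apply: contraTneq c_gt0 => G1.
by rewrite -clG lt0n negbK nil_class0 G1.
Qed.

Lemma in_B_abelian : abelian [set: gT] = (c == 1).
Proof. by have [_ clG _ _] := BG; rewrite -nil_class1 clG; case: (c) c_gt0 => [|[|]]. Qed.

Lemma in_B_card_gt_square : c != 1 -> p ^ 2 < #|gT|.
Proof.
rewrite -in_B_abelian ltnNge; apply: contra => le_p2; have [pG _ _ _] := BG.
have nt : [set: gT] != 1%g by rewrite -cardG_gt1 cardsT in_B_card_gt1.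
have [_ _ [m cardG]] := pgroup_pdiv pG nt; apply: (p2group_abelian pG).
by rewrite cardG pfactorK //; move: le_p2; rewrite -cardsT cardG leq_exp2l ?prime_gt1.
Qed.

End Group.

Lemma in_B_class1_isog (gT hT : finGroupType) : c = 1 ->
  in_B p c N [set: gT]%G -> in_B p c N [set: hT]%G -> ([set: gT] \isog [set: hT])%g.
Proof.
move=> c1 BG BH; have abel (kT : finGroupType) : in_B p c N [set: kT]%G -> (p.-abelem [set: kT])%g.
  move=> BK; rewrite abelemE // (in_B_abelian BK) c1 /=.
  by have [_ _ -> _] := BK.
have [[_ _ _ cardG] [_ _ _ cardH]] := (BG, BH).
by rewrite (isog_abelem_card _ (abel _ BG)) abel // cardG cardH /=.
Qed.

End InB.

Section LazardGadget.
Variables (p c : nat) (S : lazard_system p c).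
Hypothesis p_gt2 : 2 < p.
Let p_prime := lazard_prime S.
Let c_gt0 := lazard_class_gt0 S.

Section Construction.
Variables (N : nat) (gT : finGroupType).
Hypotheses (BG : in_B p c N [set: gT]%G) (G_ce : class_exponent p c gT).
Local Notation br := (@lazard_bracket p c S gT G_ce).

Lemma lazard_gadget_in_B : in_B p 2 (N ^ 3 * p ^ 2) [set: gadget br]%G.
Proof.
have [pG _ _ <-] := BG; have card_Fp := card_Fp p_prime.
have := @gadget_in_B _ _ br p; rewrite card_Fp cardsT; apply.
- by case: (even_prime p_prime) p_gt2 => [->|].
- exact: pchar_Fp.
- exact: (in_B_card_gt1 c_gt0 BG).
- by move: pG; rewrite /pgroup cardsT.
exact: pnat_id.
Qed.

Lemma gadget_program_cayley_table (sG : seq gT) : uniq sG -> (forall x, x \in sG) ->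
  exists2 out, outputs_within (gadget_program S) [seq index (x * y)%g sG | x <- sG, y <- sG]
    (gadget_time S N) out & cayley_table [set: gadget br]%G out.
Proof.
move=> sG_uniq sG_full; have size_sG : size sG = N.
  have [_ _ _ <-] := BG; rewrite cardsT -(card_uniqP sG_uniq).
  by apply: eq_card => x; rewrite sG_full.
pose elements := gadget_list S sG G_ce.
exists [seq index (x * y)%g elements | x <- elements, y <- elements].
  by rewrite -size_sG; apply: gadget_program_correct.
exact: cayley_table_gadget.
Qed.

Lemma lazard_bracket_nil_alternating : nil_alternating br.
Proof.
have [pG _ _ _] := BG; split=> [x|x y|].
- exact: lazard_bracket_commute.
- by exists c; apply: lazard_engel.
have : 'Z([set: gT])%g != 1%g.
  by rewrite center_nil_eq1 ?(pgroup_nil pG) // -cardG_gt1 cardsT (in_B_card_gt1 c_gt0 BG).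
case/trivgPn=> z /centerP[_ Zz] z1; exists (z : lazard_algebra S G_ce) => // y.
by apply: lazard_bracket_commute G_ce _ _ _; apply: Zz; rewrite inE.
Qed.

Lemma lazard_bracket_neq0 : c != 1 -> exists x y, br x y != 0%R.
Proof.
rewrite -(in_B_abelian c_gt0 BG) => nabG.
have [/forallP br0|] := boolP [forall x, [forall y, br x y == 0%R]].
  case/negP: nabG; apply: (lazard_bracket_trivial_abelian (S := S)) => // x y.
  by have /forallP/(_ y)/eqP := br0 x.
by case/forallPn=> x /forallPn[y br_xy]; exists x, y.
Qed.

End Construction.

Lemma lazard_gadget_isog N (gT hT : finGroupType)
    (G_ce : class_exponent p c gT) (H_ce : class_exponent p c hT) :
  in_B p c N [set: gT]%G -> in_B p c N [set: hT]%G ->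
  ([set: gT] \isog [set: hT])%g <->
  ([set: gadget (@lazard_bracket p c S gT G_ce)]
     \isog [set: gadget (@lazard_bracket p c S hT H_ce)])%g.
Proof.
move=> BG BH; split=> [/isog_setTP[f fM f_bij]|gadget_iso].
  apply: (@algebra_gadget_isog _ _ _ (@lazard_bracket p c S gT G_ce)
    (@lazard_bracket p c S hT H_ce) f f_bij) => [|x y].
    by apply: Fp_linear => x y; apply: (word_op_morph (add_word S) fM).
  exact: (word_op_morph (bracket_word S) fM).
have [c1|c_neq1] := eqVneq c 1; first exact: (in_B_class1_isog p_prime c_gt0 c1 BG BH).
have [||||||f [f_bij fD f_br]] := gadget_isog_algebra _ _ _ _ _ _ gadget_iso.
- exact: lazard_bracket_nil_alternating BG _.
- exact: lazard_bracket_nil_alternating BH _.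
- by rewrite -(dvdn_pcharf (pchar_Fp p_prime)) gtnNdvd.
- by have [[_ _ _ <-] [_ _ _]] := (BG, BH); rewrite !cardsT.
- by rewrite card_Fp //; apply: (in_B_card_gt_square p_prime c_gt0 BH c_neq1).
- exact: lazard_bracket_neq0 BH _ c_neq1.
by apply/isog_setTP; exists f => //; apply: lazard_morph G_ce H_ce fD f_br.
Qed.

End LazardGadget.

Theorem theorem1p2 (p c : nat) (p_prime : prime p) (c_gt0 : 0 < c)
    (c_lt_p : c < p) (not_2_1 : ~ (p = 2 /\ c = 1)) :
  exists (A : prog) (time order : {poly nat}),
    forall (N : nat) (gT hT : finGroupType) (G : {group gT}) (H : {group hT})
           (v w : seq nat),
      in_B p c N G -> in_B p c N H ->
      cayley_table G v -> cayley_table H w ->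
      exists (v' w' : seq nat) (aT bT : finGroupType)
             (AG : {group aT}) (AH : {group bT}) (M M' : nat),
        [/\ outputs_within A v time.[N]%R v' /\
              outputs_within A w time.[N]%R w',
            cayley_table AG v' /\ cayley_table AH w',
            in_B p 2 M AG /\ in_B p 2 M' AH,
            M <= order.[N]%R /\ M' <= order.[N]%R
          & (G \isog H)%g <-> (AG \isog AH)%g].
Proof.
have p_gt2 : 2 < p by lia.
have [S] := lazard_system_inhabited p_prime c_lt_p c_gt0.
have [time timeE] := polynomial_gadget_time S.
exists (gadget_program S), time, ('X^3 * (p ^ 2)%N%:P)%R => N gT hT G H v w BG BH tabG tabH.
have [sG [sG_uniq sG_full] ->] := cayley_table_subg tabG.
have [sH [sH_uniq sH_full] ->] := cayley_table_subg tabH.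
have [isoG isoH] := (isog_subg G, isog_subg H).
have [BsG BsH] := (isog_in_B isoG BG, isog_in_B isoH BH).
have [G_ce H_ce] := (in_B_class_exponent BsG, in_B_class_exponent BsH).
have [v' runG tabG'] := gadget_program_cayley_table S BsG G_ce sG_uniq sG_full.
have [w' runH tabH'] := gadget_program_cayley_table S BsH H_ce sH_uniq sH_full.
have orderE : ('X^3 * (p ^ 2)%N%:P : {poly nat}).[N]%R = N ^ 3 * p ^ 2.
  by rewrite hornerM hornerXn hornerC.
exists v', w', (gadget (@lazard_bracket p c S _ G_ce)), (gadget (@lazard_bracket p c S _ H_ce)).
exists [set: _]%G, [set: _]%G, (N ^ 3 * p ^ 2), (N ^ 3 * p ^ 2).
rewrite -timeE orderE; split=> //; first by split; apply: lazard_gadget_in_B.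
rewrite (isog_transl _ isoG) (isog_transr _ isoH).
exact: (lazard_gadget_isog S p_gt2 G_ce H_ce BsG BsH).
Qed.
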